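(* The asymptotic behavior of $d_{2n}$ for large $n$ is given by $$d_{2n}=\left(1+O\left(n^{-1/10}\right)\right)D\,n^{4/3}\exp\left(-E\,n^{2/3}\right)$$ as $n\to\infty$, where $D,E$ are the constants $$D=\frac{128\times2^{1/3}\pi^{2/3}e^{-2\pi/3}}{\sqrt3},\qquad E=3(4\pi)^{1/3}.$$
   Context: For $x>0$ let $\omega(x)=\sum_{m=1}^\infty(2\pi^2m^4x^2-3\pi m^2x)e^{-\pi m^2x}$. For $n\ge0$ define $$d_n=\frac{(3/2)_n}{2^{n-3/2}\,n!}\int_0^\infty\frac{\omega(x)}{(x+1)^{3/2}}\left(\frac{x-1}{x+1}\right)^n{}_2F_1\left(\frac n2+\frac34,\frac n2+\frac54;n+2;\left(\frac{x-1}{x+1}\right)^2\right)dx$$ (an absolutely convergent integral). Here $(a)_n=a(a+1)\cdots(a+n-1)$ is the Pochhammer symbol and ${}_2F_1$ is the Gauss hypergeometric function. *)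

(* Defs.v *)
From HB Require Import structures.
From mathcomp Require Import all_boot all_order all_algebra.
From mathcomp Require Import all_classical all_reals all_analysis.

Set Implicit Arguments.
Unset Strict Implicit.
Unset Printing Implicit Defensive.

Import Order.TTheory GRing.Theory Num.Theory.
Import numFieldNormedType.Exports.

Local Open Scope classical_set_scope.
Local Open Scope ring_scope.

Definition pochhammer (R : realType) (a : R) (n : nat) : R :=
  \prod_(i < n) (a + i%:R).

(* The defining power series: it is the Gauss function where it converges, in
   particular for `|z| < 1 when c is not a nonpositive integer. *)
Definition hyp2F1 (R : realType) (a b c z : R) : R :=
  limn [series pochhammer a k * pochhammer b k / (pochhammer c k * k`!%:R)
               * z ^+ k]_k.

Definition omega (R : realType) (x : R) : R :=
  limn (fun N : nat => \sum_(1 <= m < N)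
    ((2 * pi ^+ 2 * m%:R ^+ 4 * x ^+ 2 - 3 * pi * m%:R ^+ 2 * x)
     * expR (- (pi * m%:R ^+ 2 * x)))).

Definition d_integrand (R : realType) (n : nat) (x : R) : R :=
  omega x / (x + 1) `^ (3 / 2) * ((x - 1) / (x + 1)) ^+ n
  * hyp2F1 (n%:R / 2 + 3 / 4) (n%:R / 2 + 5 / 4) (n%:R + 2)
      (((x - 1) / (x + 1)) ^+ 2).

Definition d_coef (R : realType) (n : nat) : R :=
  pochhammer (3 / 2) n / (2 `^ (n%:R - 3 / 2) * n`!%:R)
  * \int[lebesgue_measure]_(x in `]0, +oo[) d_integrand n x.

Definition constD (R : realType) : R :=
  128 * 2 `^ (1 / 3) * pi `^ (2 / 3) * expR (- (2 * pi / 3)) / Num.sqrt 3.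

Definition constE (R : realType) : R := 3 * (4 * pi) `^ (1 / 3).

(* Main.v *)
Require Import Defs.
From mathcomp Require Import all_boot all_order all_algebra ring lra zify.
From mathcomp Require Import all_classical all_reals all_analysis.
From mathcomp Require Import measurable_realfun.

(** The integrand of [d_N], for [N = 2 n], is continuous, nonnegative and, up to the
    factor [x^2], invariant under [x -> 1/x]; so the integral is twice an integral over
    [x >= 1], where it is treated by Laplace's method in the variable [r = sqrt x].

    The Gauss function [2F1(b/2, (b+1)/2; b+1/2; z^2)], [b = N + 3/2], depends on the
    large parameter as well as on [z], and needs a uniform two-sided bound. If the third
    parameter is replaced by [b + 1], the function becomes
    [(2 / (1 + s))^b] with [s = sqrt (1 - z^2)] ([p_closed], by a first-order
    differential system). The ratio of the coefficients of the two series
    behaves like the square root of a linear function of the index, and is therefore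
    squeezed between tangents whose series have closed forms as well. This gives
    [hyp2F1_le] and [hyp2F1_ge]: the Gauss function equals
    [(2 / (1 + s))^b sqrt ((1 + s) / (2 s))] up to a relative error of order [1 / (b s)].
    For [x = r^2] one has [s = 2 r / (1 + r^2)], everything is rational up to one square
    root, and the integrand is, up to constants,
    [omega(r^2) ((r - 1) / (r + 1))^N / ((1 + r)^2 sqrt r)].

    The symmetry of the integrand comes from [omega(1/x) = sqrt x omega(x)]
    ([omega_inversion]), obtained by differentiating Jacobi's functional equation of the
    theta function twice. Jacobi's equation ([theta_inversion]) is proved by Polya's
    method: the average of [(2 cos)^(2m)] over roots of unity is a sum of binomial
    coefficients ([discrete_theta]), and for [m ~ l^2 / t] both sides converge to theta
    series by Tannery's theorem. The limit produces the constant
    [lim 16^(-m) binomial(2m, m)^2 m], and the equation itself, at its fixed point, shows that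
    this constant is [1 / pi] ([wallisE]); this is also what the asymptotics of the factor
    [(3/2)_N / N!] requires ([prefactor_bounds]).

    For [r >= 1], [omega(r^2)] is [2 pi^2 r^4 exp (- pi r^2)] up to a relative error
    of order [1 / r], and [((r - 1) / (r + 1))^N] is about
    [exp (- 4 n / r - (4/3) n / r^3)]. With [2 n = pi al^3] the dominant exponent is
    [pi r^2 + 4 n / r = 3 pi al^2 + pi (r - al)^2 (1 + 2 al / r)], a square around [al]
    that looks like [3 pi (r - al)^2] near its centre, while the correction
    [(4/3) n / r^3] tends to [2 pi / 3]. After division by its size at [al]
    the integrand, extended by 0 to [r < 1], thus differs from
    [exp (- 2 pi / 3) exp (- 3 pi (r - al)^2)] by at most a constant times
    [exp (- (r - al)^2) / al], for all [r] ([saddle_pointwise]).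
    Integrating yields [exp (- 2 pi / 3) / sqrt 3] with an error of order
    [1 / al], that is [n^(-1/3)]; rewriting the constants in terms of [n]
    is [main_termE]. *)

Set Implicit Arguments.
Unset Strict Implicit.
Unset Printing Implicit Defensive.

Import Order.TTheory GRing.Theory Num.Theory.
Import numFieldNormedType.Exports.

Local Open Scope classical_set_scope.
Local Open Scope ring_scope.

(** * Pointwise derivatives *)

Section PointwiseDerivatives.
Variable R : realType.
Implicit Types (f g : R -> R) (x a b : R).

Lemma is_derive_addf f g x a b : is_derive x (1 : R) f a -> is_derive x (1 : R) g b ->
  is_derive x (1 : R) (fun y => f y + g y) (a + b).
Proof. by move=> df dg; apply: is_deriveD. Qed.

Lemma is_derive_subf f g x a b : is_derive x (1 : R) f a -> is_derive x (1 : R) g b ->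
  is_derive x (1 : R) (fun y => f y - g y) (a - b).
Proof. by move=> df dg; apply: is_deriveB. Qed.

Lemma is_derive_mulf f g x a b : is_derive x (1 : R) f a -> is_derive x (1 : R) g b ->
  is_derive x (1 : R) (fun y => f y * g y) (a * g x + f x * b).
Proof.
move=> df dg; rewrite -[fun y => _]/(f * g); apply: is_derive_eq.
by rewrite /GRing.scale /= addrC mulrC.
Qed.

Lemma is_derive_mulcf c f x a : is_derive x (1 : R) f a ->
  is_derive x (1 : R) (fun y => c * f y) (c * a).
Proof.
by move=> df; have := is_derive_mulf (is_derive_cst c x 1) df; rewrite mul0r add0r.
Qed.

Lemma is_derive_compf f g x a b : is_derive (g x) (1 : R) f a -> is_derive x (1 : R) g b ->
  is_derive x (1 : R) (fun y => f (g y)) (a * b).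
Proof. by move=> df dg; apply: is_derive1_comp. Qed.

Lemma is_derive_invf f x a : is_derive x (1 : R) f a -> f x != 0 ->
  is_derive x (1 : R) (fun y => (f y)^-1) (- a / f x ^+ 2).
Proof.
move=> df fx; have := is_deriveV fx df.
by rewrite /GRing.scale /= mulrC mulNr mulrN.
Qed.

Lemma mvt_closed (f df : R -> R) (a b : R) : a <= b ->
  (forall x, a <= x <= b -> is_derive x (1 : R) f (df x)) ->
  exists c, a <= c <= b /\ f b - f a = df c * (b - a).
Proof.
move=> ab fd.
have [||c] := @MVT_segment _ f df a b ab.
- by move=> x; rewrite in_itv/= => /andP[? ?]; apply: fd; rewrite !ltW.
- apply: derivable_within_continuous => x; rewrite in_itv/= => xab.
  by have [] := fd x xab.
- by rewrite in_itv/= => cab ->; exists c.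
Qed.

End PointwiseDerivatives.
Arguments is_derive_compf {R} f g {x a b}.

(** * Power series converging in the unit disc *)

Section PowerSeries.
Variable R : realType.
Implicit Types (c d : nat -> R) (x y : R).

(** Radius of convergence at least 1, phrased by boundedness so that it passes to
    linear combinations, derivatives and shifts without computing any radius. *)
Definition tempered c :=
  forall x, 0 <= x < 1 -> exists K, forall k, `|c k| * x ^+ k <= K.

Definition psum c x : R := limn (pseries c x).

Lemma tempered_le c d : (forall k, `|c k| <= `|d k|) -> tempered d -> tempered c.
Proof.
move=> cd td x x01; have [K HK] := td x x01; exists K => k.
apply: le_trans (HK k); apply: ler_wpM2r (cd k).
by rewrite exprn_ge0//; lra.
Qed.

Lemma tempered_bounded c K : (forall k, `|c k| <= K) -> tempered c.
Proof.
move=> cK x /andP[x0 x1]; exists K => k.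
apply: le_trans (cK k); rewrite ler_piMr// exprn_ile1//; exact: ltW.
Qed.

Lemma eventually_nonincreasing_bounded c (k0 : nat) :
  (forall k, (k0 <= k)%N -> `|c k.+1| <= `|c k|) -> exists K, forall k, `|c k| <= K.
Proof.
move=> h; exists (\sum_(i < k0.+1) `|c i|) => k.
have base j : (j <= k0)%N -> `|c j| <= \sum_(i < k0.+1) `|c i|.
  move=> jk; rewrite (bigD1 (Ordinal (jk : (j < k0.+1)%N)))//= lerDl sumr_ge0//.
elim: k => [|k IH]; first exact: base.
have [kk|kk] := leqP k.+1 k0; first exact: base.
by apply: le_trans (h _ _) IH.
Qed.

Lemma tempered_lin c d (a b : R) : tempered c -> tempered d ->
  tempered (fun k => a * c k + b * d k).
Proof.
move=> tc td x x01; have [K HK] := tc x x01; have [L HL] := td x x01.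
exists (`|a| * K + `|b| * L) => k.
have x0 : 0 <= x ^+ k by rewrite exprn_ge0//; lra.
apply: (@le_trans _ _ ((`|a| * `|c k| + `|b| * `|d k|) * x ^+ k)).
  by apply: ler_wpM2r => //; rewrite -!normrM ler_normD.
rewrite mulrDl -!mulrA; apply: lerD; exact: ler_wpM2l.
Qed.

(** Each of the [k+1] copies of [x^k] fits below one of the terms [x^0, ..., x^k] of
    the geometric series. *)
Lemma mulrn_expr_le x k : 0 <= x < 1 -> k.+1%:R * x ^+ k <= (1 - x)^-1.
Proof.
move=> /andP[x0 x1]; have x1' : 0 < 1 - x by rewrite subr_gt0.
rewrite -[_^-1]mul1r ler_pdivlMr// mulrC.
have -> : k.+1%:R * x ^+ k = \sum_(i < k.+1) x ^+ k.
  by rewrite sumr_const card_ord mulr_natl.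
apply: (@le_trans _ _ ((1 - x) * \sum_(i < k.+1) x ^+ i)).
  apply: ler_wpM2l; first exact: ltW.
  apply: ler_sum => i _; apply: ler_wiXn2l => //; first exact: ltW.
  by rewrite -ltnS.
have := subrX1 x k.+1; have : 0 <= x ^+ k.+1 by rewrite exprn_ge0.
lra.
Qed.

(** The factor [k] coming from differentiation is absorbed by enlarging [x] to
    the midpoint [y] of [x] and 1, since [k (x / y)^k] is bounded. *)
Lemma tempered_diffs c : tempered c -> tempered (pseries_diffs c).
Proof.
move=> tc x /andP[x0 x1].
pose y := (1 + x) / 2; have y0 : 0 < y by rewrite /y; lra.
have y1 : y < 1 by rewrite /y; lra.
have [K HK] := tc y (introT andP (conj (ltW y0) y1)).
have xy : 0 <= x / y < 1.
  by rewrite divr_ge0 ?(ltW y0)//= ltr_pdivrMr// mul1r /y; lra.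
exists ((1 - x / y)^-1 * (K / y)) => k; rewrite /pseries_diffs.
have -> : `|k.+1%:R * c k.+1| * x ^+ k =
    (k.+1%:R * (x / y) ^+ k) * (`|c k.+1| * y ^+ k.+1 / y).
  have yn0 : y != 0 by rewrite lt0r_neq0.
  by rewrite normrM ger0_norm// exprS expr_div_n; field; rewrite ?expf_neq0 ?yn0.
apply: ler_pM.
- by case/andP: xy => xy0 _; rewrite mulr_ge0// exprn_ge0.
- by rewrite divr_ge0 ?(ltW y0)// mulr_ge0// exprn_ge0// (ltW y0).
- exact: mulrn_expr_le.
- by rewrite ler_pM2r ?invr_gt0.
Qed.

Lemma tempered_shift c : tempered c -> tempered (fun k => if k is k'.+1 then c k' else 0).
Proof.
move=> tc x x01; have [K HK] := tc x x01; exists K => -[|k].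
  by rewrite normr0 mul0r; apply: le_trans (HK 0%N); rewrite mulr_ge0// exprn_ge0//; lra.
apply: le_trans (HK k); rewrite exprS mulrCA ler_piMl//; last by lra.
by rewrite mulr_ge0// exprn_ge0//; lra.
Qed.

Lemma tempered_natmul c : tempered c -> tempered (fun k => k%:R * c k).
Proof.
move=> /tempered_diffs/tempered_shift; apply: tempered_le => -[|k]//.
by rewrite mul0r.
Qed.

(** Domination by a geometric series of ratio [|x| / y], with [y] the midpoint of
    [|x|] and 1. *)
Lemma tempered_cvg c x : tempered c -> `|x| < 1 -> cvgn (pseries c x).
Proof.
move=> tc x1; pose y := (1 + `|x|) / 2.
have xge := normr_ge0 x.
have y0 : 0 < y by rewrite /y; lra.
have y1 : y < 1 by rewrite /y; lra.
have [K HK] := tc y (introT andP (conj (ltW y0) y1)).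
have xy : `|x| / y < 1 by rewrite ltr_pdivrMr// mul1r /y; lra.
apply: normed_cvg; rewrite /normed_series_of.
apply: (@series_le_cvg _ _ (geometric K (`|x| / y))).
- by move=> n; rewrite normr_ge0.
- move=> n; apply: mulr_ge0; last by rewrite exprn_ge0// divr_ge0// ltW.
  by apply: le_trans (HK 0%N); rewrite mulr_ge0// exprn_ge0// ltW.
- move=> n /=; rewrite normrM normrX expr_div_n.
  rewrite mulrA ler_pdivlMr ?exprn_gt0// mulrAC ler_wpM2r// exprn_ge0//.
- apply: is_cvg_geometric_series; rewrite ger0_norm// divr_ge0// ltW//.
Qed.

Lemma psum_is_derive c x : tempered c -> `|x| < 1 ->
  is_derive x (1 : R) (psum c) (psum (pseries_diffs c) x).
Proof.
move=> tc x1; pose y := (1 + `|x|) / 2.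
have xge := normr_ge0 x.
have y0 : 0 < y by rewrite /y; lra.
have y1 : `|y| < 1 by rewrite ger0_norm ?ltW// /y; lra.
apply: (@pseries_snd_diffs _ c y).
- exact: tempered_cvg.
- exact/tempered_cvg/y1/tempered_diffs.
- exact/tempered_cvg/y1/tempered_diffs/tempered_diffs.
- by rewrite [ltRHS]ger0_norm ?ltW// /y; lra.
Qed.

Lemma psum_continuous c x : tempered c -> `|x| < 1 -> {for x, continuous (psum c)}.
Proof.
move=> tc x1; apply/differentiable_continuous/derivable1_diffP.
by have [] := psum_is_derive tc x1.
Qed.

Lemma psum_lin c d (a b x : R) : tempered c -> tempered d -> `|x| < 1 ->
  psum (fun k => a * c k + b * d k) x = a * psum c x + b * psum d x.
Proof.
move=> tc td x1; apply: cvg_lim => //.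
have -> : pseries (fun k => a * c k + b * d k) x =
    (fun n => a * pseries c x n + b * pseries d x n).
  apply/funext => n; rewrite /pseries /series /= !mulr_sumr -big_split /=.
  by apply: eq_bigr => i _; ring.
by apply: cvgD; apply: cvgMr; exact: tempered_cvg.
Qed.

Lemma psum0 c : psum c 0 = c 0%N.
Proof.
apply: cvg_lim => //; rewrite -cvg_shiftS.
have -> : (fun n => pseries c 0 n.+1) = fun=> c 0%N; last exact: cvg_cst.
apply/funext => n; rewrite /pseries /series /= big_nat_recl//= expr0 mulr1 big1 ?addr0//.
by move=> i _; rewrite exprS mul0r mulr0.
Qed.

Lemma psum_shift c x : tempered c -> `|x| < 1 ->
  psum (fun k => if k is k'.+1 then c k' else 0) x = x * psum c x.
Proof.
move=> tc x1; apply: cvg_lim => //; rewrite -cvg_shiftS.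
have -> : (fun n => pseries (fun k => if k is k'.+1 then c k' else 0) x n.+1) =
    (fun n => x * pseries c x n).
  apply/funext => n; rewrite /pseries /series /= big_nat_recl//= mul0r add0r mulr_sumr.
  by apply: eq_bigr => i _; rewrite exprS mulrCA.
by apply: cvgMr; exact: tempered_cvg.
Qed.

Lemma eq_psum c d : c =1 d -> psum c =1 psum d.
Proof. by move=> /funext->. Qed.

(** The Euler operator [x d/dx]: with it, recurrences between coefficients become
    differential equations. *)
Lemma psum_euler c x : tempered c -> `|x| < 1 ->
  psum (fun k => k%:R * c k) x = x * psum (pseries_diffs c) x.
Proof.
move=> tc x1; rewrite -psum_shift//; last exact: tempered_diffs.
by apply: eq_psum => -[|k]//; rewrite mul0r.
Qed.

Lemma ler_psum c d x : tempered c -> tempered d -> 0 <= x < 1 ->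
  (forall k, c k <= d k) -> psum c x <= psum d x.
Proof.
move=> tc td /andP[x0 x1] cd.
have x1' : `|x| < 1 by rewrite ger0_norm.
apply: lim_series_le; try exact: tempered_cvg.
by move=> n /=; apply: ler_wpM2r (cd n); exact: exprn_ge0.
Qed.

Lemma psum_ge0 c x : tempered c -> 0 <= x < 1 ->
  (forall k, 0 <= c k) -> 0 <= psum c x.
Proof.
move=> tc /andP[x0 x1] c0; apply: limr_ge.
  by apply: tempered_cvg => //; rewrite ger0_norm.
by apply: nearW => n; apply: sumr_ge0 => k _; rewrite mulr_ge0// exprn_ge0.
Qed.

Lemma ler_psum_arg c x y : tempered c -> (forall k, 0 <= c k) ->
  0 <= x -> x <= y -> y < 1 -> psum c x <= psum c y.
Proof.
move=> tc c0 x0 xy y1; apply: lim_series_le.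
- by apply: tempered_cvg => //; rewrite ger0_norm//; lra.
- by apply: tempered_cvg => //; rewrite ger0_norm//; lra.
- by move=> n; apply: ler_wpM2l => //; rewrite lerXn2r ?nnegrE//; lra.
Qed.

Lemma tempered_succ c : tempered c -> tempered (c \o succn).
Proof.
move=> /tempered_diffs; apply: tempered_le => k.
by rewrite /pseries_diffs normrM ger0_norm// ler_peMl// ler1n.
Qed.

Lemma psum_succ c x : tempered c -> `|x| < 1 ->
  psum c x = c 0%N + x * psum (c \o succn) x.
Proof.
move=> tc x1; apply: cvg_lim => //; rewrite -cvg_shiftS.
have -> : (fun n => pseries c x n.+1) = (fun n => c 0%N + x * pseries (c \o succn) x n).
  apply/funext => n; rewrite /pseries /series /= big_nat_recl//= expr0 mulr1 mulr_sumr.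
  by congr (_ + _); apply: eq_bigr => i _; rewrite exprS mulrCA.
apply: cvgD; first exact: cvg_cst.
by apply: cvgMr; exact: (tempered_cvg (tempered_succ tc) x1).
Qed.

Lemma psum_ge_head c x : tempered c -> 0 <= x < 1 ->
  (forall k, 0 <= c k) -> c 0%N <= psum c x.
Proof.
move=> tc x01 c0; rewrite psum_succ//; last by have /andP[? ?] := x01; rewrite ger0_norm.
rewrite lerDl mulr_ge0//; first by case/andP: x01.
by apply: (psum_ge0 (tempered_succ tc)) => // k; exact: c0.
Qed.

End PowerSeries.

(** * Gauss functions with upper parameters b/2 and (b+1)/2 *)

Section Hypergeometric.
Variable R : realType.

Lemma pochhammerS (a : R) n : pochhammer a n.+1 = pochhammer a n * (a + n%:R).
Proof. by rewrite /pochhammer big_ord_recr. Qed.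

Lemma pochhammer_gt0 (a : R) n : 0 < a -> 0 < pochhammer a n.
Proof. by move=> a0; apply: prodr_gt0 => i _; rewrite ltr_wpDr. Qed.

Definition hyp2F1_coef (a b c : R) k :=
  pochhammer a k * pochhammer b k / (pochhammer c k * k`!%:R).

Lemma hyp2F1E a b c : hyp2F1 a b c = psum (hyp2F1_coef a b c).
Proof. by []. Qed.

Lemma hyp2F1_coefS (a b c : R) k : 0 < c ->
  hyp2F1_coef a b c k.+1 =
  hyp2F1_coef a b c k * ((a + k%:R) * (b + k%:R) / ((c + k%:R) * k.+1%:R)).
Proof.
move=> c0; rewrite /hyp2F1_coef !pochhammerS factS natrM.
have p0 : pochhammer c k != 0 by rewrite lt0r_neq0// pochhammer_gt0.
have f0 : k`!%:R != 0 :> R by rewrite pnatr_eq0 -lt0n fact_gt0.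
have k0 : k.+1%:R != 0 :> R by rewrite pnatr_eq0.
have c1 : c + k%:R != 0 by rewrite lt0r_neq0// ltr_wpDr.
by field; rewrite p0 f0 c1 nat1r k0.
Qed.

Lemma hyp2F1_coef0 (a b c : R) : hyp2F1_coef a b c 0 = 1.
Proof. by rewrite /hyp2F1_coef /pochhammer !big_ord0 fact0 !mul1r invr1. Qed.

Lemma hyp2F1_coef_gt0 (a b c : R) k : 0 < a -> 0 < b -> 0 < c ->
  0 < hyp2F1_coef a b c k.
Proof.
by move=> *; rewrite divr_gt0 ?mulr_gt0 ?pochhammer_gt0// ltr0n fact_gt0.
Qed.

Section Quadratic.
Variable b : R.
Hypothesis b0 : 0 < b.

(** The function [p = 2F1(b/2, (b+1)/2; b+1)], which has the closed form
    [(2 / (1 + sqrt (1 - x)))^b], see [p_closed]. *)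
Definition pcoef (k : nat) : R := hyp2F1_coef (b / 2) (b / 2 + 1 / 2) (b + 1) k.
(** The coefficients of [q = p + (2/b) x p'], that is of
    [2F1(b/2+1, (b+1)/2; b+1)], equal to [p / sqrt (1 - x)] by [q_sqrt]. *)
Definition qcoef k : R := 1 * pcoef k + 2 / b * (k%:R * pcoef k).

Lemma pcoef_gt0 k : 0 < pcoef k.
Proof. by have hb := b0; apply: hyp2F1_coef_gt0; lra. Qed.

Lemma pcoefS k : pcoef k.+1 =
  pcoef k * ((b / 2 + k%:R) * (b / 2 + 1 / 2 + k%:R) / ((b + 1 + k%:R) * k.+1%:R)).
Proof. have hb := b0; by rewrite /pcoef hyp2F1_coefS//; lra. Qed.

(** The coefficients decrease as soon as [k >= b^2], hence are bounded. *)
Lemma tempered_pcoef : tempered pcoef.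
Proof.
have hb := b0.
pose k0 := `|Num.ceil (b ^+ 2)|%N.
have [K HK] : exists K, forall k, `|pcoef k| <= K.
  apply: (@eventually_nonincreasing_bounded _ _ k0) => k kk.
  have kb : b ^+ 2 <= k%:R.
    apply: le_trans (_ : k0%:R <= _); last by rewrite ler_nat.
    by rewrite /k0 natr_absz ger0_norm ?ceil_ge0 ?ceil_ge// (lt_le_trans _ (sqr_ge0 b)).
  rewrite !ger0_norm ?(ltW (pcoef_gt0 _))// pcoefS ger_pMr ?pcoef_gt0//.
  have k00 : 0 <= k%:R :> R by [].
  rewrite ler_pdivrMr ?mul1r; last by rewrite mulr_gt0//; lra.
  rewrite -(natr1 k); nra.
exact: tempered_bounded HK.
Qed.

Lemma tempered_qcoef : tempered qcoef.
Proof. exact/tempered_lin/tempered_natmul/tempered_pcoef/tempered_pcoef. Qed.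

Lemma qcoefE k : qcoef k = pcoef k * (b + 2 * k%:R) / b.
Proof. by have hb := b0; rewrite /qcoef; field; lra. Qed.

Lemma qcoef_gt0 k : 0 < qcoef k.
Proof.
have hb := b0.
rewrite qcoefE divr_gt0// mulr_gt0 ?pcoef_gt0//.
by have : 0 <= k%:R :> R by []; lra.
Qed.

(** The recurrence behind [pq_ode2]. *)
Lemma qcoef_rec k : (2 * k.+1%:R + b) * qcoef k.+1 - b * pcoef k.+1
  = (b + 2 * k%:R + 1) * qcoef k.
Proof.
have hb := b0.
have k0 : 0 <= k%:R :> R by [].
by rewrite !qcoefE pcoefS -(natr1 k); field; lra.
Qed.

Let p := psum pcoef.
Let q := psum qcoef.
Let p' := psum (pseries_diffs pcoef).
Let q' := psum (pseries_diffs qcoef).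

(** Together with [pq_ode2] this is the hypergeometric equation of [p], written as
    a first-order system for [p] and [q]. *)
Lemma pq_ode1 x : `|x| < 1 -> 2 * (x * p' x) = b * (q x - p x).
Proof.
have hb := b0.
move=> x1; have tp := tempered_pcoef.
rewrite /p' -psum_euler// /q.
rewrite (@eq_psum _ qcoef (fun k => 1 * pcoef k + 2 / b * (k%:R * pcoef k)))//.
rewrite psum_lin//; last exact: tempered_natmul.
by rewrite -/p; field; lra.
Qed.

Lemma pq_ode2 x : `|x| < 1 ->
  2 * (x * q' x) * (1 - x) = b * p x - b * q x + (b + 1) * x * q x.
Proof.
have hb := b0.
move=> x1; have tp := tempered_pcoef; have tq := tempered_qcoef.
have tkq := tempered_natmul tq.
have t1 : tempered (fun k => 1 * (2 * (k%:R * qcoef k) + b * qcoef k) + - b * pcoef k).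
  exact: tempered_lin (tempered_lin _ _ tkq tq) tp.
have t2 : tempered (fun k => 2 * (k%:R * qcoef k) + (b + 1) * qcoef k).
  exact: tempered_lin tkq tq.
have : psum (fun k => 1 * (2 * (k%:R * qcoef k) + b * qcoef k) + - b * pcoef k) x =
   x * psum (fun k => 2 * (k%:R * qcoef k) + (b + 1) * qcoef k) x.
  rewrite -psum_shift//; apply: eq_psum => -[|k].
    by rewrite qcoefE; field; lra.
  by have := qcoef_rec k; lra.
rewrite (@psum_lin _ (fun k => 2 * (k%:R * qcoef k) + b * qcoef k))//; last exact: tempered_lin.
have tkp := tempered_natmul tp.
have qE : q x = 1 * psum pcoef x + 2 / b * psum (fun k => k%:R * pcoef k) x.
  by rewrite -psum_lin.
by rewrite !psum_lin// -qE psum_euler// -/p -/q'; lra.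
Qed.

Lemma pcoef_head : pcoef 0 = 1. Proof. exact: hyp2F1_coef0. Qed.

Lemma qcoef_head : qcoef 0 = 1.
Proof. by have hb := b0; rewrite qcoefE pcoef_head; field; lra. Qed.

Lemma p_ge1 x : 0 <= x < 1 -> 1 <= p x.
Proof.
have hb := b0.
move=> x01; rewrite -pcoef_head; apply: psum_ge_head => //; first exact: tempered_pcoef.
by move=> k; rewrite ltW// pcoef_gt0.
Qed.

Lemma q_ge1 x : 0 <= x < 1 -> 1 <= q x.
Proof.
have hb := b0.
move=> x01; rewrite -qcoef_head; apply: psum_ge_head => //; first exact: tempered_qcoef.
by move=> k; rewrite ltW// qcoef_gt0.
Qed.

(** The two first-order equations give [x D' = - b D] for the discriminant
    [D = (1 - x) q^2 - p^2]; so [D^2] cannot increase, and it starts at [0]. *)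
Lemma pq_discriminant x : 0 <= x < 1 -> (1 - x) * q x ^+ 2 = p x ^+ 2.
Proof.
have hb := b0.
move=> /andP[x0 x1].
pose D y := (1 - y) * (q y * q y) - p y * p y.
pose D' y := ((0 - 1) * (q y * q y) + (1 - y) * (q' y * q y + q y * q' y)) -
  (p' y * p y + p y * p' y).
have dD y : 0 <= y <= x -> is_derive y (1 : R) (fun y => D y * D y) (D' y * D y + D y * D' y).
  move=> /andP[y0 yx]; have y1 : `|y| < 1 by rewrite ger0_norm//; lra.
  have dp := psum_is_derive tempered_pcoef y1.
  have dq := psum_is_derive tempered_qcoef y1.
  have dDy : is_derive y (1 : R) D (D' y).
    exact: (is_derive_subf (is_derive_mulf (is_derive_subf (is_derive_cst (1:R) y 1)
      (is_derive_id y 1)) (is_derive_mulf dq dq)) (is_derive_mulf dp dp)).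
  exact: is_derive_mulf.
have [c [/andP[c0 cx] hc]] := mvt_closed x0 dD.
have c1 : `|c| < 1 by rewrite ger0_norm//; lra.
have Dc : c * D' c = - b * D c.
  have -> : c * D' c = - c * (q c * q c) + q c * (2 * (c * q' c) * (1 - c))
      - p c * (2 * (c * p' c)) by rewrite /D'; ring.
  by rewrite pq_ode1// pq_ode2// /D; ring.
have D0 : D 0 = 0.
  by rewrite /D /p /q !psum0 pcoef_head qcoef_head; ring.
(* By the mean value theorem [D x ^+ 2] is [x] times a derivative that is nonpositive by [Dc]. *)
have : D x ^+ 2 <= 0.
  move: hc; rewrite D0 mul0r !subr0 -expr2 => ->.
  have [c00|c00] := leP c 0.
    have -> : c = 0 by lra.
    by rewrite D0 mulr0 mul0r addr0 mul0r.
  have -> : (D' c * D c + D c * D' c) * x = - (2 * b * x * D c ^+ 2 / c).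
    have -> : D' c = - b * D c / c by rewrite -Dc; field; lra.
    by field; lra.
  by rewrite oppr_le0 divr_ge0 ?(ltW c00)// mulr_ge0 ?sqr_ge0// mulr_ge0//; lra.
rewrite real_exprn_even_le0 ?num_real//= /D => /eqP; rewrite !expr2; lra.
Qed.

Let S (x : R) := Num.sqrt (1 - x).

Lemma S_gt0 x : x < 1 -> 0 < S x.
Proof. by move=> x1; rewrite sqrtr_gt0 subr_gt0. Qed.

Lemma S_sqr x : x < 1 -> S x * S x = 1 - x.
Proof. by move=> x1; rewrite -expr2 sqr_sqrtr// subr_ge0 ltW. Qed.

Lemma q_sqrt x : 0 <= x < 1 -> q x = p x / S x.
Proof.
move=> x01; have x1 : x < 1 by case/andP: x01.
have hS := S_gt0 x1; apply: (mulfI (lt0r_neq0 hS)).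
have p1 := p_ge1 x01; have q1 := q_ge1 x01.
rewrite mulrCA divff ?mulr1 ?lt0r_neq0//.
apply/eqP; rewrite -(@eqrXn2 _ 2) ?mulr_ge0 ?(ltW hS)//; [|lra..].
by rewrite exprMn [X in X * _]expr2 S_sqr// pq_discriminant.
Qed.

(** With [q = p / S] and [S = sqrt (1 - x)] the first equation of the system reads
    [p' / p = b (1 - S) / (2 x S)], which is also the logarithmic derivative of the
    right-hand side. *)
Lemma p_closed x : 0 <= x < 1 -> p x = (2 / (1 + S x)) `^ b.
Proof.
move=> x01; have hb := b0; have /andP[x0 x1] := x01.
pose w y := ln (p y) + b * ln (1 + S y).
pose w' y := (p y)^-1 * p' y + b * ((1 + S y)^-1 * (0 + (2 * S y)^-1 * (0 - 1))).
have dw y : 0 <= y <= x -> is_derive y (1 : R) w (w' y).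
  move=> /andP[y0 yx]; have y01 : 0 <= y < 1 by lra.
  have y1 : `|y| < 1 by rewrite ger0_norm//; lra.
  have dp : is_derive y (1 : R) p (p' y) := psum_is_derive tempered_pcoef y1.
  have p0 : 0 < p y by have := p_ge1 y01; lra.
  have s0 : 0 < 1 + S y by have := @S_gt0 y; lra.
  have dS : is_derive y (1 : R) S ((2 * S y)^-1 * (0 - 1)).
    have dg : is_derive y (1 : R) (fun z : R => 1 - z) (0 - 1).
      have := is_derive_subf (is_derive_cst (1:R) y 1) (is_derive_id y 1); exact.
    have ds : is_derive (1 - y) (1 : R) Num.sqrt (2 * Num.sqrt (1 - y))^-1.
      by apply: is_derive1_sqrt; lra.
    exact: (is_derive_compf Num.sqrt (fun z => 1 - z) ds dg).
  have dl1 := is_derive_compf (@ln R) p (is_derive1_ln p0) dp.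
  have dl2 := is_derive_compf (@ln R) (fun z => 1 + S z) (is_derive1_ln s0)
    (is_derive_addf (is_derive_cst (1:R) y 1) dS).
  exact: (is_derive_addf dl1 (is_derive_mulcf b dl2)).
have w'0 y : 0 <= y < 1 -> w' y = 0.
  move=> y01; have /andP[y0 y1] := y01; have p0 := p_ge1 y01.
  have s0 := S_gt0 y1; have s2 := S_sqr y1.
  have yn : `|y| < 1 by rewrite ger0_norm.
  rewrite /w'; move: y0; rewrite le_eqVlt => /orP[/eqP y0|y0].
    rewrite -y0 /p /p' !psum0 /pseries_diffs pcoefS pcoef_head /S subr0 sqrtr1.
    by field; lra.
  have -> : p' y = b * p y * (1 - S y) / (2 * y * S y).
    have e := pq_ode1 yn; rewrite q_sqrt// in e.
    have -> : p' y = (2 * (y * p' y)) / (2 * y) by field; lra.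
    by rewrite e; field; lra.
  have s1 : S y != 1 by apply/eqP => e; move: s2; rewrite e; lra.
  have : y = (1 - S y) * (1 + S y) by lra.
  move: (S y) s0 s1 (p y) p0 => s s0 s1 P P0 ->; field.
  by rewrite subr_eq0 [1 == _]eq_sym s1; lra.
have [c [/andP[c0 cx]]] := mvt_closed x0 dw.
rewrite w'0; last by lra.
rewrite mul0r /w /p psum0 pcoef_head ln1 /S subr0 sqrtr1 -/p -/(S x) => hw.
have p0 : 0 < p x by have := p_ge1 x01; lra.
have s0 : 0 < 1 + S x by have := S_gt0 x1; lra.
apply: ln_inj; rewrite ?posrE//; first exact/powR_gt0/divr_gt0.
rewrite ln_powR ln_div ?posrE// mulrBr; lra.
Qed.

End Quadratic.

(** Contiguity relations: through them the series of [psum_scoef] becomes a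
    combination of the closed forms for [b], [b + 1] and [b + 2]. *)
Lemma pcoef_succ1 (b : R) k : 0 < b ->
  pcoef (b + 1) k = pcoef b k * ((b + 1) * (b + 2 * k%:R) / (b * (b + 1 + k%:R))).
Proof.
move=> b0; have b1 : 0 < b + 1 by lra.
elim: k => [|k IH]; first by rewrite !pcoef_head; field; lra.
have k0 : 0 <= k%:R :> R by [].
by rewrite !pcoefS// IH -(natr1 k); field; lra.
Qed.

Lemma pcoef_succ2 (b : R) k : 0 < b ->
  pcoef (b + 2) k =
  pcoef b k.+1 * (4 * k.+1%:R * (b + 2) / (b * (b + 2 + k%:R))).
Proof.
move=> b0; have b1 : 0 < b + 2 by lra.
elim: k => [|k IH]; first by rewrite pcoefS// !pcoef_head; field; lra.
have k0 : 0 <= k%:R :> R by [].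
by rewrite pcoefS// IH [in RHS]pcoefS// -!natr1; field; lra.
Qed.

Section Sandwich.
Variable b : R.
Hypothesis b0 : 0 < b.

(** The Gauss function [2F1(b/2, (b+1)/2; b+1/2)] of the integrand, for
    [b = N + 3/2]. It has no elementary closed form, but its third parameter is
    only 1/2 away from that of [p]. *)
Definition tcoef (k : nat) : R := hyp2F1_coef (b / 2) (b / 2 + 1 / 2) (b + 1 / 2) k.

(** The ratio [(b+1)_k / (b+1/2)_k]; it behaves like the square root of a linear
    function of [k], which is what [tau_le] and [tau_ge] make precise. *)
Let tau k := tcoef k / pcoef b k.

Let tau_gt0 k : 0 < tau k.
Proof.
have hb := b0; apply: divr_gt0; last exact: pcoef_gt0.
by apply: hyp2F1_coef_gt0; lra.
Qed.

Let tauS k : tau k.+1 = tau k * ((b + 1 + k%:R) / (b + 1 / 2 + k%:R)).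
Proof.
have hb := b0; have k0 : 0 <= k%:R :> R by [].
have p0 := pcoef_gt0 b0 k.
rewrite /tau pcoefS// /tcoef hyp2F1_coefS -/(tcoef k); last by lra.
by rewrite -(natr1 k); field; lra.
Qed.

Let tau_le k : tau k ^+ 2 <= (b + k%:R) / b.
Proof.
have hb := b0; elim: k => [|k IH].
  by rewrite /tau /tcoef /pcoef !hyp2F1_coef0 divr1 expr1n addr0 divff// lt0r_neq0.
have k0 : 0 <= k%:R :> R by [].
rewrite tauS exprMn.
apply: (@le_trans _ _ ((b + k%:R) / b * ((b + 1 + k%:R) / (b + 1 / 2 + k%:R)) ^+ 2)).
  by rewrite ler_wpM2r// sqr_ge0.
rewrite -(natr1 k) mulrAC ler_pM2r ?invr_gt0// expr_div_n mulrA.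
rewrite ler_pdivrMr; last by rewrite exprn_gt0//; lra.
nra.
Qed.

Let tau_ge k : (b + 1 + k%:R) / (b + 1) <= tau k ^+ 2.
Proof.
have hb := b0; elim: k => [|k IH].
  by rewrite /tau /tcoef /pcoef !hyp2F1_coef0 divr1 expr1n addr0 divff// lt0r_neq0//; lra.
have k0 : 0 <= k%:R :> R by [].
rewrite tauS exprMn.
apply: (@le_trans _ _ ((b + 1 + k%:R) / (b + 1) * ((b + 1 + k%:R) / (b + 1 / 2 + k%:R)) ^+ 2)); last first.
  by rewrite ler_wpM2r// sqr_ge0.
rewrite -(natr1 k) [leRHS]mulrAC ler_pM2r ?invr_gt0//; last by lra.
rewrite expr_div_n mulrA ler_pdivlMr; last by rewrite exprn_gt0//; lra.
have X0 : 0 < b + 1 + k%:R by lra.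
have -> : b + 1 + (k%:R + 1) = (b + 1 + k%:R) + 1 by ring.
have -> : b + 1 / 2 + k%:R = (b + 1 + k%:R) - 1 / 2 by field.
have X1 : 1 <= b + 1 + k%:R by lra.
by move: (b + 1 + k%:R) X0 X1 => X *; nra.
Qed.

Let tcoefE k : tcoef k = pcoef b k * tau k.
Proof. by rewrite /tau mulrC divfK// lt0r_neq0// pcoef_gt0. Qed.

(** The arithmetic-geometric inequality [tau <= w tau^2 / 2 + 1 / (2 w)] replaces
    the square root by a linear function of [k], for which the series can be summed. *)
Lemma tcoef_le w k : 0 < w ->
  tcoef k <= w / 2 * (pcoef b k * ((b + k%:R) / b)) + (2 * w)^-1 * pcoef b k.
Proof.
move=> w0; rewrite tcoefE.
have -> : w / 2 * (pcoef b k * ((b + k%:R) / b)) + (2 * w)^-1 * pcoef b k =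
  pcoef b k * ((w * w * ((b + k%:R) / b) + 1) / (2 * w)) by have hb := b0; field; lra.
rewrite ler_pM2l ?pcoef_gt0// ler_pdivlMr ?mulr_gt0//.
apply: (@le_trans _ _ (w * w * tau k ^+ 2 + 1)).
  by have := sqr_ge0 (w * tau k - 1); rewrite !expr2; lra.
by rewrite lerD2r ler_pM2l ?mulr_gt0.
Qed.

(** The tangent at [y = w^2] of the convex function [y^(-1/2)], taken at
    [y = tau^(-2)]: [tau >= 3 / (2 w) - tau^(-2) / (2 w^3)]. *)
Lemma tcoef_ge w k : 0 < w ->
  3 / (2 * w) * pcoef b k - (2 * w ^+ 3)^-1 * (pcoef b k * ((b + 1) / (b + 1 + k%:R)))
  <= tcoef k.
Proof.
move=> w0; have hb := b0; have k0 : 0 <= k%:R :> R by [].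
have t0 := tau_gt0 k; rewrite tcoefE.
have -> : 3 / (2 * w) * pcoef b k
    - (2 * w ^+ 3)^-1 * (pcoef b k * ((b + 1) / (b + 1 + k%:R))) =
  pcoef b k * (3 / (2 * w) - (2 * w ^+ 3)^-1 * ((b + 1) / (b + 1 + k%:R))).
  by field; lra.
rewrite ler_pM2l ?pcoef_gt0//.
apply: (@le_trans _ _ (3 / (2 * w) - (2 * w ^+ 3)^-1 * (tau k ^+ 2)^-1)).
  rewrite lerD2l lerN2 ler_pM2l ?invr_gt0 ?mulr_gt0 ?exprn_gt0//.
  rewrite -[leRHS]invrK lef_pV2 ?posrE ?invr_gt0 ?exprn_gt0//; last by rewrite divr_gt0; lra.
  by rewrite invf_div; exact: tau_ge.
have -> : 3 / (2 * w) - (2 * w ^+ 3)^-1 * (tau k ^+ 2)^-1 =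
   tau k - (w * tau k - 1) ^+ 2 * (2 * (w * tau k) + 1) / (2 * w ^+ 3 * tau k ^+ 2).
  by field; lra.
have wt : 0 < w * tau k by rewrite mulr_gt0.
rewrite gerBl; apply: divr_ge0.
  by apply: mulr_ge0; [exact: sqr_ge0|lra].
by apply: mulr_ge0; [apply: mulr_ge0|]; rewrite ?exprn_ge0 ?(ltW w0) ?(ltW t0).
Qed.

Lemma tempered_ucoef : tempered (fun k => pcoef b k * ((b + k%:R) / b)).
Proof.
have hb := b0; have tp := tempered_pcoef b0.
have := tempered_lin 1 (1 / b) tp (tempered_natmul tp).
by apply: tempered_le => k; rewrite le_eqVlt; apply/orP; left; apply/eqP; congr `|_|; field; lra.
Qed.

Lemma tempered_scoef : tempered (fun k => pcoef b k * ((b + 1) / (b + 1 + k%:R))).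
Proof.
have hb := b0; apply: tempered_le (tempered_pcoef b0) => k.
have k0 : 0 <= k%:R :> R by [].
rewrite normrM ler_piMr// ger0_norm; last by rewrite divr_ge0; lra.
by rewrite ler_pdivrMr; lra.
Qed.

Lemma tempered_tcoef : tempered tcoef.
Proof.
have := tempered_lin (1 / 2) (2 * 1)^-1 tempered_ucoef (tempered_pcoef b0).
apply: tempered_le => k; have hb := b0.
rewrite ger0_norm; last by rewrite tcoefE mulr_ge0// ltW// pcoef_gt0.
by apply: le_trans (tcoef_le _ ltr01) (ler_norm _).
Qed.

Variable x : R.
Hypothesis x01 : 0 <= x < 1.
Let p := psum (pcoef b) x.
Let s := Num.sqrt (1 - x).

Let x1 : `|x| < 1.
Proof. by have /andP[x0 xl1] := x01; rewrite ger0_norm. Qed.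

Let s_gt0 : 0 < s.
Proof. by have /andP[_ ?] := x01; exact: S_gt0. Qed.

Let s_sqr : s * s = 1 - x.
Proof. by have /andP[_ ?] := x01; exact: S_sqr. Qed.

Lemma psum_ucoef : psum (fun k => pcoef b k * ((b + k%:R) / b)) x = p * ((1 + s) / (2 * s)).
Proof.
have hb := b0; have hs := s_gt0; have tp := tempered_pcoef b0.
transitivity (psum (fun k => 1 / 2 * pcoef b k + 1 / 2 * qcoef b k) x).
  by apply: eq_psum => k; rewrite qcoefE//; field; lra.
rewrite psum_lin//; last exact: tempered_qcoef.
by rewrite q_sqrt// -/p -/s; field; lra.
Qed.

Lemma psum_scoef : psum (fun k => pcoef b k * ((b + 1) / (b + 1 + k%:R))) x =
  p * (2 * s + 2 / (b + 2) * (1 - s)) / (1 + s).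
Proof.
have hb := b0; have hs := s_gt0; have b1 : 0 < b + 1 by lra.
have b2 : 0 < b + 2 by lra.
have t1 := tempered_pcoef b1; have t2 := tempered_pcoef b2.
transitivity (psum (fun k => 1 * pcoef (b + 1) k + - ((b + 1) / (2 * (b + 2))) *
   (if k is k'.+1 then pcoef (b + 2) k' else 0)) x).
  apply: eq_psum => k; rewrite pcoef_succ1//.
  case: k => [|k]; first by rewrite !pcoef_head; field; lra.
  have k0 : 0 <= k%:R :> R by [].
  by rewrite pcoef_succ2// -!(natr1 k); field; lra.
rewrite psum_lin//; last exact: tempered_shift.
rewrite psum_shift// !p_closed// /p p_closed// -/s.
have c0 : 2 / (1 + s) != 0 by rewrite mulf_neq0// ?invr_neq0; lra.
rewrite (@powRD _ _ b 1) ?c0 ?implybT// (@powRD _ _ b 2) ?c0 ?implybT// powRr1; last by rewrite divr_ge0; lra.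
rewrite powR_mulrn; last by rewrite divr_ge0; lra.
have -> : x = 1 - s * s by have := s_sqr; lra.
by field; lra.
Qed.

(** The termwise bound [tcoef_le] with [w^(-2) = (1 + s) / (2 s)], the choice that
    makes its two summands equal after summation. *)
Lemma hyp2F1_le : hyp2F1 (b / 2) (b / 2 + 1 / 2) (b + 1 / 2) x <=
  (2 / (1 + s)) `^ b * Num.sqrt ((1 + s) / (2 * s)).
Proof.
have hb := b0; have hs := s_gt0.
rewrite hyp2F1E -[hyp2F1_coef _ _ _]/tcoef -p_closed// -/p.
have v0 : 0 < (1 + s) / (2 * s) by rewrite divr_gt0//; lra.
set u := Num.sqrt _; have u0 : 0 < u by rewrite sqrtr_gt0.
have u2 : (1 + s) / (2 * s) = u * u by rewrite -expr2 sqr_sqrtr// ltW.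
have := @ler_psum _ _ _ x tempered_tcoef
  (tempered_lin (u^-1 / 2) (2 * u^-1)^-1 tempered_ucoef (tempered_pcoef b0)) x01
  (fun k => tcoef_le k (w := u^-1) (eq_ind_r is_true u0 (invr_gt0 _))).
rewrite psum_lin//; [|exact: tempered_ucoef|exact: tempered_pcoef].
rewrite psum_ucoef u2 -/p; move/le_trans; apply.
by rewrite le_eqVlt; apply/orP; left; apply/eqP; field; lra.
Qed.

(** The same [w] in [tcoef_ge] gives back the upper bound, up to a relative error
    of order [1 / (b s)]. *)
Lemma hyp2F1_ge : (2 / (1 + s)) `^ b * Num.sqrt ((1 + s) / (2 * s)) *
   (1 - (1 - s) / (2 * (b + 2) * s)) <= hyp2F1 (b / 2) (b / 2 + 1 / 2) (b + 1 / 2) x.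
Proof.
have hb := b0; have hs := s_gt0.
rewrite hyp2F1E -[hyp2F1_coef _ _ _]/tcoef -p_closed// -/p.
have v0 : 0 < (1 + s) / (2 * s) by rewrite divr_gt0//; lra.
set u := Num.sqrt _; have u0 : 0 < u by rewrite sqrtr_gt0.
have u2 : (1 + s) / (2 * s) = u * u by rewrite -expr2 sqr_sqrtr// ltW.
have ui0 : 0 < u^-1 by rewrite invr_gt0.
have := @ler_psum _ _ _ x (tempered_lin (3 / (2 * u^-1)) (- (2 * u^-1 ^+ 3)^-1)
   (tempered_pcoef b0) tempered_scoef) tempered_tcoef x01.
have h k : 3 / (2 * u^-1) * pcoef b k + - (2 * u^-1 ^+ 3)^-1 *
  (pcoef b k * ((b + 1) / (b + 1 + k%:R))) <= tcoef k.
  by rewrite mulNr; exact: tcoef_ge.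
move=> /(_ h); rewrite psum_lin//; [|exact: tempered_pcoef|exact: tempered_scoef].
rewrite psum_scoef -/p; apply: le_trans; rewrite le_eqVlt; apply/orP; left; apply/eqP.
have -> : (2 * u^-1 ^+ 3)^-1 = u * (u * u) / 2 by field; lra.
by rewrite -u2; field; lra.
Qed.

End Sandwich.
End Hypergeometric.

(** * A finite form of Jacobi's functional equation *)

Section Polya.
Variable R : realType.

(** Tannery's theorem, for sums whose range of summation also grows. *)
Lemma tannery (a : nat -> nat -> R) (l g : nat -> R) (K : nat -> nat) :
  (forall k, a n k @[n --> \oo] --> l k) ->
  (forall n k, `|a n k| <= g k) ->
  (forall n k, (K n <= k)%N -> a n k = 0) ->
  cvgn (series g) ->
  \sum_(k < K n) a n k @[n --> \oo] --> limn (series l).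
Proof.
move=> al ag aK cg.
have g0 k : 0 <= g k by apply: le_trans (ag 0%N k).
have lg k : `|l k| <= g k.
  rewrite -(cvg_lim _ (cvg_norm (al k)))//; apply: limr_le.
    by apply/cvg_ex; eexists; exact: (cvg_norm (al k)).
  by apply: nearW => n; exact: ag.
have cl : cvgn (series l).
  by apply: normed_cvg; apply: series_le_cvg lg cg.
have tail M J : (M <= J)%N -> \sum_(M <= k < J) g k <= limn (series g) - series g M.
  move=> MJ; rewrite -sub_series_geq// lerD2r.
  apply: nondecreasing_cvgn_le => //; apply: nondecreasing_series => n _ _; exact: g0.
apply/cvgrPdist_le => e e0.
have e3 : 0 < e / 3 by rewrite divr_gt0.
have : \forall M \near \oo, `|limn (series g) - series g M| <= e / 3.
  exact: (cvgrPdist_le _ _).1 cg _ e3.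
have : \forall M \near \oo, `|limn (series l) - series l M| <= e / 3.
  exact: (cvgrPdist_le _ _).1 cl _ e3.
move=> [M1 _ HM1] [M2 _ HM2]; pose M := maxn M1 M2.
have {}HM1 := HM1 M (leq_maxl _ _); have {}HM2 := HM2 M (leq_maxr _ _).
have aM : series (a n) M @[n --> \oo] --> series l M.
  elim: (M) => [|M' IH]; first by rewrite /series /=; under eq_fun do rewrite big_geq//; rewrite big_geq//; exact: cvg_cst.
  rewrite /series /=; under eq_fun do rewrite big_nat_recr//=.
  by rewrite big_nat_recr//=; apply: cvgD => //; exact: al.
near=> n.
have Hn : `|series l M - series (a n) M| <= e / 3.
  by near: n; exact: (cvgrPdist_le _ _).1 aM _ e3.
have Hs : `|\sum_(k < K n) a n k - series (a n) M| <= e / 3.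
  pose J := maxn (K n) M.
  have -> : \sum_(k < K n) a n k = series (a n) J.
    rewrite /series /= (big_cat_nat _ (leq_maxl (K n) M))//= big_mkord.
    rewrite [X in _ = _ + X]big_nat [X in _ = _ + X]big1 ?addr0// => i /andP[Ki _]; exact: aK.
  have MJ : (M <= J)%N by exact: leq_maxr.
  rewrite sub_series_geq//; apply: le_trans (ler_norm_sum _ _ _) _.
  apply: le_trans (_ : \sum_(M <= k < J) g k <= _); first by apply: ler_sum => k _.
  by apply: le_trans (tail _ _ MJ) _; apply: le_trans (ler_norm _) HM2.
have -> : limn (series l) - \sum_(k < K n) a n k =
  (limn (series l) - series l M) + (series l M - series (a n) M)
  - (\sum_(k < K n) a n k - series (a n) M) by ring.
apply: le_trans (ler_normB _ _) _; apply: (@le_trans _ _ (e / 3 + e / 3 + e / 3)); last by lra.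
by apply: lerD Hs; apply: le_trans (ler_normD _ _) _; exact: lerD.
Unshelve. all: end_near.
Qed.

Lemma sum_fold_center (F : nat -> R) p :
  \sum_(j < p.*2.+1) F j = F p + \sum_(d < p) (F (p - d.+1)%N + F (p + d.+1)%N).
Proof.
elim: p F => [|p IH] F; first by rewrite big_ord1 big_ord0 addr0.
rewrite doubleS big_ord_recr big_ord_recl /=.
have -> : \sum_(i < p.*2.+1) F (bump 0 i) = \sum_(i < p.*2.+1) F i.+1 by [].
rewrite (IH (fun i => F i.+1)) [in RHS]big_ord_recr /= subnn.
have -> : \sum_(d < p) (F (p - d.+1).+1 + F (p + d.+1).+1) =
  \sum_(d < p) (F (p.+1 - d.+1)%N + F (p.+1 + d.+1)%N).
  by apply: eq_bigr => d _; rewrite subSS subnSK// addSn.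
have -> : (p.+1 + p.+1)%N = p.*2.+2 by lia.
ring.
Qed.

(** The real form of the binomial expansion of [(e^(ix) + e^(-ix))^M]. *)
Lemma expr_2cos (x : R) M :
  (2 * cos x) ^+ M = \sum_(i < M.+1) 'C(M, i)%:R * cos (M%:R * x - 2 * i%:R * x).
Proof.
elim: M => [|M IH]; first by rewrite big_ord1 bin0 mul0r mulr0 mul0r subr0 cos0 mulr1 expr0.
rewrite exprS IH mulr_sumr.
have step (i : nat) : 2 * cos x * ('C(M, i)%:R * cos (M%:R * x - 2 * i%:R * x)) =
   'C(M, i)%:R * cos (M.+1%:R * x - 2 * i%:R * x) +
   'C(M, i)%:R * cos (M.+1%:R * x - 2 * i.+1%:R * x).
  have -> : M.+1%:R * x - 2 * i%:R * x = (M%:R * x - 2 * i%:R * x) + x.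
    by ring.
  have -> : M.+1%:R * x - 2 * i.+1%:R * x = (M%:R * x - 2 * i%:R * x) - x.
    by ring.
  by move: (M%:R * x - 2 * i%:R * x) => A; rewrite cosD cosB; ring.
under eq_bigr do rewrite step; rewrite big_split /=.
rewrite [in RHS]big_ord_recl /=.
under [in RHS]eq_bigr do rewrite /bump /= add1n binS natrD mulrDl.
rewrite big_split /= [X in _ = _ + (X + _)]big_ord_recr /=.
rewrite [X in X + _ = _]big_ord_recl /= !bin0 bin_small// mul0r addr0 addrA.
by under eq_bigr do rewrite /bump /= add1n.
Qed.

Lemma expr_2cos_even (x : R) m : (2 * cos x) ^+ m.*2 =
  'C(m.*2, m)%:R + 2 * \sum_(d < m) 'C(m.*2, m + d.+1)%:R * cos (2 * d.+1%:R * x).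
Proof.
rewrite expr_2cos (sum_fold_center (fun i => 'C(m.*2, i)%:R * cos (m.*2%:R * x - 2 * i%:R * x))).
congr (_ + _).
  by rewrite -muln2 natrM mulrC [2 * _]mulrC subrr cos0 mul1r.
rewrite mulr_sumr; apply: eq_bigr => -[d /= dm] _.
have -> : 'C(m.*2, m - d.+1) = 'C(m.*2, m + d.+1).
  by rewrite -bin_sub; [congr 'C(_, _); lia|lia].
have -> : m.*2%:R * x - 2 * (m - d.+1)%:R * x = 2 * d.+1%:R * x.
  by rewrite natrB// -muln2 natrM; ring.
have -> : m.*2%:R * x - 2 * (m + d.+1)%:R * x = - (2 * d.+1%:R * x).
  by rewrite natrD -muln2 natrM; ring.
by rewrite cosN; ring.
Qed.

Lemma sinDpin (x : R) n : sin (n%:R * pi + x) = (-1) ^+ n * sin x.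
Proof.
elim: n => [|n IH]; first by rewrite mul0r add0r expr0 mul1r.
have -> : n.+1%:R * pi + x = (n%:R * pi + x) + pi :> R by ring.
by rewrite sinDpi IH exprS; ring.
Qed.

Lemma cos_2pin (n : nat) : cos (2 * n%:R * pi) = 1 :> R.
Proof.
elim: n => [|n IH]; first by rewrite mulr0 mul0r cos0.
have -> : 2 * n.+1%:R * pi = 2 * n%:R * pi + pi *+ 2 :> R by ring.
by rewrite cosD2pi.
Qed.

Lemma sin_piM_div_neq0 (a l : nat) : (0 < l)%N -> ~~ (l %| a)%N ->
  sin (a%:R * pi / l%:R) != 0 :> R.
Proof.
move=> l0 la; have lR : 0 < l%:R :> R by rewrite ltr0n.
have r0 : (0 < a %% l)%N by rewrite lt0n.
have rl : (a %% l < l)%N by rewrite ltn_mod.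
have -> : a%:R * pi / l%:R = (a %/ l)%:R * pi + (a %% l)%:R * pi / l%:R :> R.
  by rewrite [in LHS](divn_eq a l) natrD natrM; field; lra.
rewrite sinDpin mulf_neq0// ?signr_eq0// lt0r_neq0// sin_gt0_pi// divr_gt0 ?mulr_gt0 ?ltr0n ?pi_gt0//=.
by rewrite ltr_pdivrMr// mulrC ltr_pM2l ?pi_gt0// ltr_nat.
Qed.

(** Dirichlet kernel at a multiple of [2 pi / l]: the product with
    [2 sin (theta / 2)] telescopes to [2 sin (a pi) = 0]. *)
Lemma sum_cos_roots (p a : nat) : let l := p.*2.+1 in
  1 + 2 * \sum_(j < p) cos (2 * a%:R * (j.+1%:R * pi / l%:R)) =
  if (l %| a)%N then l%:R else 0 :> R.
Proof.
move=> l; have lR : 0 < l%:R :> R by rewrite ltr0n.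
case: ifPn => la.
  rewrite (eq_bigr (fun=> 1)) => [|j _]; last first.
    have -> : 2 * a%:R * (j.+1%:R * pi / l%:R) = 2 * (j.+1 * (a %/ l))%:R * pi :> R.
      by rewrite -{1}(divnK la) !natrM; field; lra.
    exact: cos_2pin.
  by rewrite sumr_const card_ord /l -muln2 -(natr1 (p * 2)%N) natrM; ring.
pose h : R := a%:R * pi / l%:R.
have s0 : sin h != 0 by exact: sin_piM_div_neq0.
apply: (mulfI s0); rewrite mulr0 mulrDr mulr1.
have tel n : sin h + sin h * (2 * \sum_(j < n) cos (2 * a%:R * (j.+1%:R * pi / l%:R)))
   = sin ((2 * n%:R + 1) * h).
  elim: n => [|n IH]; first by rewrite big_ord0 !mulr0 addr0 add0r mul1r.
  rewrite big_ord_recr /= [2 * (_ + _)]mulrDr [sin h * (_ + _)]mulrDr addrA IH.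
  have -> : 2 * a%:R * (n.+1%:R * pi / l%:R) = 2 * n.+1%:R * h by rewrite /h; ring.
  have -> : (2 * n%:R + 1) * h = 2 * n.+1%:R * h - h by ring.
  have -> : (2 * n.+1%:R + 1) * h = 2 * n.+1%:R * h + h by ring.
  by rewrite sinB sinD; ring.
rewrite tel; have -> : (2 * p%:R + 1) * h = a%:R * pi + 0.
  have -> : 2 * p%:R + 1 = l%:R :> R by rewrite /l -(natr1 p.*2) -muln2 natrM; ring.
  by rewrite /h addr0; field; lra.
by rewrite sinDpin sin0 mulr0.
Qed.

Lemma sum_multiples (g : nat -> R) (l n : nat) : (0 < l)%N ->
  \sum_(d < n * l) (if (l %| d.+1)%N then g d.+1 else 0) = \sum_(k < n) g (k.+1 * l)%N.
Proof.
move=> l0; elim: n => [|n IH]; first by rewrite !big_ord0.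
rewrite mulSn addnC big_split_ord /= IH big_ord_recr /=; congr (_ + _).
case: l l0 {IH} => // l _; rewrite big_ord_recr /= big1 => [|i _].
  by rewrite add0r -addnS -mulSnr dvdn_mull.
by rewrite -addnS dvdn_addr ?dvdn_mull// gtnNdvd// ltnS.
Qed.

(** Polya's starting point: averaging [(2 cos)^(2m)] over the [l]-th roots of unity
    extracts the binomial coefficients at distance a multiple of [l] from the
    centre. For large [l] and [m] of order [l^2] both sides become theta series. *)
Lemma discrete_theta (p m : nat) : let l := p.*2.+1 in
  1 + 2 * \sum_(j < p) cos (j.+1%:R * pi / l%:R) ^+ m.*2 =
  l%:R * ('C(m.*2, m)%:R / 4 ^+ m) *
  (1 + 2 * \sum_(k < m) ('C(m.*2, m + k.+1 * l)%:R / 'C(m.*2, m)%:R)) :> R.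
Proof.
move=> l; have c0 : 0 < 'C(m.*2, m)%:R :> R by rewrite ltr0n bin_gt0; lia.
have f0 : 0 < 4 ^+ m :> R by rewrite exprn_gt0.
apply: (mulfI (lt0r_neq0 f0)).
have e4 : 4 ^+ m = 2 ^+ m.*2 :> R by rewrite -mul2n exprM; congr (_ ^+ _); ring.
have e4' : 4 ^+ m = 'C(m.*2, m)%:R + 2 * \sum_(d < m) 'C(m.*2, m + d.+1)%:R :> R.
  rewrite e4; have := expr_2cos_even 0 m; rewrite cos0 mulr1 => ->; congr (_ + 2 * _).
  by apply: eq_bigr => d _; rewrite mulr0 cos0 mulr1.
have -> : 4 ^+ m * (1 + 2 * \sum_(j < p) cos (j.+1%:R * pi / l%:R) ^+ m.*2) =
  'C(m.*2, m)%:R * (1 + 2 * p%:R) + 2 * \sum_(d < m) ('C(m.*2, m + d.+1)%:R *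
    (1 + 2 * \sum_(j < p) cos (2 * d.+1%:R * (j.+1%:R * pi / l%:R)))) :> R.
  rewrite mulrDr mulr1 [in X in X + _]e4'.
  have -> : 4 ^+ m * (2 * \sum_(j < p) cos (j.+1%:R * pi / l%:R) ^+ m.*2) =
     2 * \sum_(j < p) ('C(m.*2, m)%:R + 2 * \sum_(d < m) ('C(m.*2, m + d.+1)%:R *
       cos (2 * d.+1%:R * (j.+1%:R * pi / l%:R)))) :> R.
    rewrite mulrCA; congr (2 * _); rewrite mulr_sumr; apply: eq_bigr => j _.
    by rewrite e4 -exprMn expr_2cos_even.
  rewrite big_split /= sumr_const card_ord -mulr_sumr exchange_big /=.
  under [in RHS]eq_bigr do rewrite mulrDr mulr1 mulrCA.
  rewrite [in RHS]big_split /= -[in RHS]mulr_sumr.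
  under [X in _ = _ + 2 * (_ + 2 * X)]eq_bigr do rewrite mulr_sumr.
  by rewrite -mulr_natr; ring.
under eq_bigr do rewrite sum_cos_roots -/l.
have -> : 1 + 2 * p%:R = l%:R :> R by rewrite /l -(natr1 p.*2) -muln2 natrM; ring.
have -> : \sum_(d < m) 'C(m.*2, m + d.+1)%:R * (if (l %| d.+1)%N then l%:R else 0) =
   l%:R * \sum_(k < m) 'C(m.*2, m + k.+1 * l)%:R :> R.
  rewrite -(sum_multiples (fun d => 'C(m.*2, m + d)%:R))// mulr_sumr.
  rewrite -(big_mkord xpredT (fun d => 'C(m.*2, m + d.+1)%:R * (if (l %| d.+1)%N then l%:R else 0))).
  rewrite -(big_mkord xpredT (fun d => l%:R * (if (l %| d.+1)%N then 'C(m.*2, m + d.+1)%:R else 0))).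
  have ml : (m <= m * l)%N by rewrite leq_pmulr.
  rewrite [RHS](big_cat_nat _ ml)//= [X in _ = _ + X]big_nat [X in _ = _ + X]big1 ?addr0.
    by apply: eq_bigr => d _; case: ifP => _; rewrite ?mulr0// mulrC.
  by move=> d /andP[md _]; rewrite bin_small ?if_same ?mulr0//; lia.
rewrite -mulr_suml.
field; lra.
Qed.

(** * Limits of powers and of binomial ratios *)

Lemma squeeze_seq (f g h : nat -> R) (l : R) :
  (\forall n \near \oo, f n <= g n <= h n) ->
  f n @[n --> \oo] --> l -> h n @[n --> \oo] --> l -> g n @[n --> \oo] --> l.
Proof. by move=> fgh fl hl; exact: squeeze_cvgr fgh _ fl hl. Qed.

Lemma cvg_to_eq (a b : R) (u : nat -> R) :
  a = b -> u n @[n --> \oo] --> a -> u n @[n --> \oo] --> b.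
Proof. by move=> ->. Qed.

Lemma eq_cvg_seq (f g : nat -> R) (l : R) : f =1 g ->
  f n @[n --> \oo] --> l -> g n @[n --> \oo] --> l.
Proof. by move=> /funext->. Qed.

Lemma cvg_expR_seq (u : nat -> R) (l : R) :
  u n @[n --> \oo] --> l -> expR (u n) @[n --> \oo] --> expR l.
Proof. by move=> ul; apply: continuous_cvg => //; exact: continuous_expR. Qed.

(** From [1 - x <= e^(-x)] and [e^(-x/(1-x)) <= 1 - x]. *)
Lemma cvg_pow_expR (x : nat -> R) (N : nat -> nat) (y : R) :
  (forall n, 0 <= x n) -> x n @[n --> \oo] --> 0 ->
  (N n)%:R * x n @[n --> \oo] --> y -> (1 - x n) ^+ (N n) @[n --> \oo] --> expR (- y).
Proof.
move=> x0 xl Nx.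
have xs : \forall n \near \oo, x n < 1.
  by apply: (cvgr_lt _ xl); exact: ltr01.
apply: (@squeeze_seq (fun n => expR (- ((N n)%:R * x n / (1 - x n)))) _
   (fun n => expR (- ((N n)%:R * x n)))).
- near=> n; have x1 : x n < 1 by near: n.
  have x0n := x0 n; apply/andP; split; last first.
    rewrite -mulrN expRM_natl lerXn2r ?nnegrE ?expR_ge0//; first by lra.
    by have := expR_ge1Dx (- x n).
  rewrite -mulrA -mulrN expRM_natl lerXn2r ?nnegrE ?expR_ge0//; first by lra.
  rewrite expRN -[leRHS]invrK lef_pV2 ?posrE ?invr_gt0 ?expR_gt0//; last by lra.
  apply: le_trans (expR_ge1Dx _); rewrite le_eqVlt; apply/orP; left; apply/eqP.
  by field; lra.
- apply: cvg_expR_seq; rewrite -[y]divr1; apply: cvgN; apply: cvgM => //.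
  apply: cvgV; first by rewrite oner_neq0.
  by rewrite -[X in _ --> X]subr0; apply: cvgB => //; exact: cvg_cst.
- by apply: cvg_expR_seq; exact: cvgN.
Unshelve. all: end_near.
Qed.

Lemma sin_ge_cosM (u : R) : 0 <= u <= pi -> u * cos u <= sin u <= u.
Proof.
move=> /andP[u0 upi].
have [c [/andP[c0 cu] hc]] := mvt_closed u0 (fun x (_ : 0 <= x <= u) => is_derive_sin x).
rewrite sin0 !subr0 in hc; rewrite hc mulrC; apply/andP; split.
  apply: ler_wpM2r => //; rewrite leNgt; apply/negP.
  by rewrite ltr_cos ?in_itv/= ?c0 ?u0 ?upi ?(le_trans cu upi)//; lra.
by rewrite ler_piMl// cos_le1.
Qed.

(** A weak form of Jordan's inequality, from [sin u = 2 sin (u/2) cos (u/2)] and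
    [cos (u/2)^2 >= 1/2]. *)
Lemma sin_ge_half (u : R) : 0 <= u <= pi / 2 -> u / 2 <= sin u.
Proof.
move=> /andP[u0 upi]; pose v := u / 2; have v0 : 0 <= v by rewrite /v; lra.
have pi0 := pi_gt0 R.
have [//|sv _] := andP (@sin_ge_cosM v _); first by rewrite /v; lra.
have uv : u = v *+ 2 by rewrite /v; lra.
have cu : 0 <= cos u by apply: cos_ge0_pihalf; lra.
have cv : 0 <= cos v by apply: cos_ge0_pihalf; rewrite /v; lra.
have := cos_mulr2n v; rewrite -uv => c2.
rewrite uv sin_mulr2n; have h : cos v * (v * cos v) <= cos v * sin v by exact: ler_wpM2l.
have h2 : v * (1 / 2) <= v * cos v ^+ 2 by apply: ler_wpM2l => //; lra.
by rewrite expr2 in h2; lra.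
Qed.

Section BinomialRatio.
Variable m : nat.

Definition bin_ratio d : R := 'C(m.*2, m + d)%:R / 'C(m.*2, m)%:R.

Lemma bin_ratio_ge0 d : 0 <= bin_ratio d.
Proof. by rewrite divr_ge0. Qed.

Lemma bin_ratio0 : bin_ratio 0 = 1.
Proof. by rewrite /bin_ratio addn0 divff// pnatr_eq0 -lt0n bin_gt0; lia. Qed.

Lemma bin_ratio_small d : (m < d)%N -> bin_ratio d = 0.
Proof. by move=> md; rewrite /bin_ratio bin_small ?mul0r//; lia. Qed.

Lemma bin_ratioS d : (d <= m)%N ->
  bin_ratio d.+1 = bin_ratio d * ((m%:R - d%:R) / (m + d).+1%:R).
Proof.
move=> dm; have := mul_bin_left m.*2 (m + d).
have -> : (m.*2 - (m + d) = m - d)%N by lia.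
move/(congr1 (fun n => n%:R : R)); rewrite !natrM natrB// /bin_ratio addnS => e.
have s0 : 0 < (m + d).+1%:R :> R by rewrite ltr0n.
have -> : 'C(m.*2, (m + d).+1)%:R = (m%:R - d%:R) * 'C(m.*2, m + d)%:R / (m + d).+1%:R :> R.
  by rewrite -e mulrC mulKf// lt0r_neq0.
by ring.
Qed.

(** Each factor [(m-j)/(m+j+1) = 1 - (2j+1)/(m+j+1)] is compared with an
    exponential, and [1 + 3 + ... + (2d-1) = d^2]. *)
Lemma bin_ratio_le d : (0 < m)%N -> (d <= m)%N ->
  bin_ratio d <= expR (- (d%:R ^+ 2 / (m + d)%:R)).
Proof.
move=> m0 dm; suff: forall j, (j <= d)%N -> bin_ratio j <= expR (- (j%:R ^+ 2 / (m + d)%:R)).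
  exact.
have md0 : 0 < (m + d)%:R :> R by rewrite ltr0n; lia.
elim=> [|j IH] jd; first by rewrite bin_ratio0 expr0n mul0r oppr0 expR0.
rewrite bin_ratioS; last by lia.
have -> : - (j.+1%:R ^+ 2 / (m + d)%:R) = - (j%:R ^+ 2 / (m + d)%:R) - (2 * j%:R + 1) / (m + d)%:R :> R.
  by ring.
rewrite expRD; apply: ler_pM; rewrite ?bin_ratio_ge0//.
- by rewrite divr_ge0// subr_ge0 ler_nat; lia.
- by apply: IH; exact: ltnW.
have mj0 : 0 < (m + j).+1%:R :> R by rewrite ltr0n.
have j0 : 0 <= j%:R :> R by [].
apply: le_trans (_ : expR (- ((2 * j%:R + 1) / (m + j).+1%:R)) <= _).
  apply: le_trans (expR_ge1Dx _); rewrite le_eqVlt; apply/orP; left; apply/eqP.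
  rewrite -(natr1 (m + j)%N) natrD; field.
  by rewrite -natrD natr1 lt0r_neq0.
rewrite ler_expR lerN2 ler_pM2l; last by lra.
by rewrite lef_pV2 ?posrE// ler_nat; lia.
Qed.

(** As before, now with [(m+j+1)/(m-j) = 1 + (2j+1)/(m-j)]. *)
Lemma bin_ratio_ge d : (d < m)%N ->
  expR (- (d%:R ^+ 2 / (m - d)%:R)) <= bin_ratio d.
Proof.
move=> dm; suff: forall j, (j <= d)%N -> expR (- (j%:R ^+ 2 / (m - d)%:R)) <= bin_ratio j.
  exact.
have md0 : 0 < (m - d)%:R :> R by rewrite ltr0n; lia.
elim=> [|j IH] jd; first by rewrite bin_ratio0 expr0n mul0r oppr0 expR0.
rewrite bin_ratioS; last by lia.
have -> : - (j.+1%:R ^+ 2 / (m - d)%:R) = - (j%:R ^+ 2 / (m - d)%:R) - (2 * j%:R + 1) / (m - d)%:R :> R.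
  by ring.
rewrite expRD; apply: ler_pM; rewrite ?expR_ge0//; first by apply: IH; exact: ltnW.
have mj0 : 0 < (m - j)%:R :> R by rewrite ltr0n; lia.
have j0 : 0 <= j%:R :> R by [].
apply: le_trans (_ : expR (- ((2 * j%:R + 1) / (m - j)%:R)) <= _).
  rewrite ler_expR lerN2 ler_pM2l; last by lra.
  by rewrite lef_pV2 ?posrE// ler_nat; lia.
rewrite expRN -[leRHS]invrK lef_pV2 ?posrE ?expR_gt0 ?invr_gt0 ?invf_div//.
  apply: le_trans (expR_ge1Dx _); rewrite le_eqVlt; apply/orP; left; apply/eqP.
  rewrite natrB in mj0 *; try lia.
  by rewrite -(natr1 (m + j)%N) natrD; field; lra.
by rewrite divr_gt0 ?ltr0n// -natrB//; lia.
Qed.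

End BinomialRatio.

End Polya.

(** * Wallis' constant and the theta function *)

Section Theta.
Variable R : realType.

Definition central (m : nat) : R := 'C(m.*2, m)%:R / 4 ^+ m.

Lemma central_gt0 m : 0 < central m.
Proof. by rewrite divr_gt0 ?exprn_gt0// ltr0n bin_gt0; lia. Qed.

Lemma centralS m : central m.+1 = central m * ((2 * m%:R + 1) / (2 * m%:R + 2)).
Proof.
have e : (m.+1 * m.+1 * 'C(m.+1.*2, m.+1) = 2 * m.+1 * m.*2.+1 * 'C(m.*2, m))%N.
  have /= h1 := mul_bin_diag m.*2.+1 m.
  have h4 : 'C(m.*2.+1, m) = 'C(m.*2.+1, m.+1) by rewrite -bin_sub; [congr 'C(_, _); lia|lia].
  by rewrite doubleS binS h4 addnn -mul2n mulnCA -!mulnA -h1.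
have m0 : 0 <= m%:R :> R by [].
have f0 : 0 < 4 ^+ m :> R by rewrite exprn_gt0.
move/(congr1 (fun n => n%:R : R)): e; rewrite !natrM -(natr1 m.*2) -(muln2 m) natrM -(natr1 m) (muln2 m) => e.
rewrite /central exprS.
have -> : 'C(m.+1.*2, m.+1)%:R = 2 * (m%:R * 2 + 1) / (m%:R + 1) * 'C(m.*2, m)%:R :> R.
  apply: (mulfI (_ : (m%:R + 1) * (m%:R + 1) != 0)); first by rewrite lt0r_neq0// mulr_gt0; lra.
  by rewrite e; field; lra.
by field; lra.
Qed.

Let up m := central m.+1 ^+ 2 * m.+1%:R.
Let dn m := central m.+1 ^+ 2 * (m.+1%:R + 1 / 2).

(** Its value, [1/pi], is found only in [wallisE]: monotonicity of the two
    sequences is enough to give the limit and its two-sided bounds. *)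
Definition wallis : R := limn up.

Let up_nd : nondecreasing_seq up.
Proof.
apply/nondecreasing_seqP => n; rewrite /up [in leRHS]centralS.
have n0 : 0 < n.+1%:R :> R by rewrite ltr0n.
rewrite -(natr1 n.+1); move: (central n.+1) => c.
move: (n.+1%:R) n0 => x x0.
have -> : (c * ((2 * x + 1) / (2 * x + 2))) ^+ 2 * (x + 1) =
  c ^+ 2 * (x + 1 / (4 * (x + 1))) by field; lra.
by apply: ler_wpM2l; rewrite ?sqr_ge0// lerDl divr_ge0; lra.
Qed.

Let dn_ni : nonincreasing_seq dn.
Proof.
apply/nonincreasing_seqP => n; rewrite /dn [in leLHS]centralS.
have n0 : 0 < n.+1%:R :> R by rewrite ltr0n.
rewrite -(natr1 n.+1); move: (central n.+1) => c.
move: (n.+1%:R) n0 => x x0.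
have -> : (c * ((2 * x + 1) / (2 * x + 2))) ^+ 2 * (x + 1 + 1 / 2) =
  c ^+ 2 * (x + 1 / 2 - (2 * x + 1) / (8 * (x + 1) ^+ 2)) by field; lra.
apply: ler_wpM2l; rewrite ?sqr_ge0// gerBl; apply: divr_ge0; first by lra.
by apply: mulr_ge0; rewrite ?sqr_ge0.
Qed.

Let up_dn n : up n <= dn n.
Proof. by rewrite /up /dn ler_wpM2l ?sqr_ge0// lerDl. Qed.

Let up_bound n : up n <= dn 0.
Proof. by apply: le_trans (up_dn n) (dn_ni (leq0n n)). Qed.

Lemma wallis_cvg : up n @[n --> \oo] --> wallis.
Proof.
apply: nondecreasing_is_cvgn => //; exists (dn 0) => _ [n _ <-]; exact: up_bound.
Qed.

Lemma wallis_ge m : (0 < m)%N -> central m ^+ 2 * m%:R <= wallis.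
Proof.
case: m => // m _; apply: (nondecreasing_cvgn_le up_nd wallis_cvg m).
Qed.

Lemma wallis_le m : (0 < m)%N -> wallis <= central m ^+ 2 * (m%:R + 1 / 2).
Proof.
case: m => // m _; apply: limr_le; first exact: wallis_cvg.
exists m => // n /= mn; exact: le_trans (up_dn n) (dn_ni mn).
Qed.

Definition gauss_sum (t : R) := limn (series (fun k : nat => expR (- (k.+1%:R ^+ 2 * t)))).
Definition theta (t : R) := 1 + 2 * gauss_sum t.

Lemma cvg_series_expRN (c : R) : 0 < c -> cvgn (series (fun k : nat => expR (- (k.+1%:R * c)))).
Proof.
move=> c0; have -> : (fun k : nat => expR (- (k.+1%:R * c))) = geometric (expR (- c)) (expR (- c)).
  by apply/funext => k /=; rewrite -mulrN expRM_natl exprS.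
by apply: is_cvg_geometric_series; rewrite ger0_norm ?expR_ge0// expR_lt1; lra.
Qed.

Lemma gauss_sum_cvg (t : R) : 0 < t -> cvgn (series (fun k : nat => expR (- (k.+1%:R ^+ 2 * t)))).
Proof.
move=> t0; apply: series_le_cvg (cvg_series_expRN t0) => k; rewrite ?expR_ge0//.
rewrite ler_expR lerN2 ler_pM2r// expr2 ler_peMl// ler1n//.
Qed.

Lemma gauss_sum_ge0 (t : R) : 0 < t -> 0 <= gauss_sum t.
Proof.
move=> t0; apply: limr_ge; first exact: gauss_sum_cvg.
by apply: nearW => n; apply: sumr_ge0 => i _; exact: expR_ge0.
Qed.

Lemma theta_gt0 (t : R) : 0 < t -> 0 < theta t.
Proof. by move=> t0; have := gauss_sum_ge0 t0; rewrite /theta; lra. Qed.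

Section Limit.
Variable t : R.
Hypothesis t0 : 0 < t.

(** [m] is the least natural number above [l^2 / t], so that [l^2 / m] tends to [t]. *)
Let l (p : nat) := p.*2.+1.
Let m p := (Num.truncn ((l p)%:R ^+ 2 / t)).+1.

Let l_gt0 p : 0 < (l p)%:R :> R. Proof. by rewrite ltr0n. Qed.

Let m_gt0 p : 0 < (m p)%:R :> R. Proof. by rewrite ltr0n. Qed.

Let m_bounds p : (l p)%:R ^+ 2 / t <= (m p)%:R <= (l p)%:R ^+ 2 / t + 1.
Proof.
have h0 : 0 <= (l p)%:R ^+ 2 / t by rewrite divr_ge0 ?sqr_ge0 ?(ltW t0).
have /andP[h1 h2] := truncn_itv h0.
by rewrite ltW//= /m -(natr1 (Num.truncn _)) lerD2r.
Qed.

Let linv : (l p)%:R^-1 @[p --> \oo] --> (0 : R).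
Proof.
apply: (@squeeze_seq _ (fun=> 0) _ harmonic); [|exact: cvg_cst|exact: cvg_harmonic].
apply: nearW => p; rewrite /= invr_ge0 ler0n/= lef_pV2 ?posrE ?ltr0n// ler_nat /l; lia.
Qed.

Let ml2 : (m p)%:R / (l p)%:R ^+ 2 @[p --> \oo] --> t^-1.
Proof.
apply: (@squeeze_seq _ (fun=> t^-1) _ (fun p => t^-1 + (l p)%:R^-1 * (l p)%:R^-1)); [|exact: cvg_cst|].
  apply: nearW => p; have /andP[h1 h2] := m_bounds p.
  have l0 := l_gt0 p; have l20 : 0 < (l p)%:R ^+ 2 :> R by rewrite exprn_gt0.
  rewrite ler_pdivlMr// ler_pdivrMr// mulrC h1/=; apply: le_trans h2 _.
  by rewrite le_eqVlt; apply/orP; left; apply/eqP; have ht := t0; field; lra.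
apply: (@cvg_to_eq _ (t^-1 + 0 * 0)); first by rewrite mulr0 addr0.
by apply: cvgD; [exact: cvg_cst|exact: cvgM].
Qed.

Let l2m : (l p)%:R ^+ 2 / (m p)%:R @[p --> \oo] --> t.
Proof.
have -> : (fun p => (l p)%:R ^+ 2 / (m p)%:R) = (fun p => ((m p)%:R / (l p)%:R ^+ 2)^-1 : R).
  by apply/funext => p; rewrite invf_div.
by rewrite -[t]invrK; apply: cvgV => //; rewrite invr_neq0// lt0r_neq0.
Qed.

Let lsin (c : R) : 0 <= c -> (l p)%:R * sin (c / (l p)%:R) @[p --> \oo] --> c.
Proof.
move=> c0.
have cl0 : c / (l p)%:R @[p --> \oo] --> (0 : R).
  by rewrite -[X in _ --> X](mulr0 c); apply: cvgM; [exact: cvg_cst|exact: linv].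
apply: (@squeeze_seq _ (fun p => c * cos (c / (l p)%:R)) _ (fun=> c)); [|..|exact: cvg_cst].
  near=> p; have l0 := l_gt0 p.
  have cpi : c / (l p)%:R <= pi.
    near: p; exact: (cvgr_le _ cl0 _ (pi_gt0 R)).
  have : 0 <= c / (l p)%:R <= pi by rewrite divr_ge0 ?(ltW l0).
  move=> /sin_ge_cosM; rewrite mulrAC ler_pdivrMr// ler_pdivlMr// mulrC.
  by rewrite [sin _ * _]mulrC.
apply: (@cvg_to_eq _ (c * cos 0)); first by rewrite cos0 mulr1.
apply: cvgM; first exact: cvg_cst.
exact: (@continuous_cvg _ _ _ _ _ (fun p => c / (l p)%:R) cos 0 (@continuous_cos R 0) cl0).
Unshelve. all: end_near.
Qed.

Let cos_limit (j : nat) :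
  cos (j.+1%:R * pi / (l p)%:R) ^+ (m p).*2 @[p --> \oo] --> expR (- (j.+1%:R ^+ 2 * (pi ^+ 2 / t))).
Proof.
set c := j.+1%:R * pi.
have c0 : 0 <= c by rewrite mulr_ge0// pi_ge0.
have -> : (fun p => cos (c / (l p)%:R) ^+ (m p).*2) = (fun p => (1 - sin (c / (l p)%:R) ^+ 2) ^+ m p).
  by apply/funext => p; rewrite -cos2sin2 -exprM mul2n.
apply: cvg_pow_expR => [p||]; first exact: sqr_ge0.
  have -> : (fun p => sin (c / (l p)%:R) ^+ 2) = (fun p => ((l p)%:R * sin (c / (l p)%:R) * (l p)%:R^-1)
     * ((l p)%:R * sin (c / (l p)%:R) * (l p)%:R^-1)).
    by apply/funext => p; have := (l_gt0 p, m_gt0 p) => -[? ?]; field; lra.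
  apply: (@cvg_to_eq _ (c * 0 * (c * 0))); first by rewrite !mulr0.
  by apply: cvgM; apply: cvgM => //; exact: lsin.
have -> : (fun p => (m p)%:R * sin (c / (l p)%:R) ^+ 2) = (fun p => (m p)%:R / (l p)%:R ^+ 2 *
     ((l p)%:R * sin (c / (l p)%:R) * ((l p)%:R * sin (c / (l p)%:R)))).
  by apply/funext => p; have := (l_gt0 p, m_gt0 p) => -[? ?]; field; lra.
have -> : j.+1%:R ^+ 2 * (pi ^+ 2 / t) = t^-1 * (c * c) by rewrite /c; ring.
by apply: cvgM => //; apply: cvgM; exact: lsin.
Qed.

Let bin_limit (k : nat) :
  bin_ratio R (m p) (k.+1 * l p)%N @[p --> \oo] --> expR (- (k.+1%:R ^+ 2 * t)).
Proof.
have minv : (l p)%:R / (m p)%:R @[p --> \oo] --> (0 : R).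
  have -> : (fun p => (l p)%:R / (m p)%:R) = (fun p => (l p)%:R ^+ 2 / (m p)%:R * (l p)%:R^-1 : R).
    by apply/funext => p; have := (l_gt0 p, m_gt0 p) => -[? ?]; field; lra.
  by rewrite -[X in _ --> X](mulr0 t); apply: cvgM.
have lm (e : R) : k.+1%:R ^+ 2 * ((l p)%:R ^+ 2 / (m p)%:R) / (1 + e * (k.+1%:R * ((l p)%:R / (m p)%:R)))
    @[p --> \oo] --> k.+1%:R ^+ 2 * t.
  apply: (@cvg_to_eq _ (k.+1%:R ^+ 2 * t / (1 + e * (k.+1%:R * 0)))).
    by rewrite !mulr0 addr0 divr1.
  apply: cvgM; first by apply: cvgM => //; exact: cvg_cst.
  apply: cvgV; first by rewrite !mulr0 addr0 oner_neq0.
  by apply: cvgD; [exact: cvg_cst|apply: cvgM; [exact: cvg_cst|apply: cvgM => //; exact: cvg_cst]].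
have small : \forall p \near \oo, k.+1%:R * ((l p)%:R / (m p)%:R) < 1 :> R.
  apply: (cvgr_lt (0 : R)) => //.
  by rewrite -[X in _ --> X](mulr0 k.+1%:R); apply: cvgM => //; exact: cvg_cst.
apply: (@squeeze_seq _
  (fun p => expR (- (k.+1%:R ^+ 2 * ((l p)%:R ^+ 2 / (m p)%:R) / (1 + -1 * (k.+1%:R * ((l p)%:R / (m p)%:R)))))) _
  (fun p => expR (- (k.+1%:R ^+ 2 * ((l p)%:R ^+ 2 / (m p)%:R) / (1 + 1 * (k.+1%:R * ((l p)%:R / (m p)%:R)))))));
  [|by apply: cvg_expR_seq; apply: cvgN..].
near=> p; have sp : k.+1%:R * ((l p)%:R / (m p)%:R) < 1 :> R by near: p.
have m0 : 0 < (m p)%:R :> R by rewrite ltr0n.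
have klm : (k.+1 * l p < m p)%N.
  by move: sp; rewrite mulrA ltr_pdivrMr// mul1r -natrM ltr_nat.
have l0 := l_gt0 p; have k0 : 0 < k.+1%:R :> R by rewrite ltr0n.
have := bin_ratio_ge R klm; have := bin_ratio_le R (leq_ltn_trans (leq0n _) klm) (ltnW klm).
have klm' : k.+1%:R * (l p)%:R < (m p)%:R :> R by rewrite -natrM ltr_nat.
have kl0 : 0 < k.+1%:R * (l p)%:R :> R by rewrite mulr_gt0.
rewrite natrB ?(ltnW klm)// natrD !natrM => h1 h2; apply/andP; split.
  apply: le_trans h2; rewrite le_eqVlt; apply/orP; left; apply/eqP; congr (expR (- _)).
  by field; lra.
apply: le_trans h1 _; rewrite le_eqVlt; apply/orP; left; apply/eqP; congr (expR (- _)).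
by field; lra.
Unshelve. all: end_near.
Qed.

Let cos_dom p j : (j < p)%N ->
  `|cos (j.+1%:R * pi / (l p)%:R) ^+ (m p).*2| <= expR (- (j.+1%:R * t^-1)).
Proof.
move=> jp; have l0 := l_gt0 p; have pi2 := pi_ge2 R; have ht := t0.
set u := j.+1%:R * pi / (l p)%:R.
have u0 : 0 <= u by rewrite divr_ge0 ?mulr_ge0 ?(ltW l0)//; lra.
have u1 : u <= pi / 2.
  rewrite /u ler_pdivrMr//; have -> : (l p)%:R = 2 * p%:R + 1 :> R.
    by rewrite /l -(natr1 p.*2) -muln2 natrM mulrC.
  have : j.+1%:R <= p%:R :> R by rewrite ler_nat.
  nra.
have [h _] := (@sin_ge_half _ u, tt); rewrite u0 u1 in h; have {}h := h isT.
rewrite -mul2n exprM cos2sin2 ger0_norm; last by rewrite exprn_ge0// -cos2sin2 sqr_ge0.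
apply: le_trans (_ : expR (- sin u ^+ 2) ^+ m p <= _).
  by rewrite lerXn2r ?nnegrE ?expR_ge0// -?cos2sin2 ?sqr_ge0// cos2sin2; exact: expR_ge1Dx.
rewrite -expRM_natl ler_expR mulrN lerN2.
have /andP[h1 _] := m_bounds p.
apply: le_trans (_ : (l p)%:R ^+ 2 / t * (u / 2) ^+ 2 <= _); last first.
  apply: ler_pM => //; rewrite ?divr_ge0 ?sqr_ge0 ?(ltW t0)//.
  by rewrite lerXn2r ?nnegrE//; lra.
have -> : (l p)%:R ^+ 2 / t * (u / 2) ^+ 2 = j.+1%:R ^+ 2 * (pi / 2) ^+ 2 * t^-1.
  by rewrite /u; field; lra.
rewrite ler_pM2r ?invr_gt0//.
have j1 : 1 <= j.+1%:R :> R by rewrite ler1n.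
have p1 : 1 <= pi / 2 :> R by lra.
apply: (@le_trans _ _ (j.+1%:R ^+ 2)); first by rewrite expr2 ler_peMr//; lra.
by rewrite ler_peMr ?sqr_ge0// exprn_ege1.
Qed.

(** The geometric majorant of the binomial side, uniform in [p]: within the range
   [k l <= m] the exponent [(k l)^2 / (m + k l)] is at least [(k l)^2 / (2 m)]. *)
Let bin_dom p k :
  `|bin_ratio R (m p) (k.+1 * l p)| <= expR (- (k.+1%:R * (2 * (t^-1 + 1))^-1)).
Proof.
have ht := t0; have l0 := l_gt0 p; have ti : 0 < t^-1 by rewrite invr_gt0.
rewrite ger0_norm ?bin_ratio_ge0//.
have [mk|mk] := ltnP (m p) (k.+1 * l p)%N; first by rewrite bin_ratio_small// expR_ge0.
apply: le_trans (bin_ratio_le R _ mk) _ => //; rewrite ler_expR lerN2.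
have k1 : 1 <= k.+1%:R :> R by rewrite ler1n.
have /andP[_ h2] := m_bounds p.
have l1 : 1 <= (l p)%:R :> R by rewrite ler1n.
have m0 : 0 < (m p)%:R :> R by rewrite ltr0n.
have mk' : k.+1%:R * (l p)%:R <= (m p)%:R :> R by rewrite -natrM ler_nat.
rewrite natrD natrM ler_pdivlMr; last by have := mulr_ge0 (ler0n R k.+1) (ltW l0); lra.
rewrite mulrAC ler_pdivrMr; last by lra.
have h3 : (m p)%:R <= (l p)%:R ^+ 2 * (t^-1 + 1).
  by apply: le_trans h2 _; rewrite mulrDr mulr1 lerD2l expr2; nra.
apply: (@le_trans _ _ (k.+1%:R * (2 * ((l p)%:R ^+ 2 * (t^-1 + 1))))).
  by rewrite ler_pM2l; lra.
have : 0 <= (l p)%:R ^+ 2 * (t^-1 + 1) by rewrite mulr_ge0 ?sqr_ge0//; lra.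
rewrite exprMn; move: k1 {mk'}; set K := k.+1%:R; set L := (l p)%:R ^+ 2 => k1 hL.
have -> : K ^+ 2 * L * (2 * (t^-1 + 1)) = K * (K * (2 * (L * (t^-1 + 1)))) by ring.
by rewrite ler_pM2l; [nra|lra].
Qed.

(** The limit of [discrete_theta] along [m ~ l^2 / t], by Tannery's theorem on
    either side: [m sin^2 (j pi / l)] tends to [j^2 pi^2 / t] on the left, and
    [(k l)^2 / m] to [k^2 t] on the right. *)
Lemma theta_wallis : theta (pi ^+ 2 / t) = Num.sqrt (t * wallis) * theta t.
Proof.
have ht := t0; have ti : 0 < t^-1 by rewrite invr_gt0.
pose a p j := if (j < p)%N then cos (j.+1%:R * pi / (l p)%:R) ^+ (m p).*2 else 0 : R.
pose b p k := if (k < m p)%N then bin_ratio R (m p) (k.+1 * l p)%N else 0.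
have La : \sum_(j < p) a p j @[p --> \oo] --> gauss_sum (pi ^+ 2 / t).
  apply: (@tannery _ a (fun j => expR (- (j.+1%:R ^+ 2 * (pi ^+ 2 / t)))) _ id) (cvg_series_expRN ti) => [j|p j|p j pj].
  - apply: squeeze_seq (@cos_limit j) (@cos_limit j).
    by exists j.+1 => // p /= jp; rewrite /a jp lexx.
  - by rewrite /a; case: ifP => [|_]; [exact: cos_dom|rewrite normr0 expR_ge0].
  - by rewrite /a ltnNge pj.
have Lb : \sum_(k < m p) b p k @[p --> \oo] --> gauss_sum t.
  have c0 : 0 < (2 * (t^-1 + 1))^-1 by rewrite invr_gt0; lra.
  apply: (@tannery _ b (fun k => expR (- (k.+1%:R ^+ 2 * t))) _ m) (cvg_series_expRN c0) => [k|p k|p k pk].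
  - have -> : b ^~ k = (fun p => bin_ratio R (m p) (k.+1 * l p)%N); last exact: (@bin_limit k).
    apply/funext => p; rewrite /b; case: ltnP => // mk; rewrite bin_ratio_small//.
    by rewrite /l; lia.
  - by rewrite /b; case: ifP => _; [exact: bin_dom|rewrite normr0 expR_ge0].
  - by rewrite /b ltnNge pk.
(* [l central(m)] is the square root of [(l^2 / m) (central(m)^2 m)], whose factors tend to [t] and Wallis' constant. *)
have Lc : (l p)%:R * central (m p) @[p --> \oo] --> Num.sqrt (t * wallis).
  have -> : (fun p => (l p)%:R * central (m p)) =
      (fun p => Num.sqrt ((l p)%:R ^+ 2 / (m p)%:R * (central (m p) ^+ 2 * (m p)%:R))).
    apply/funext => p; have m0 : 0 < (m p)%:R :> R by rewrite ltr0n.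
    have -> : (l p)%:R ^+ 2 / (m p)%:R * (central (m p) ^+ 2 * (m p)%:R) = ((l p)%:R * central (m p)) ^+ 2.
      by field; lra.
    by rewrite sqrtr_sqr ger0_norm// mulr_ge0// ltW// central_gt0.
  apply: continuous_cvg; first exact: sqrt_continuous.
  apply: cvgM => //; rewrite -[X in X @ _](_ : up \o (fun p => (m p).-1) = _)//.
  apply: cvg_comp wallis_cvg.
  apply/cvgnyPge => A; exists `|Num.ceil (A.+1%:R * t)|%N => // p /= Bp.
  have Ap : A.+1%:R * t <= p%:R.
    apply: le_trans (_ : `|Num.ceil (A.+1%:R * t)|%N%:R <= _); last by rewrite ler_nat.
    rewrite natr_absz ger0_norm ?ceil_ge// ceil_ge0.
    by apply: lt_le_trans (_ : 0 <= _) => //; rewrite mulr_ge0// ltW.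
  have /andP[h _] := m_bounds p.
  suff : (A.+1 <= m p)%N by [].
  rewrite -(ler_nat R); apply: le_trans h; rewrite ler_pdivlMr//; apply: le_trans Ap _.
  by rewrite -natrX ler_nat /l; nia.
have E p : 1 + 2 * \sum_(j < p) a p j =
  (l p)%:R * central (m p) * (1 + 2 * \sum_(k < m p) b p k).
  have := discrete_theta R p (m p); rewrite -/(l p) -/(central (m p)) => e.
  have -> : \sum_(j < p) a p j = \sum_(j < p) cos (j.+1%:R * pi / (l p)%:R) ^+ (m p).*2.
    by apply: eq_bigr => j _; rewrite /a ltn_ord.
  by rewrite e; congr (_ * (1 + 2 * _)); apply: eq_bigr => k _; rewrite /b ltn_ord.
have H1 : 1 + 2 * \sum_(j < p) a p j @[p --> \oo] --> theta (pi ^+ 2 / t).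
  by apply: cvgD; [exact: cvg_cst|apply: cvgM => //; exact: cvg_cst].
have H2 : 1 + 2 * \sum_(j < p) a p j @[p --> \oo] --> Num.sqrt (t * wallis) * theta t.
  under eq_fun do rewrite E; apply: cvgM => //.
  by apply: cvgD; [exact: cvg_cst|apply: cvgM => //; exact: cvg_cst].
exact: (cvg_unique _ H1 H2).
Qed.
End Limit.

(** The functional equation is its own normalisation: at the fixed point [t = pi]
    of [t -> pi^2 / t] it forces Wallis' constant. *)
Lemma wallisE : wallis = pi^-1.
Proof.
have pi0 := pi_gt0 R.
have := theta_wallis pi0; rewrite expr2 mulfK ?lt0r_neq0// => e.
have th := theta_gt0 pi0.
have e1 : Num.sqrt (pi * wallis) = 1.
  by apply: (mulIf (lt0r_neq0 th)); rewrite mul1r.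
have : 0 <= pi * wallis.
  rewrite mulr_ge0 ?pi_ge0//; apply: le_trans (wallis_ge (ltn0Sn 0)).
  by rewrite mulr_ge0// sqr_ge0.
move=> /sqr_sqrtr; rewrite e1 expr1n => e2.
by apply: (mulfI (lt0r_neq0 pi0)); rewrite -e2 divff// lt0r_neq0.
Qed.

Lemma theta_inversion (x : R) : 0 < x -> theta (pi / x) = Num.sqrt x * theta (pi * x).
Proof.
move=> x0; have pi0 := pi_gt0 R.
have := theta_wallis (mulr_gt0 pi0 x0); rewrite wallisE.
have -> : pi ^+ 2 / (pi * x) = pi / x :> R by field; lra.
by have -> : pi * x / pi = x :> R by field; lra.
Qed.
End Theta.

(** * The function omega *)

Section Omega.
Variable R : realType.

Lemma is_derive_pos_unique (f g : R -> R) (x a b : R) : 0 < x ->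
  (forall y, 0 < y -> f y = g y) ->
  is_derive x (1 : R) f a -> is_derive x (1 : R) g b -> a = b.
Proof.
move=> x0 fg [_ <-] [_ <-]; apply: near_eq_derive.
by near=> y; apply: fg; near: y; exact: lt_nbhsr.
Unshelve. all: end_near.
Qed.

(** The indicator of the positive squares: the theta series becomes a power series
    in [q = exp (- pi x)], and its derivatives in [x] come from the Euler operator. *)
Definition square_coef (k : nat) : R :=
  ([exists m : 'I_k.+1, (0 < m)%N && (m * m == k)%N])%:R.

Lemma square_coefP m : (0 < m)%N -> square_coef (m * m) = 1.
Proof.
move=> m0; rewrite /square_coef; case: existsP => // -[].
have mm : (m < (m * m).+1)%N by rewrite ltnS leq_pmulr.
by exists (Ordinal mm); rewrite /= m0 eqxx.
Qed.

Lemma square_coef_gap m k : (m * m < k < m.+1 * m.+1)%N -> square_coef k = 0.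
Proof.
move=> /andP[mk km]; rewrite /square_coef; case: existsP => // -[j /andP[_ /eqP jj]].
have : (m < j)%N by rewrite ltnNge; apply/negP => h; have := leq_mul h h; lia.
by move=> h; have := leq_mul h h; lia.
Qed.

Lemma square_coef_ge0 k : 0 <= square_coef k.
Proof. exact: ler0n. Qed.

Lemma square_coef_le1 k : square_coef k <= 1.
Proof. by rewrite /square_coef; case: existsP. Qed.

Lemma tempered_square : tempered square_coef.
Proof.
apply: (@tempered_bounded _ _ 1) => k.
by rewrite ger0_norm ?square_coef_ge0// square_coef_le1.
Qed.

Definition square_coef1 k := k%:R * square_coef k.
Definition square_coef2 k := k%:R * square_coef1 k.

Lemma tempered_square1 : tempered square_coef1.
Proof. exact/tempered_natmul/tempered_square. Qed.

Lemma tempered_square2 : tempered square_coef2.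
Proof. exact/tempered_natmul/tempered_square1. Qed.

Lemma sum_square_coef (f : nat -> R) N :
  \sum_(k < (N * N).+1) square_coef k * f k = \sum_(m < N) f (m.+1 * m.+1)%N.
Proof.
elim: N => [|N IH].
  rewrite big_ord1 big_ord0 /square_coef; case: existsP => [[j /andP[j0 /eqP jj]]|_].
    by have := muln_gt0 j j; rewrite jj j0.
  by rewrite mul0r.
rewrite [RHS]big_ord_recr /= -IH.
have e : (N.+1 * N.+1 = (N * N).+1 + N.*2)%N by lia.
rewrite big_ord_recr /= square_coefP// mul1r; congr (_ + _).
rewrite e big_split_ord /= [X in _ + X]big1 ?addr0// => i _.
rewrite (@square_coef_gap N) ?mul0r//; have := ltn_ord i.
by rewrite e; move: (nat_of_ord i) => j; lia.
Qed.

Lemma psum_square_cvg (f : nat -> R) (q : R) :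
  tempered (fun k => f k * square_coef k) -> `|q| < 1 ->
  \sum_(m < N) f (m.+1 * m.+1)%N * q ^+ (m.+1 * m.+1) @[N --> \oo] -->
  psum (fun k => f k * square_coef k) q.
Proof.
move=> tf q1; have := tempered_cvg tf q1.
move=> /(cvg_comp (fun N => (N * N).+1)); move=> h.
have {}h : pseries (fun k => f k * square_coef k) q \o (fun N => (N * N).+1) @ \oo -->
  psum (fun k => f k * square_coef k) q.
  apply: h; apply/cvgnyPge => A; exists A => // N /= AN; apply: leq_trans AN _; nia.
apply: eq_cvg_seq h => N; rewrite -(sum_square_coef (fun k => f k * q ^+ k)) /= /pseries /series /= big_mkord.
by apply: eq_bigr => k _; ring.
Qed.

Let q (x : R) := expR (- (pi * x)).
Let q_lt1 (x : R) : 0 < x -> `|q x| < 1.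
Proof.
by move=> x0; rewrite ger0_norm ?expR_ge0// expR_lt1 oppr_lt0 mulr_gt0// pi_gt0.
Qed.
Let q_itv (x : R) : 0 < x -> 0 <= q x < 1.
Proof. by move=> x0; rewrite expR_ge0/=; have := q_lt1 x0; rewrite ger0_norm// expR_ge0. Qed.

Let G x := psum square_coef (q x).
Let E1 x := psum square_coef1 (q x).
Let E2 x := psum square_coef2 (q x).

Let dq (x : R) : is_derive x (1 : R) q (q x * - pi).
Proof.
have h : is_derive x (1 : R) (fun y : R => - pi * y) (- pi).
  by have := is_derive_mulcf (- pi) (is_derive_id x (1:R)); rewrite mulr1.
have -> : q = (fun y => expR (- pi * y)) by apply/funext => y; rewrite /q mulNr.
exact: (is_derive_compf expR (fun y => - pi * y) (is_derive_expR _) h).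
Qed.

Let dpsum (c : nat -> R) (x : R) : tempered c -> 0 < x ->
  is_derive x (1 : R) (fun y => psum c (q y)) (- pi * psum (fun k => k%:R * c k) (q x)).
Proof.
move=> tc x0; have d := psum_is_derive tc (q_lt1 x0).
have := is_derive_compf (psum c) q d (dq x).
by rewrite psum_euler ?q_lt1//; congr is_derive; ring.
Qed.

Lemma gauss_sumE (x : R) : 0 < x -> gauss_sum (pi * x) = G x.
Proof.
move=> x0; apply: cvg_lim => //.
have := @psum_square_cvg (fun=> 1) (q x) _ (q_lt1 x0).
have e : (fun k => 1 * square_coef k) = square_coef by apply/funext => k; rewrite mul1r.
rewrite e => /(_ tempered_square); apply: eq_cvg_seq => N; rewrite /series /= big_mkord; apply: eq_bigr => k _.
by rewrite mul1r /q -expRM_natl natrM; congr expR; ring.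
Qed.

Lemma omega_psum (x : R) : 0 < x ->
  omega x = 2 * pi ^+ 2 * x ^+ 2 * E2 x - 3 * pi * x * E1 x.
Proof.
move=> x0; apply: cvg_lim => //; rewrite -cvg_shiftS.
have tl := tempered_lin (2 * pi ^+ 2 * x ^+ 2) (- (3 * pi * x)) tempered_square2 tempered_square1.
rewrite -mulNr -psum_lin//; [|exact: tempered_square2|exact: tempered_square1|exact: q_lt1].
pose f k := 2 * pi ^+ 2 * x ^+ 2 * (k%:R * k%:R) + - (3 * pi * x) * k%:R : R.
have ef : (fun k => 2 * pi ^+ 2 * x ^+ 2 * square_coef2 k + - (3 * pi * x) * square_coef1 k) =
   (fun k => f k * square_coef k).
  by apply/funext => k; rewrite /square_coef2 /square_coef1 /f; ring.
rewrite ef in tl *; have := psum_square_cvg tl (q_lt1 x0).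
apply: eq_cvg_seq => N; rewrite big_add1 /= big_mkord; apply: eq_bigr => m _.
rewrite /f /q -expRM_natl natrM; congr (_ * expR _); ring.
Qed.

(** Differentiating Jacobi's equation once. *)
Let E1_inversion (x : R) : 0 < x -> 2 * pi * E1 x^-1 / x ^+ 2 =
  (1 + 2 * G x) / (2 * Num.sqrt x) - 2 * pi * Num.sqrt x * E1 x.
Proof.
move=> x0; have s0 : 0 < Num.sqrt x by rewrite sqrtr_gt0.
have xi0 : 0 < x^-1 by rewrite invr_gt0.
have dinv : is_derive x (1 : R) (fun y : R => y^-1) (- 1 / x ^+ 2).
  by apply: (is_derive_invf (is_derive_id x 1)); rewrite lt0r_neq0.
have dG (y : R) : 0 < y -> is_derive y (1 : R) G (- pi * E1 y) := dpsum tempered_square.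
have dL := is_derive_addf (is_derive_cst (1:R) x 1) (is_derive_mulcf 2
   (is_derive_compf G (fun y => y^-1) (dG _ xi0) dinv)).
have dR := is_derive_mulf (is_derive1_sqrt x0) (is_derive_addf (is_derive_cst (1:R) x 1)
   (is_derive_mulcf 2 (dG _ x0))).
have := is_derive_pos_unique x0 _ dL dR.
rewrite add0r => e; transitivity (2 * (- pi * E1 x^-1 * (- 1 / x ^+ 2))); first by field; lra.
rewrite e => [|y y0]; first by rewrite /cst /=; field; lra.
have := theta_inversion y0; rewrite /theta !gauss_sumE// ?invr_gt0//.
Qed.

(** Differentiating it twice: [omega] is the combination
    [x^2 d^2/dx^2 + (x/2) d/dx] of the two sides at [1/x], in which the
    undifferentiated theta function cancels. *)
Lemma omega_inversion (x : R) : 0 < x -> omega x^-1 = Num.sqrt x * omega x.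
Proof.
move=> x0; have s0 : 0 < Num.sqrt x by rewrite sqrtr_gt0.
have xi0 : 0 < x^-1 by rewrite invr_gt0.
have dinv : is_derive x (1 : R) (fun y : R => y^-1) (- 1 / x ^+ 2).
  by apply: (is_derive_invf (is_derive_id x 1)); rewrite lt0r_neq0.
have dG (y : R) : 0 < y -> is_derive y (1 : R) G (- pi * E1 y) := dpsum tempered_square.
have dE (y : R) : 0 < y -> is_derive y (1 : R) E1 (- pi * E2 y) := dpsum tempered_square1.
have dsq : is_derive x (1 : R) (fun y => y * y) (1 * x + x * 1).
  exact: (is_derive_mulf (is_derive_id x 1) (is_derive_id x 1)).
have xx0 : x * x != 0 by rewrite mulf_neq0// lt0r_neq0.
have dL := is_derive_mulcf (2 * pi) (is_derive_mulf
   (is_derive_compf E1 (fun y => y^-1) (dE _ xi0) dinv) (is_derive_invf dsq xx0)).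
have ds := is_derive1_sqrt x0.
have ds2 := is_derive_mulcf 2 ds.
have s20 : 2 * Num.sqrt x != 0 by rewrite mulf_neq0// lt0r_neq0.
have dR := is_derive_subf
  (is_derive_mulf (is_derive_addf (is_derive_cst (1:R) x 1) (is_derive_mulcf 2 (dG _ x0)))
    (is_derive_invf ds2 s20))
  (is_derive_mulcf (2 * pi) (is_derive_mulf ds (dE _ x0))).
have e1 := E1_inversion x0.
have := is_derive_pos_unique x0 _ dL dR => e2.
have {}e2 := e2 _; rewrite !omega_psum//.
have xs : x = Num.sqrt x ^+ 2 by rewrite sqr_sqrtr// ltW.
have {}e2 : 2 * pi * ((- pi * E2 x^-1 * (-1 / x ^+ 2)) / (x * x)
     + E1 x^-1 * (- (1 * x + x * 1) / (x * x) ^+ 2)) =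
   (2 * (- pi * E1 x)) / (2 * Num.sqrt x)
   + (1 + 2 * G x) * (- (2 * (2 * Num.sqrt x)^-1) / (2 * Num.sqrt x) ^+ 2)
   - 2 * pi * ((2 * Num.sqrt x)^-1 * E1 x + Num.sqrt x * (- pi * E2 x)).
  move: e2; rewrite /cst /= add0r; apply => y y0.
  rewrite -mulrA; have := E1_inversion y0; rewrite expr2; lra.
have -> : 2 * pi ^+ 2 * x^-1 ^+ 2 * E2 x^-1 - 3 * pi * x^-1 * E1 x^-1 =
  x ^+ 2 * (2 * pi * ((- pi * E2 x^-1 * (-1 / x ^+ 2)) / (x * x)
     + E1 x^-1 * (- (1 * x + x * 1) / (x * x) ^+ 2))) + x / 2 * (2 * pi * E1 x^-1 / x ^+ 2).
  by field; lra.
rewrite e1 e2; move: (E1 x) (E2 x) (G x) => a b c.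
by rewrite xs sqrtr_sqr ger0_norm ?(ltW s0)//; field; lra.
Qed.

Lemma q_sum_ge0 c (x : R) : tempered c -> (forall k, 0 <= c k) -> 0 < x -> 0 <= psum c (q x).
Proof. by move=> tc c0 x0; apply: psum_ge0 => //; exact: q_itv. Qed.

Let sq1_ge0 k : 0 <= square_coef1 k.
Proof. by rewrite mulr_ge0 ?square_coef_ge0. Qed.

Let sq2_ge0 k : 0 <= square_coef2 k.
Proof. by rewrite mulr_ge0. Qed.

(** All terms of [omega] are nonnegative for [x >= 1], and the first one is the
    bound. *)
Lemma omega_ge (x : R) : 1 <= x ->
  (2 * pi ^+ 2 * x ^+ 2 - 3 * pi * x) * expR (- (pi * x)) <= omega x.
Proof.
move=> x1; have x0 : 0 < x by lra.
have p2 := pi_ge2 R.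
pose c k := 2 * pi ^+ 2 * x ^+ 2 * square_coef2 k + - (3 * pi * x) * square_coef1 k.
have tc : tempered c by exact: tempered_lin tempered_square2 tempered_square1.
have -> : omega x = psum c (q x).
  rewrite omega_psum// psum_lin ?mulNr//; [exact: tempered_square2|exact: tempered_square1|exact: q_lt1].
have c0 k : 0 <= c k.
  rewrite /c /square_coef2; case: k => [|k]; first by rewrite /square_coef1 !mul0r !mulr0 addr0.
  have k1 : 1 <= k.+1%:R :> R by rewrite ler1n.
  have -> : 2 * pi ^+ 2 * x ^+ 2 * (k.+1%:R * square_coef1 k.+1) + - (3 * pi * x) * square_coef1 k.+1
    = pi * x * (2 * (pi * (x * k.+1%:R)) - 3) * square_coef1 k.+1 by ring.
  have xk : 1 <= x * k.+1%:R by exact: mulr_ege1.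
  have : pi <= pi * (x * k.+1%:R) by rewrite ler_peMr//; lra.
  by move=> h; rewrite !mulr_ge0//; lra.
rewrite psum_succ ?q_lt1//.
have -> : c 0%N = 0 by rewrite /c /square_coef2 /square_coef1 !mul0r !mulr0 addr0.
rewrite add0r mulrC ler_wpM2l ?expR_ge0//.
have -> : 2 * pi ^+ 2 * x ^+ 2 - 3 * pi * x = (c \o succn) 0%N.
  by rewrite /= /c /square_coef2 /square_coef1 (@square_coefP 1)//; ring.
by apply: (psum_ge_head (tempered_succ tc) (q_itv x0)) => k; exact: c0.
Qed.

(** The terms after the first carry a further factor [q = exp (- pi x) <= 1 / x]. *)
Lemma omega_le : exists2 K : R, 0 <= K & forall x : R, 1 <= x ->
  omega x <= 2 * pi ^+ 2 * x ^+ 2 * expR (- (pi * x)) * (1 + K / x).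
Proof.
have p2 := pi_ge2 R; pose c := square_coef2 \o succn \o succn.
have tc : tempered c by do 2 apply: tempered_succ; exact: tempered_square2.
have c0 k : 0 <= c k by exact: sq2_ge0.
have M0 : 0 <= psum c (q 1) by apply: q_sum_ge0.
exists (psum c (q 1)) => // x x1; have x0 : 0 < x by lra.
rewrite omega_psum//.
have E10 : 0 <= E1 x by apply: q_sum_ge0 => //; exact: tempered_square1.
have E2x : E2 x = q x * (1 + q x * psum c (q x)).
  rewrite /E2 psum_succ ?q_lt1//; last exact: tempered_square2.
  rewrite {1}/square_coef2 mul0r add0r psum_succ ?q_lt1//; last first.
    exact/tempered_succ/tempered_square2.
  by congr (_ * (_ + _)); rewrite /= /square_coef2 /square_coef1 (@square_coefP 1)// !mulr1.
apply: (@le_trans _ _ (2 * pi ^+ 2 * x ^+ 2 * E2 x)).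
  by rewrite gerBl; apply: mulr_ge0 => //; apply: mulr_ge0; lra.
rewrite E2x -[leRHS]mulrA; apply: ler_wpM2l; first exact: mulr_ge0 (mulr_ge0 (ler0n _ 2) (sqr_ge0 _)) (sqr_ge0 _).
apply: ler_wpM2l; first exact: expR_ge0.
rewrite lerD2l mulrC.
have /andP[q0 _] := q_itv x0.
apply: ler_pM => //; first by apply: q_sum_ge0.
  apply: ler_psum_arg => //; last by have /andP[] := q_itv ltr01.
  by rewrite ler_expR lerN2 ler_pM2l//; lra.
rewrite /q expRN lef_pV2 ?posrE ?expR_gt0//.
by apply: le_trans (expR_ge1Dx _); nra.
Qed.

(** For [x < 1] the sign is not visible on the series; it comes from [x >= 1] by
    inversion. *)
Lemma omega_ge0 (x : R) : 0 < x -> 0 <= omega x.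
Proof.
have h (y : R) : 1 <= y -> 0 <= omega y.
  move=> y1; apply: le_trans (omega_ge y1); apply: mulr_ge0 (expR_ge0 _).
  have p2 := pi_ge2 R.
  have -> : 2 * pi ^+ 2 * y ^+ 2 - 3 * pi * y = pi * y * (2 * (pi * y) - 3) by ring.
  have : pi <= pi * y by rewrite ler_peMr//; lra.
  by move=> ?; rewrite !mulr_ge0//; lra.
move=> x0; have [x1|x1] := leP 1 x; first exact: h.
rewrite -[x]invrK omega_inversion ?invr_gt0// mulr_ge0// h//.
by rewrite -[leLHS]invr1 lef_pV2 ?posrE// ltW.
Qed.

Lemma omega_continuous (x : R) : 0 < x -> {for x, continuous (@omega R)}.
Proof.
move=> x0; have dE1 := dpsum tempered_square1 x0; have dE2 := dpsum tempered_square2 x0.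
have dx := is_derive_id x (1:R).
have d := is_derive_subf (is_derive_mulf (is_derive_mulcf (2 * pi ^+ 2) (is_derive_mulf dx dx)) dE2)
  (is_derive_mulf (is_derive_mulcf (3 * pi) dx) dE1).
apply/differentiable_continuous/derivable1_diffP.
have h : \near x, 2 * pi ^+ 2 * (x * x) * psum square_coef2 (q x)
   - 3 * pi * x * psum square_coef1 (q x) = omega x.
  by near=> y; rewrite omega_psum ?expr2//; near: y; exact: lt_nbhsr.
by have [] := near_eq_is_derive h d.
Unshelve. all: end_near.
Qed.

End Omega.

(** * Two-sided bounds for the integrand *)

Section Integrand.
Variable R : realType.

(** What remains of the integrand at [x = r^2], apart from [omega] and a constant,
    when the Gauss function is replaced by the bound [hyp2F1_le]. *)
Definition saddle_kernel (N : nat) (r : R) : R :=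
  ((r - 1) / (r + 1)) ^+ N / ((1 + r) ^+ 2 * Num.sqrt r).

Lemma powR_3half (x : R) : 0 <= x -> x `^ (3 / 2) = x * Num.sqrt x.
Proof.
move=> x0; have -> : 3 / 2 = 1 + 2^-1 :> R by field.
rewrite le_eqVlt in x0; case/orP: x0 => [/eqP <-|x0].
  by rewrite powR0 ?mul0r//; apply/eqP; lra.
by rewrite powRD ?(lt0r_neq0 x0) ?implybT// powRr1 ?powR12_sqrt// ltW.
Qed.

Section Bounds.
Variables (n : nat) (r : R).
Hypothesis r0 : 0 < r.
Let N := n.*2.
Let x := r ^+ 2.
Let z := (x - 1) / (x + 1).
Let b : R := N%:R + 3 / 2.
Let main := Num.sqrt 2 * 2 ^+ N * (omega x * saddle_kernel N r).

Let x0 : 0 < x. Proof. by rewrite exprn_gt0. Qed.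

Let z2 : 0 <= z ^+ 2 < 1.
Proof.
have hx := x0; rewrite sqr_ge0 /z expr_div_n ltr_pdivrMr ?mul1r; last by rewrite exprn_gt0//; lra.
by rewrite !expr2; nra.
Qed.

Let sqrt_z : Num.sqrt (1 - z ^+ 2) = 2 * r / (x + 1).
Proof.
have hx := x0; have hr := r0.
have -> : 1 - z ^+ 2 = (2 * r / (x + 1)) ^+ 2 by rewrite /z /x; field; rewrite -/x; lra.
by rewrite sqrtr_sqr ger0_norm// divr_ge0; lra.
Qed.

Let z_even : 0 <= z ^+ N.
Proof. by rewrite /N -muln2 mulnC exprM exprn_ge0// sqr_ge0. Qed.

(** In the variable [r = sqrt x] the root [sqrt (1 - z^2) = 2 r / (1 + r^2)] is
   rational. *)
Let kernelE : z ^+ N / (x + 1) `^ (3 / 2) *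
  ((2 / (1 + Num.sqrt (1 - z ^+ 2))) `^ b *
   Num.sqrt ((1 + Num.sqrt (1 - z ^+ 2)) / (2 * Num.sqrt (1 - z ^+ 2)))) =
  Num.sqrt 2 * 2 ^+ N * saddle_kernel N r.
Proof.
have hx := x0; have hr := r0; rewrite sqrt_z.
have -> : 1 + 2 * r / (x + 1) = (1 + r) ^+ 2 / (x + 1) by rewrite /x; field; rewrite -/x; lra.
have -> : (1 + r) ^+ 2 / (x + 1) / (2 * (2 * r / (x + 1))) = (1 + r) ^+ 2 / (2 ^+ 2 * r).
  by field; lra.
have -> : 2 / ((1 + r) ^+ 2 / (x + 1)) = 2 * (x + 1) / (1 + r) ^+ 2 by field; lra.
have y0 : 0 < 2 * (x + 1) / (1 + r) ^+ 2 by rewrite divr_gt0 ?exprn_gt0//; lra.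
rewrite /b powRD ?(lt0r_neq0 y0) ?implybT// powR_mulrn ?(ltW y0)// !powR_3half ?(ltW y0)//; last by lra.
have r1 : 0 <= 1 + r by lra.
have -> : Num.sqrt (2 * (x + 1) / (1 + r) ^+ 2) = Num.sqrt 2 * Num.sqrt (x + 1) / (1 + r).
  rewrite sqrtrM; last by rewrite mulr_ge0//; lra.
  by rewrite sqrtrV ?sqr_ge0// sqrtr_sqr ger0_norm// sqrtrM.
have -> : Num.sqrt ((1 + r) ^+ 2 / (2 ^+ 2 * r)) = (1 + r) / (2 * Num.sqrt r).
  rewrite sqrtrM ?sqr_ge0// sqrtrV; last by rewrite mulr_ge0// ltW.
  by rewrite [Num.sqrt (2 ^+ 2 * r)]sqrtrM ?sqr_ge0// !sqrtr_sqr !ger0_norm.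
rewrite /saddle_kernel.
have s2 : 0 < Num.sqrt 2 :> R by rewrite sqrtr_gt0.
have sx : 0 < Num.sqrt (x + 1) by rewrite sqrtr_gt0; lra.
have sr : 0 < Num.sqrt r by rewrite sqrtr_gt0.
have zE : z * (2 * (x + 1) / (1 + r) ^+ 2) = 2 * ((r - 1) / (r + 1)).
  by rewrite /z /x; field; rewrite -/x; lra.
transitivity ((z * (2 * (x + 1) / (1 + r) ^+ 2)) ^+ N * Num.sqrt 2 / ((1 + r) ^+ 2 * Num.sqrt r)).
  by rewrite [(z * _) ^+ N]exprMn; move: (z ^+ N) ((2 * (x + 1) / (1 + r) ^+ 2) ^+ N) => p q; field; lra.
by rewrite zE [(2 * _) ^+ N]exprMn; move: (2 ^+ N) (((r - 1) / (r + 1)) ^+ N) => p q; field; lra.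
Qed.

Let d_integrandE : d_integrand N x =
  omega x * (z ^+ N / (x + 1) `^ (3 / 2) *
    hyp2F1 (b / 2) (b / 2 + 1 / 2) (b + 1 / 2) (z ^+ 2)).
Proof.
rewrite /d_integrand -/z; have -> : N%:R / 2 + 3 / 4 = b / 2 by rewrite /b; field.
have -> : N%:R / 2 + 5 / 4 = b / 2 + 1 / 2 by rewrite /b; field.
have -> : N%:R + 2 = b + 1 / 2 by rewrite /b; field.
by ring.
Qed.

Let b0 : 0 < b. Proof. by have : 0 <= N%:R :> R by []; rewrite /b; lra. Qed.

Let w0 : 0 <= z ^+ N / (x + 1) `^ (3 / 2).
Proof. by rewrite divr_ge0// powR_ge0. Qed.

Lemma d_integrand_le : d_integrand N x <= main.
Proof.
have hx := x0; rewrite d_integrandE.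
have -> : main = omega x * (Num.sqrt 2 * 2 ^+ N * saddle_kernel N r) by rewrite /main mulrCA.
rewrite -kernelE; apply: ler_wpM2l; first exact: omega_ge0.
by apply: ler_wpM2l => //; exact: hyp2F1_le.
Qed.

Lemma d_integrand_ge :
  main * (1 - (x + 1) / (4 * (N%:R + 7 / 2) * r)) <= d_integrand N x.
Proof.
have hx := x0; have hr := r0; have hb := b0.
rewrite d_integrandE.
have -> : main = omega x * (Num.sqrt 2 * 2 ^+ N * saddle_kernel N r) by rewrite /main mulrCA.
rewrite -kernelE -!(mulrA (omega x)); apply: ler_wpM2l; first exact: omega_ge0.
rewrite -!(mulrA (z ^+ N / _)); apply: ler_wpM2l => //.
apply: le_trans (hyp2F1_ge b0 z2); apply: ler_wpM2l.
  by rewrite mulr_ge0 ?sqrtr_ge0// powR_ge0.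
rewrite lerD2l lerN2 sqrt_z.
have -> : (x + 1) / (4 * (N%:R + 7 / 2) * r) = 1 / (2 * (b + 2) * (2 * r / (x + 1))).
  by rewrite /b; field; rewrite /b in hb; lra.
rewrite ler_wpM2r ?invr_ge0//; first by rewrite mulr_ge0 ?divr_ge0//; lra.
by rewrite gerBl divr_ge0; lra.
Qed.

Lemma d_integrand_ge0 : 0 <= d_integrand N x.
Proof.
have hx := x0; have hb := b0; rewrite d_integrandE mulr_ge0 ?omega_ge0// mulr_ge0//.
rewrite hyp2F1E; apply: psum_ge0 => //; first exact: tempered_tcoef.
by move=> k; apply: ltW; apply: hyp2F1_coef_gt0; lra.
Qed.

End Bounds.
End Integrand.

(** * Elementary estimates *)

Section ElementaryEstimates.
Variable R : realType.

(** The remainder of the odd Taylor expansion of [2 artanh]. *)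
Lemma artanh_taylor (y : R) : 0 <= y < 1 ->
  exists2 c, 0 <= c <= y &
    ln (1 + y) - ln (1 - y) - 2 * y - 2 / 3 * (y * (y * y)) = 2 * c ^+ 4 / (1 - c ^+ 2) * y.
Proof.
move=> /andP[y0 y1].
have h x : 0 <= x <= y -> is_derive x (1 : R)
    (fun x => ln (1 + x) - ln (1 - x) - 2 * x - 2 / 3 * (x * (x * x)))
    ((1 + x)^-1 * (0 + 1) - (1 - x)^-1 * (0 - 1) - 2 * 1 - 2 / 3 * (1 * (x * x) + x * (1 * x + x * 1))).
  move=> /andP[x0 xy].
  have dx := is_derive_id x (1 : R).
  have d1 := is_derive_addf (is_derive_cst (1:R) x 1) dx.
  have d2 := is_derive_subf (is_derive_cst (1:R) x 1) dx.
  have p1 : 0 < 1 + x by lra.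
  have p2 : 0 < 1 - x by lra.
  exact: (is_derive_subf (is_derive_subf (is_derive_subf
     (is_derive_compf (@ln R) (fun z => 1 + z) (is_derive1_ln p1) d1)
     (is_derive_compf (@ln R) (fun z => 1 - z) (is_derive1_ln p2) d2))
     (is_derive_mulcf 2 dx)) (is_derive_mulcf (2 / 3) (is_derive_mulf dx (is_derive_mulf dx dx)))).
have [c [cy e]] := mvt_closed y0 h; exists c => //.
move: e; rewrite addr0 subr0 ln1 !mul0r !mulr0 !subr0 => ->; congr (_ * _).
have [c0 c1] : 0 <= c /\ c < 1 by lra.
have c2 : c ^+ 2 < 1 by rewrite expr2; nra.
by field; lra.
Qed.

Lemma mobius_ratioE (y : R) : 0 <= y < 1 ->
  (1 - y) / (1 + y) = expR (- (ln (1 + y) - ln (1 - y))).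
Proof.
by move=> y01; rewrite opprB expRB !lnK// posrE; lra.
Qed.

Lemma mobius_le (y : R) : 0 <= y <= 1 ->
  (1 - y) / (1 + y) <= expR (- (2 * y + 2 / 3 * y ^+ 3)).
Proof.
move=> /andP[y0]; rewrite le_eqVlt => /orP[/eqP->|y1]; first by rewrite subrr mul0r expR_ge0.
have y01 : 0 <= y < 1 by rewrite y0.
rewrite mobius_ratioE// ler_expR lerN2.
have [c /andP[c0 cy] e] := artanh_taylor y01.
suff : 0 <= 2 * c ^+ 4 / (1 - c ^+ 2) * y.
  by rewrite -e !exprS expr0 !mulr1; lra.
rewrite mulr_ge0// divr_ge0 ?mulr_ge0 ?exprn_ge0// subr_ge0 exprn_ile1//; lra.
Qed.

Lemma mobius_ge (y : R) : 0 <= y <= 1 / 2 ->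
  expR (- (2 * y + 2 / 3 * y ^+ 3 + 8 / 3 * y ^+ 5)) <= (1 - y) / (1 + y).
Proof.
move=> /andP[y0 y1]; have y01 : 0 <= y < 1 by lra.
rewrite mobius_ratioE// ler_expR lerN2.
have [c /andP[c0 cy] e] := artanh_taylor y01.
suff : 2 * c ^+ 4 / (1 - c ^+ 2) * y <= 8 / 3 * y ^+ 5.
  by rewrite -e (exprS _ 2) (exprS _ 1) expr1; lra.
rewrite (exprSr y 4) [leRHS]mulrA; apply: ler_wpM2r => //.
have c2 : c ^+ 2 <= 1 / 4 by rewrite expr2; nra.
rewrite ler_pdivrMr; last by lra.
have c4 : c ^+ 4 <= y ^+ 4 by rewrite lerXn2r ?nnegrE//; lra.
have y4 : 0 <= y ^+ 4 by rewrite exprn_ge0.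
apply: (@le_trans _ _ (2 * y ^+ 4)); first by rewrite ler_pM2l.
by move: (c ^+ 2) c2 (y ^+ 4) y4 => a ? d ?; nra.
Qed.

Lemma expR_diff_le (a b : R) : 0 <= a -> 0 <= b -> `|expR (- a) - expR (- b)| <= `|a - b|.
Proof.
wlog ab : a b / a <= b => [h|].
  have [ab|/ltW ba] := leP a b; first exact: h.
  by move=> a0 b0; rewrite distrC (distrC a); exact: h.
move=> a0 b0; rewrite (distrC a) !ger0_norm ?subr_ge0 ?ler_expR ?lerN2//.
have -> : expR (- b) = expR (- a) * expR (- (b - a)).
  by rewrite -expRD; congr expR; ring.
have e1 := expR_ge1Dx (- (b - a)).
have ea1 : expR (- a) <= 1 by rewrite expR_le1; lra.
have ea0 := expR_ge0 (- a).
rewrite -{1}[expR (- a)]mulr1 -mulrBr.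
by apply: le_trans (_ : 1 * (b - a) <= _); [apply: ler_pM; rewrite ?subr_ge0 ?expR_le1; lra|lra].
Qed.

(** The point of this form is to keep a decaying factor. *)
Lemma expR_diff_le_min (m a b : R) : m <= a -> m <= b ->
  `|expR (- a) - expR (- b)| <= `|a - b| * expR (- m).
Proof.
move=> ma mb; have h := @expR_diff_le (a - m) (b - m).
have -> : expR (- a) - expR (- b) = (expR (- (a - m)) - expR (- (b - m))) * expR (- m).
  by rewrite mulrBl -!expRD; congr (expR _ - expR _); ring.
rewrite normrM (ger0_norm (expR_ge0 _)) ler_wpM2r ?expR_ge0//.
have -> : a - b = (a - m) - (b - m) by ring.
by apply: h; lra.
Qed.

Lemma sqr_le_expR (u : R) : u ^+ 2 <= expR (u ^+ 2).
Proof. by have := expR_ge1Dx (u ^+ 2); lra. Qed.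

Lemma pow4_le_expR (u : R) : u ^+ 4 <= 2 * expR (u ^+ 2).
Proof.
have := expR_ge1Dxn 1 (sqr_ge0 u); rewrite -exprM.
have -> : 2`!%:R = 2 :> R by [].
by have -> : (2 * 2 = 4)%N by []; lra.
Qed.

Lemma cubic_le (u : R) : u <= (1 + u ^+ 2) / 2 /\ u ^+ 3 <= (u ^+ 2 + u ^+ 4) / 2.
Proof.
split; rewrite -subr_ge0.
  have -> : (1 + u ^+ 2) / 2 - u = (u - 1) ^+ 2 / 2 by field.
  by rewrite divr_ge0 ?sqr_ge0.
have -> : (u ^+ 2 + u ^+ 4) / 2 - u ^+ 3 = (u * (u - 1)) ^+ 2 / 2 by field.
by rewrite divr_ge0 ?sqr_ge0.
Qed.

Lemma cubic_le_expR (u : R) : 1 + u + u ^+ 3 <= 4 * expR (u ^+ 2).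
Proof.
have [h1 h3] := cubic_le u; have h2 := sqr_le_expR u; have h4 := pow4_le_expR u.
have h0 : 1 <= expR (u ^+ 2) by have := expR_ge1Dx (u ^+ 2); have := sqr_ge0 u; lra.
lra.
Qed.

Lemma quartic_le_expR (u : R) : (1 + u) ^+ 3 * u <= 11 * expR (u ^+ 2).
Proof.
have [h1 h3] := cubic_le u; have h2 := sqr_le_expR u; have h4 := pow4_le_expR u.
have h0 : 1 <= expR (u ^+ 2) by have := expR_ge1Dx (u ^+ 2); have := sqr_ge0 u; lra.
have -> : (1 + u) ^+ 3 * u = u + 3 * u ^+ 2 + 3 * u ^+ 3 + u ^+ 4 by ring.
lra.
Qed.

(** Propagates errors through a product, one factor at a time. *)
Lemma norm_mulB_le (x y x' y' d e B : R) :
  `|x - x'| <= d -> `|y - y'| <= e -> `|y| <= B -> 0 <= x' <= 1 ->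
  `|x * y - x' * y'| <= d * B + e.
Proof.
move=> hx hy hB /andP[x0 x1].
have -> : x * y - x' * y' = (x - x') * y + x' * (y - y') by ring.
apply: le_trans (ler_normD _ _) _; rewrite !normrM; apply: lerD.
  by apply: ler_pM.
rewrite (ger0_norm x0); apply: le_trans hy; exact: ler_piMl.
Qed.

End ElementaryEstimates.

(** * The integrand against its Gaussian approximation *)

Section SaddlePoint.
Variable R : realType.

Lemma pi_le4 : pi <= 4 :> R.
Proof. by have := pihalf_lt2 R; lra. Qed.

Lemma sqrt_dist1 (x : R) : 0 <= x -> `|Num.sqrt x - 1| <= `|x - 1|.
Proof.
move=> x0; have s0 := sqrtr_ge0 x.
have e : x - 1 = (Num.sqrt x - 1) * (Num.sqrt x + 1) by rewrite -{1}(sqr_sqrtr x0); ring.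
rewrite e normrM ler_peMr// ger0_norm; lra.
Qed.

Lemma omega_ratio : exists2 K : R, 0 <= K & forall r : R, 1 <= r ->
  let a := omega (r ^+ 2) / (2 * pi ^+ 2 * r ^+ 4 * expR (- (pi * r ^+ 2))) in
  0 <= a <= 1 + K /\ `|a - 1| <= (1 + K) / r.
Proof.
have [K K0 HK] := omega_le R; exists K => // r r1 a.
have p2 := pi_ge2 R; have r0 : 0 < r by lra.
have x1 : 1 <= r ^+ 2 by rewrite exprn_ege1.
have x0 : 0 < r ^+ 2 by lra.
have e0 := expR_gt0 (- (pi * r ^+ 2)).
have p0 : 0 < 2 * pi ^+ 2 * r ^+ 4 * expR (- (pi * r ^+ 2)).
  by rewrite !mulr_gt0 ?exprn_gt0//; lra.
have rx : (r ^+ 2)^-1 <= r^-1 by rewrite lef_pV2 ?posrE// expr2 ler_peMl//; lra.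
have ale : a <= 1 + K / r ^+ 2.
  rewrite /a ler_pdivrMr// mulrC; have := HK _ x1.
  by have -> : (r ^+ 2) ^+ 2 = r ^+ 4 by ring.
have age : 1 - 1 / r ^+ 2 <= a.
  rewrite /a ler_pdivlMr//; apply: le_trans (omega_ge x1).
  have -> : (r ^+ 2) ^+ 2 = r ^+ 4 by ring.
  rewrite -[X in X * (2 * _ * _ * _)]/(1 - 1 / r ^+ 2) mulrA; apply: ler_wpM2r; first exact: ltW.
  have -> : (1 - 1 / r ^+ 2) * (2 * pi ^+ 2 * r ^+ 4) = 2 * pi ^+ 2 * r ^+ 4 - 2 * pi * pi * r ^+ 2.
    by field; lra.
  rewrite lerD2l lerN2 ler_pM2r//; nra.
have a0 : 0 <= a by rewrite /a divr_ge0 ?(ltW p0)// omega_ge0.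
have Kx : K / r ^+ 2 <= K / r by exact: ler_wpM2l.
have Kr : K / r <= K by rewrite ler_pdivrMr// ler_peMr.
split; first by rewrite a0/=; lra.
have r10 : 0 < r^-1 by rewrite invr_gt0.
have Kr0 : 0 <= K / r by rewrite divr_ge0// ltW.
by rewrite ler_norml mulrDl; apply/andP; split; lra.
Qed.

Lemma square_ratio (r : R) : 1 <= r ->
  0 <= (r / (1 + r)) ^+ 2 <= 1 /\ `|(r / (1 + r)) ^+ 2 - 1| <= 2 / r.
Proof.
move=> r1; have r0 : 0 < r by lra.
have q0 : 0 <= r / (1 + r) by rewrite divr_ge0; lra.
have q1 : r / (1 + r) <= 1 by rewrite ler_pdivrMr; lra.
split; first by rewrite exprn_ge0// exprn_ile1.
rewrite ler0_norm ?subr_le0 ?exprn_ile1// opprB.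
have -> : 1 - (r / (1 + r)) ^+ 2 = (1 - r / (1 + r)) * (1 + r / (1 + r)) by ring.
apply: (@le_trans _ _ (r^-1 * 2)); last by rewrite mulrC.
apply: ler_pM; try lra.
have -> : 1 - r / (1 + r) = (1 + r)^-1 by field; lra.
by rewrite lef_pV2 ?posrE; lra.
Qed.

Section Fixed.
Variables (n : nat) (al : R).
Hypothesis al4 : 4 <= al.
Hypothesis nal : 2 * n%:R = pi * al ^+ 3.
Let N := n.*2.

Variable K : R.
Hypothesis K0 : 0 <= K.
Hypothesis omegaK : forall r : R, 1 <= r ->
  let a := omega (r ^+ 2) / (2 * pi ^+ 2 * r ^+ 4 * expR (- (pi * r ^+ 2))) in
  0 <= a <= 1 + K /\ `|a - 1| <= (1 + K) / r.

(** The size of the integrand at its maximum [r = al], up to constants and powers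
    of 2 that do not depend on [r]. *)
Definition saddle_scale (al : R) : R :=
  4 * pi ^+ 2 * (al ^+ 2 * Num.sqrt al) * expR (- (3 * pi * al ^+ 2)).

(** The factors of the integrand after division by its size at [al]: near [r = al],
   [rho], [a1] and [a2] are close to 1, [a3] is close to [exp (- 2 pi / 3)], and [g]
   is close to a Gaussian. *)
Let rho r : R := (r / al) ^+ 2 * Num.sqrt (r / al).
Let a1 r : R := omega (r ^+ 2) / (2 * pi ^+ 2 * r ^+ 4 * expR (- (pi * r ^+ 2))).
Let a2 r : R := (r / (1 + r)) ^+ 2.
Let a3 r : R := ((r - 1) / (r + 1)) ^+ N * expR (4 * n%:R / r).
Let g r : R := expR (- (pi * (r - al) ^+ 2 * (1 + 2 * al / r))).

(** Completing the square: [pi r^2 + 4n/r = 3 pi al^2 + pi (r-al)^2 (1 + 2 al/r)]. *)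
Let mainE r : 0 < r ->
  2 * r * (omega (r ^+ 2) * saddle_kernel N r) / saddle_scale al =
  a3 r * (a2 r * (a1 r * rho r)) * g r.
Proof.
move=> r0; have ha := al4; have p2 := pi_ge2 R.
have sr : 0 < Num.sqrt r by rewrite sqrtr_gt0.
have sa : 0 < Num.sqrt al by rewrite sqrtr_gt0; lra.
rewrite /rho /a1 /a2 /a3 /g /saddle_kernel /saddle_scale sqrtrM ?(ltW r0)// sqrtrV; last by lra.
have -> : expR (- (pi * (r - al) ^+ 2 * (1 + 2 * al / r))) =
   expR (- (pi * r ^+ 2)) / expR (4 * n%:R / r) / expR (- (3 * pi * al ^+ 2)).
  rewrite -!expRN -!expRD; congr expR.
  have -> : 4 * n%:R / r = 2 * (pi * al ^+ 3) / r by rewrite -nal; field; lra.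
  by field; lra.
have := expR_gt0 (- (pi * r ^+ 2)); have := expR_gt0 (4 * n%:R / r).
have := expR_gt0 (- (3 * pi * al ^+ 2)).
move: (expR _) (expR _) (expR _) (_ ^+ N) (omega _) => A B C D W *.
have e : Num.sqrt r / r = (Num.sqrt r)^-1.
  by rewrite -[X in _ / X](sqr_sqrtr (ltW r0)); field; lra.
have -> : r ^+ 4 = r ^+ 3 * (Num.sqrt r * Num.sqrt r) by rewrite -expr2 sqr_sqrtr ?(ltW r0)//; ring.
by field; lra.
Qed.

Let Phi r := 2 * r * d_integrand N (r ^+ 2) / (Num.sqrt 2 * 2 ^+ N) / saddle_scale al.
Let Pr r := a3 r * (a2 r * (a1 r * rho r)).

Let scale_gt0 : 0 < saddle_scale al.
Proof.
have ha := al4; have p2 := pi_ge2 R.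
have p0 : 0 < pi :> R by lra.
have a0 : 0 < al by lra.
by rewrite /saddle_scale !mulr_gt0 ?exprn_gt0 ?sqrtr_gt0 ?expR_gt0.
Qed.

Let c0 : 0 < Num.sqrt 2 * 2 ^+ N :> R.
Proof. by rewrite mulr_gt0 ?exprn_gt0// sqrtr_gt0. Qed.

Let Phi_ge0 r : 0 < r -> 0 <= Phi r.
Proof.
move=> r0; rewrite /Phi divr_ge0 ?(ltW scale_gt0)// divr_ge0 ?(ltW c0)//.
by rewrite mulr_ge0 ?d_integrand_ge0// mulr_ge0 ?(ltW r0).
Qed.

Let Phi_le r : 0 < r -> Phi r <= Pr r * g r.
Proof.
move=> r0; rewrite /Pr -mainE// /Phi ler_pM2r ?invr_gt0// ler_pdivrMr//.
apply: le_trans (_ : 2 * r * (Num.sqrt 2 * 2 ^+ N * (omega (r ^+ 2) * saddle_kernel N r)) <= _).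
  by apply: ler_wpM2l (d_integrand_le n r0); rewrite mulr_ge0// ltW.
by rewrite le_eqVlt; apply/orP; left; apply/eqP; ring.
Qed.

Let Phi_ge r : 0 < r -> Pr r * g r * (1 - (r ^+ 2 + 1) / (4 * (N%:R + 7 / 2) * r)) <= Phi r.
Proof.
move=> r0; rewrite /Pr -mainE// /Phi ler_pdivlMr// ler_pdivlMr//.
apply: le_trans (ler_wpM2l (_ : 0 <= 2 * r) (d_integrand_ge n r0)); last first.
  by rewrite mulr_ge0// ltW.
rewrite -/N le_eqVlt; apply/orP; left; apply/eqP; set e := 1 - _.
have := scale_gt0; move: (saddle_scale al) => s s0.
by field; lra.
Qed.

Let a3E r : 0 < r -> a3 r = ((1 - r^-1) / (1 + r^-1)) ^+ N * expR (2 * r^-1) ^+ N.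
Proof.
move=> r0; rewrite /a3 -expRM_natl; congr (_ ^+ _ * expR _).
  by field; lra.
by rewrite /N -muln2 natrM; ring.
Qed.

(** As [((1 - y) / (1 + y))^N] is about [exp (- N (2 y + (2/3) y^3))] at [y = 1/r],
   the linear term cancels against [exp (4 n / r)] and the cubic one is
   [(4/3) n / r^3 = (2 pi / 3) (al / r)^3]. *)
Let a3_le r : 1 <= r -> 0 <= a3 r <= expR (- (2 * pi / 3 * (al / r) ^+ 3)).
Proof.
move=> r1; have r0 : 0 < r by lra.
have ri : 0 <= r^-1 <= 1 by rewrite invr_ge0 (ltW r0) invf_le1.
have q0 : 0 <= (1 - r^-1) / (1 + r^-1) by apply: divr_ge0; lra.
rewrite a3E// mulr_ge0 ?exprn_ge0 ?expR_ge0//=.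
apply: (@le_trans _ _ (expR (- (2 * r^-1 + 2 / 3 * r^-1 ^+ 3)) ^+ N * expR (2 * r^-1) ^+ N)).
  apply: ler_wpM2r; first by rewrite exprn_ge0// expR_ge0.
  by rewrite lerXn2r ?nnegrE ?expR_ge0//; exact: mobius_le.
rewrite -exprMn -expRD -expRM_natl ler_expR le_eqVlt; apply/orP; left; apply/eqP.
rewrite /N -muln2 natrM [n%:R * 2]mulrC nal; field; lra.
Qed.

Let a3_ge r : 2 <= r ->
  expR (- (2 * pi / 3 * (al / r) ^+ 3 + 8 * pi / 3 * ((al / r) ^+ 3 / r ^+ 2))) <= a3 r.
Proof.
move=> r2; have r0 : 0 < r by lra.
have ri : 0 <= r^-1 <= 1 / 2.
  by rewrite invr_ge0 (ltW r0)/= div1r lef_pV2 ?posrE.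
rewrite a3E//.
apply: (@le_trans _ _ (expR (- (2 * r^-1 + 2 / 3 * r^-1 ^+ 3 + 8 / 3 * r^-1 ^+ 5)) ^+ N * expR (2 * r^-1) ^+ N)).
  rewrite -exprMn -expRD -expRM_natl ler_expR le_eqVlt; apply/orP; left; apply/eqP.
  by rewrite /N -muln2 natrM [n%:R * 2]mulrC nal; field; lra.
apply: ler_wpM2r; first by rewrite exprn_ge0// expR_ge0.
rewrite lerXn2r ?nnegrE ?expR_ge0//; first by apply: divr_ge0; lra.
exact: mobius_ge.
Qed.

Let g_le r : 0 < r -> 0 <= g r <= expR (- (pi * (r - al) ^+ 2)).
Proof.
move=> r0; have p2 := pi_ge2 R; rewrite expR_ge0/= ler_expR lerN2 ler_peMr//.
  by rewrite mulr_ge0 ?sqr_ge0//; lra.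
by have ha := al4; rewrite lerDl divr_ge0//; lra.
Qed.

Section Near.
Variable r : R.
Hypothesis near_r : `|r - al| <= al / 2.
Let u := `|r - al|.

Let r_itv : al / 2 <= r <= 3 / 2 * al.
Proof. by have := near_r; rewrite ler_norml; lra. Qed.

Let u2 : (r - al) ^+ 2 = u ^+ 2. Proof. by rewrite /u real_normK// num_real. Qed.

Let rho_near : 0 <= rho r <= 4 /\ `|rho r - 1| <= 5 * (u / al).
Proof.
have ha := al4; have /andP[r1 r2] := r_itv; rewrite /rho; set x := r / al.
have x0 : 0 <= x by rewrite divr_ge0; lra.
have x32 : x <= 3 / 2 by rewrite ler_pdivrMr; lra.
have xu : `|x - 1| = u / al.
  have -> : x - 1 = (r - al) / al by rewrite /x; field; lra.
  have al0 : 0 <= al by lra.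
  by rewrite normrM normfV (ger0_norm al0).
have s1 := sqrt_dist1 x0; rewrite xu in s1.
have u12 : u / al <= 1 / 2 by rewrite ler_pdivrMr; [have := near_r; rewrite -/u; lra|lra].
have s32 : Num.sqrt x <= 3 / 2 by move: s1; rewrite ler_norml; lra.
have s0 := sqrtr_ge0 x.
split.
  rewrite mulr_ge0 ?sqr_ge0//=.
  apply: (@le_trans _ _ ((3 / 2) ^+ 2 * (3 / 2))); last by rewrite expr2; lra.
  by apply: ler_pM; rewrite ?sqr_ge0// lerXn2r ?nnegrE//; lra.
have -> : x ^+ 2 * Num.sqrt x - 1 = (x - 1) * ((x + 1) * Num.sqrt x) + (Num.sqrt x - 1) by ring.
apply: le_trans (ler_normD _ _) _; rewrite normrM xu.
have h : `|(x + 1) * Num.sqrt x| <= 5 / 2 * (3 / 2).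
  have x1 : 0 <= x + 1 by lra.
  rewrite (ger0_norm (mulr_ge0 x1 s0)).
  by apply: ler_pM => //; lra.
have ua : 0 <= u / al by apply: divr_ge0; [exact: normr_ge0|lra].
by have := ler_wpM2l ua h; lra.
Qed.

Let a3_near : `|a3 r - expR (- (2 * pi / 3))| <= 150 * ((1 + u) / al).
Proof.
have ha := al4; have /andP[r1 r2] := r_itv; have p2 := pi_ge2 R; have p4 := pi_le4.
have r0 : 0 < r by lra.
have rr2 : 2 <= r by lra.
have u0 : 0 <= u by exact: normr_ge0.
set T := al / r.
have T0 : 0 <= T by rewrite divr_ge0; lra.
have T2 : T <= 2 by rewrite ler_pdivrMr; lra.
have uT : `|T - 1| <= 2 * (u / al).
  have -> : T - 1 = - ((r - al) / r) by rewrite /T; field; lra.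
  rewrite normrN normrM -/u normfV [X in _ / X]ger0_norm ?(ltW r0)// mulrCA.
  apply: ler_wpM2l => //; rewrite ler_pdivlMr; last by lra.
  by rewrite mulrC.
(* [a3 r] lies between [exp (- P - Q)] and [exp (- P)], and [P] tends to [P0] as [T] tends to 1. *)
pose P := 2 * pi / 3 * T ^+ 3; pose P0 : R := 2 * pi / 3; pose Q := 8 * pi / 3 * (T ^+ 3 / r ^+ 2).
have T3 : T ^+ 3 <= 8.
  apply: (@le_trans _ _ (2 ^+ 3)); first by rewrite lerXn2r ?nnegrE.
  by rewrite !exprS expr0; lra.
have T30 : 0 <= T ^+ 3 by rewrite exprn_ge0.
have P_ge0 : 0 <= P by rewrite mulr_ge0//; lra.
have P0_ge0 : 0 <= P0 by rewrite /P0; lra.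
have Q_ge0 : 0 <= Q by rewrite mulr_ge0 ?divr_ge0 ?sqr_ge0//; lra.
have PP0 : `|P - P0| <= 38 * (u / al).
  have -> : P - P0 = (T - 1) * (2 * pi / 3 * (T ^+ 2 + T + 1)) by rewrite /P /P0; field.
  rewrite normrM; apply: (@le_trans _ _ (2 * (u / al) * 19)); last by lra.
  apply: ler_pM => //; rewrite ger0_norm; last by rewrite mulr_ge0 ?addr_ge0 ?sqr_ge0//; lra.
  have T22 : T ^+ 2 <= 4 by rewrite expr2; nra.
  apply: (@le_trans _ _ (8 / 3 * 7)); last by lra.
  by apply: ler_pM; rewrite ?addr_ge0 ?sqr_ge0//; lra.
have QQ : Q <= 86 * al^-1.
  apply: (@le_trans _ _ (32 / 3 * (8 * al^-1))); last first.
    by rewrite mulrA; apply: ler_wpM2r; [rewrite invr_ge0; lra|lra].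
  apply: ler_pM; rewrite ?divr_ge0 ?sqr_ge0//; try lra.
  apply: ler_pM; rewrite ?invr_ge0 ?sqr_ge0//.
  rewrite lef_pV2 ?posrE ?exprn_gt0//; last by lra.
  by rewrite expr2; nra.
have rr1 : 1 <= r by lra.
have /andP[_ hi] := a3_le rr1; have lo := a3_ge rr2.
rewrite -/T -/P -/Q in hi lo.
have d1 := expR_diff_le P_ge0 P0_ge0.
have d2 := expR_diff_le (addr_ge0 P_ge0 Q_ge0) P0_ge0.
have d3 : `|P + Q - P0| <= `|P - P0| + Q.
  have -> : P + Q - P0 = (P - P0) + Q by ring.
  by apply: le_trans (ler_normD _ _) _; rewrite (ger0_norm Q_ge0).
have e1 : (1 + u) / al = al^-1 + u / al by rewrite mulrDl mul1r.
have ai : 0 <= al^-1 by rewrite invr_ge0; lra.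
have ua : 0 <= u / al by apply: divr_ge0; [exact: normr_ge0|lra].
rewrite -/P0 e1; move: d1 d2; rewrite !ler_norml => /andP[d11 d12] /andP[d21 d22].
by apply/andP; split; lra.
Qed.

Let g_near : 0 <= g r <= expR (- (2 * pi * u ^+ 2)) /\
  `|g r - expR (- (3 * pi * u ^+ 2))| <= 4 * pi * (u ^+ 3 / al) * expR (- (2 * pi * u ^+ 2)).
Proof.
have ha := al4; have /andP[r1 r2] := r_itv; have p2 := pi_ge2 R.
have r0 : 0 < r by lra.
have u0 : 0 <= u by exact: normr_ge0.
have T2 : 1 / 2 <= al / r by rewrite ler_pdivlMr; lra.
have pu : 0 <= pi * u ^+ 2 by rewrite mulr_ge0 ?sqr_ge0//; lra.
have m1 : 2 * pi * u ^+ 2 <= pi * u ^+ 2 * (1 + 2 * al / r).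
  have -> : 2 * pi * u ^+ 2 = pi * u ^+ 2 * 2 by ring.
  by apply: ler_wpM2l => //; lra.
rewrite /g u2; split; first by rewrite expR_ge0 ler_expR lerN2.
apply: le_trans (expR_diff_le_min m1 _) _; first by lra.
apply: ler_wpM2r; first exact: expR_ge0.
have -> : pi * u ^+ 2 * (1 + 2 * al / r) - 3 * pi * u ^+ 2 = pi * u ^+ 2 * (- (2 * ((r - al) / r))).
  by field; lra.
rewrite normrM (ger0_norm pu) normrN normrM (@ger0_norm _ 2)// normrM normfV -/u.
rewrite [`|r|]ger0_norm ?(ltW r0)//.
have -> : 4 * pi * (u ^+ 3 / al) = pi * u ^+ 2 * (2 * (u * (2 / al))) by field; lra.
apply: ler_wpM2l => //; apply: ler_wpM2l => //; apply: ler_wpM2l => //.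
rewrite ler_pdivlMr; last by lra.
by rewrite mulrC ler_pdivrMr; lra.
Qed.

(** The four errors enter one after the other, the remaining factors being bounded
   by [4 (1 + K)]; 700 exceeds the sum of the resulting constants. *)
Let PP0 : `|Pr r - expR (- (2 * pi / 3))| <= 700 * (1 + K) * ((1 + u) / al)
   /\ 0 <= Pr r <= 4 * (1 + K).
Proof.
have ha := al4; have /andP[r1 r2] := r_itv; have hK := K0.
have rr1 : 1 <= r by lra.
have u0 : 0 <= u by exact: normr_ge0.
have w0 : 0 <= (1 + u) / al by apply: divr_ge0; lra.
have ai : al^-1 <= (1 + u) / al by rewrite ler_peMl ?invr_ge0; lra.
have uw : u / al <= (1 + u) / al by apply: ler_wpM2r; rewrite ?invr_ge0; lra.
have rw : r^-1 <= 2 * ((1 + u) / al).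
  apply: (@le_trans _ _ (2 * al^-1)); last by apply: ler_wpM2l.
  rewrite ler_pdivlMr; last by lra.
  by rewrite mulrC ler_pdivrMr; lra.
have [/andP[q0 q1] q2] := omegaK rr1; rewrite -/(a1 r) in q0 q1 q2.
have [/andP[s0 s1] s2] := square_ratio rr1; rewrite -/(a2 r) in s0 s1 s2.
have [/andP[t0 t1] t2] := rho_near.
have /andP[v0 v1] := a3_le rr1; have v2 := a3_near.
have v3 : a3 r <= 1.
  apply: le_trans v1 _; rewrite expR_le1 oppr_le0 mulr_ge0 ?exprn_ge0//.
    by have := pi_ge2 R; lra.
  by apply: divr_ge0; lra.
have b1 : 0 <= a1 r * rho r <= 4 * (1 + K).
  by rewrite mulr_ge0//= mulrC; apply: ler_pM.
have b2 : 0 <= a2 r * (a1 r * rho r) <= 4 * (1 + K).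
  by case/andP: b1 => *; rewrite mulr_ge0//=; apply: le_trans (ler_piMl _ _) _.
split; last first.
  by case/andP: b2 => *; rewrite /Pr mulr_ge0//=; apply: le_trans (ler_piMl _ _) _.
have z1 : 0 <= (1 : R) <= 1 by rewrite ler01 lexx.
have n1 : `|rho r| <= 4 by rewrite ger0_norm.
have n2 : `|a1 r * rho r| <= 4 * (1 + K) by case/andP: b1 => *; rewrite ger0_norm.
have n3 : `|a2 r * (a1 r * rho r)| <= 4 * (1 + K) by case/andP: b2 => *; rewrite ger0_norm.
have m1 := norm_mulB_le q2 t2 n1 z1; rewrite mulr1 in m1.
have m2 := norm_mulB_le s2 m1 n2 z1; rewrite mulr1 in m2.
have e01 : 0 <= expR (- (2 * pi / 3) : R) <= 1.
  by rewrite expR_ge0 expR_le1 oppr_le0; have := pi_ge2 R; lra.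
have m3 := norm_mulB_le v2 m2 n3 e01; rewrite mulr1 in m3.
apply: le_trans m3 _.
have k1 : (1 + K) / r <= (1 + K) * (2 * ((1 + u) / al)) by apply: ler_wpM2l => //; lra.
have k2 : 2 / r * (4 * (1 + K)) <= (2 * (2 * ((1 + u) / al))) * (4 * (1 + K)).
  by apply: ler_wpM2r; [lra|apply: ler_wpM2l].
have k3 : 0 <= K * ((1 + u) / al) by exact: mulr_ge0.
apply: (@le_trans _ _ (150 * ((1 + u) / al) * (4 * (1 + K)) + (2 * (2 * ((1 + u) / al)) * (4 * (1 + K))
   + ((1 + K) * (2 * ((1 + u) / al)) * 4 + 5 * ((1 + u) / al))))).
  by lra.
by lra.
Qed.

(** The relative error in [d_integrand_ge] is of order [r / N], that is [al^(-2)]. *)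
Let err_near : 0 <= (r ^+ 2 + 1) / (4 * (N%:R + 7 / 2) * r) <= al^-1.
Proof.
have ha := al4; have /andP[r1 r2] := r_itv; have p2 := pi_ge2 R.
have r0 : 0 < r by lra.
have al0 : 0 < al by lra.
have c30 : 0 < al ^+ 3 by rewrite exprn_gt0.
have c3 : 2 * al ^+ 3 <= N%:R.
  have -> : N%:R = pi * al ^+ 3 by rewrite /N -muln2 natrM mulrC.
  by apply: ler_wpM2r => //; exact: ltW.
have D0 : 0 < 4 * (N%:R + 7 / 2) * r by rewrite !mulr_gt0//; lra.
apply/andP; split; first by apply: divr_ge0 (ltW D0); have := sqr_ge0 r; lra.
rewrite ler_pdivrMr// mulrC ler_pdivlMr//.
apply: (@le_trans _ _ (8 * al ^+ 3 * r)); last by apply: ler_wpM2r; lra.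
apply: (@le_trans _ _ (2 * r ^+ 2 * al)).
  by apply: ler_wpM2r; [lra|rewrite expr2; nra].
have -> : 2 * r ^+ 2 * al = 2 * r * al * r by ring.
apply: ler_wpM2r; first by lra.
apply: (@le_trans _ _ (3 * al * al)); first by apply: ler_wpM2r; lra.
have -> : 8 * al ^+ 3 = 8 * al * al * al by ring.
apply: ler_wpM2r; first by lra.
by nra.
Qed.

(** Every error is at most a polynomial in [u = |r - al|] over [al]; the polynomial
    is absorbed by giving up part of the Gaussian decay. *)
Lemma Phi_near : `|Phi r - expR (- (2 * pi / 3)) * expR (- (3 * pi * (r - al) ^+ 2))|
  <= 3200 * (1 + K) / al * expR (- ((r - al) ^+ 2)).
Proof.
have ha := al4; have /andP[r1 r2] := r_itv; have hK := K0; have p2 := pi_ge2 R; have p4 := pi_le4.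
have rr1 : 1 <= r by lra.
have r0 : 0 < r by lra.
have u0 : 0 <= u by exact: normr_ge0.
have [P1 /andP[P2 P3]] := PP0; have [/andP[g0 g1] g2] := g_near.
have G0 := expR_ge0 (- (2 * pi * u ^+ 2)).
have e01 : 0 <= expR (- (2 * pi / 3) : R) <= 1.
  by rewrite expR_ge0 expR_le1 oppr_le0; lra.
have n1 : `|g r| <= expR (- (2 * pi * u ^+ 2)) by rewrite ger0_norm.
have m1 := norm_mulB_le P1 g2 n1 e01.
have m2 : `|Phi r - Pr r * g r| <= al^-1 * (4 * (1 + K) * expR (- (2 * pi * u ^+ 2))).
  have h1 := Phi_le r0; have h2 := Phi_ge r0.
  rewrite ler0_norm ?subr_le0// opprB.
  apply: (@le_trans _ _ ((r ^+ 2 + 1) / (4 * (N%:R + 7 / 2) * r) * (Pr r * g r))).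
    by move: h2; rewrite mulrBr mulr1; lra.
  by have /andP[k1 k2] := err_near; apply: ler_pM => //; [exact: mulr_ge0|exact: ler_pM].
have e1 : 3 * pi * (r - al) ^+ 2 = 3 * pi * u ^+ 2 by rewrite u2.
rewrite e1 u2.
have -> : Phi r - expR (- (2 * pi / 3)) * expR (- (3 * pi * u ^+ 2)) =
  (Phi r - Pr r * g r) + (Pr r * g r - expR (- (2 * pi / 3)) * expR (- (3 * pi * u ^+ 2))) by ring.
apply: le_trans (ler_normD _ _) _.
have h3 : expR (- (2 * pi * u ^+ 2)) * (1 + u + u ^+ 3) <= 4 * expR (- u ^+ 2).
  have -> : expR (- u ^+ 2) = expR (u ^+ 2) * expR (- (2 * u ^+ 2)) by rewrite -expRD; congr expR; ring.
  rewrite mulrA mulrC; apply: ler_pM; rewrite ?expR_ge0 ?addr_ge0 ?exprn_ge0//.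
    exact: cubic_le_expR.
  by rewrite ler_expR lerN2; apply: ler_wpM2r; [exact: sqr_ge0|lra].
apply: le_trans (lerD m2 m1) _.
have u30 : 0 <= u ^+ 3 by rewrite exprn_ge0.
have -> : 3200 * (1 + K) / al * expR (- u ^+ 2) =
   800 * (1 + K) / al * (4 * expR (- u ^+ 2)) by ring.
(* 800 exceeds [4 + 700] and [4 pi], and [cubic_le_expR] accounts for the factor 4 in [3200 = 4 * 800]. *)
apply: (@le_trans _ _ (800 * (1 + K) / al * (expR (- (2 * pi * u ^+ 2)) * (1 + u + u ^+ 3)))); last first.
  by apply: ler_wpM2l; [apply: divr_ge0; lra|exact: h3].
have -> : al^-1 * (4 * (1 + K) * expR (- (2 * pi * u ^+ 2))) +
 (700 * (1 + K) * ((1 + u) / al) * expR (- (2 * pi * u ^+ 2)) +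
  4 * pi * (u ^+ 3 / al) * expR (- (2 * pi * u ^+ 2))) =
  (4 * (1 + K) + 700 * (1 + K) * (1 + u) + 4 * pi * u ^+ 3) *
    (al^-1 * expR (- (2 * pi * u ^+ 2))) by ring.
have -> : 800 * (1 + K) / al * (expR (- (2 * pi * u ^+ 2)) * (1 + u + u ^+ 3)) =
 (800 * (1 + K) * (1 + u + u ^+ 3)) * (al^-1 * expR (- (2 * pi * u ^+ 2))) by ring.
apply: ler_wpM2r; first by apply: mulr_ge0 G0; rewrite invr_ge0; lra.
have k1 : 0 <= K * u by exact: mulr_ge0.
have k3 : 0 <= K * u ^+ 3 by exact: mulr_ge0.
have k5 : pi * u ^+ 3 <= 4 * u ^+ 3 by exact: ler_wpM2r.
by move: (u ^+ 3) u30 k3 k5 => t u30 k3 k5; lra.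
Qed.

End Near.
(** Far from [al] the inequality [al < 2 u] supplies the factor [1 / al]. *)
Let gauss_far r : al / 2 < `|r - al| ->
  0 <= expR (- (2 * pi / 3)) * expR (- (3 * pi * (r - al) ^+ 2)) <=
  22 / al * expR (- ((r - al) ^+ 2)).
Proof.
move=> far; have ha := al4; have p2 := pi_ge2 R.
rewrite mulr_ge0 ?expR_ge0//= -(real_normK (num_real (r - al))).
move: (`|r - al|) far (normr_ge0 (r - al)) => u far u0.
have q4 := quartic_le_expR u.
have u3 : u <= (1 + u) ^+ 3 * u by rewrite ler_peMl// exprn_ege1//; lra.
have e1 : expR (- (2 * pi / 3)) <= 1 :> R by rewrite expR_le1; lra.
apply: (@le_trans _ _ (expR (- (3 * pi * u ^+ 2)))); first by rewrite ler_piMl// expR_ge0.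
apply: (@le_trans _ _ (expR (- (2 * u ^+ 2)))).
  by rewrite ler_expR lerN2; apply: ler_wpM2r; [exact: sqr_ge0|lra].
have -> : expR (- u ^+ 2) = expR (u ^+ 2) * expR (- (2 * u ^+ 2)) by rewrite -expRD; congr expR; ring.
rewrite [leRHS]mulrA; apply: ler_peMl; first exact: expR_ge0.
rewrite mulrAC ler_pdivlMr; lra.
Qed.

Let Phi_far r : 1 <= r -> al / 2 < `|r - al| ->
  Phi r <= 22 * (1 + K) / al * expR (- ((r - al) ^+ 2)).
Proof.
move=> r1 far; have ha := al4; have p2 := pi_ge2 R; have hK := K0.
have r0 : 0 < r by lra.
have g1 : 0 <= g r <= expR (- (pi * (r - al) ^+ 2)) := g_le r0.
rewrite -(real_normK (num_real (r - al))) in g1 *.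
have ru : r / al <= 1 + `|r - al|.
  rewrite ler_pdivrMr; last by lra.
  by have := ler_norm (r - al); have := normr_ge0 (r - al); nra.
move: (`|r - al|) far (normr_ge0 (r - al)) ru g1 => u far u0 ru /andP[g0 g1].
have x0 : 0 <= r / al by apply: divr_ge0; lra.
have rho1 : 0 <= rho r <= (1 + u) ^+ 3.
  rewrite /rho mulr_ge0 ?sqr_ge0 ?sqrtr_ge0//= (exprSr (1 + u) 2); apply: ler_pM; rewrite ?sqr_ge0 ?sqrtr_ge0//.
    by rewrite lerXn2r ?nnegrE//; lra.
  rewrite -(@ler_pXn2r _ 2) ?nnegrE ?sqrtr_ge0//; last by lra.
  by rewrite sqr_sqrtr//; apply: le_trans ru _; rewrite expr2 ler_peMr//; lra.
have [/andP[q0 q1] _] := omegaK r1; rewrite -/(a1 r) in q0 q1.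
have [/andP[s0 s1] _] := square_ratio r1; rewrite -/(a2 r) in s0 s1.
have /andP[v0 v1] := a3_le r1.
have v3 : a3 r <= 1.
  apply: le_trans v1 _; rewrite expR_le1 oppr_le0 mulr_ge0 ?exprn_ge0//; last by apply: divr_ge0; lra.
  by lra.
have {rho1} /andP[t0 t1] := rho1.
have Pr1 : Pr r <= (1 + K) * (1 + u) ^+ 3.
  have b0 : 0 <= a1 r * rho r by exact: mulr_ge0.
  rewrite /Pr; apply: le_trans (ler_piMl _ v3) _; first exact: mulr_ge0.
  by apply: le_trans (ler_piMl b0 s1) _; exact: ler_pM.
have Pr0 : 0 <= Pr r by apply: mulr_ge0 => //; apply: mulr_ge0 => //; exact: mulr_ge0.
apply: le_trans (Phi_le r0) _.
apply: (@le_trans _ _ ((1 + K) * (1 + u) ^+ 3 * expR (- (pi * u ^+ 2)))); first exact: ler_pM.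
have q4 := quartic_le_expR u.
have ee : expR (- (pi * u ^+ 2)) <= expR (- (2 * u ^+ 2)).
  by rewrite ler_expR lerN2; apply: ler_wpM2r; [exact: sqr_ge0|lra].
have -> : expR (- u ^+ 2) = expR (u ^+ 2) * expR (- (2 * u ^+ 2)) by rewrite -expRD; congr expR; ring.
rewrite [leRHS]mulrA; apply: ler_pM; rewrite ?expR_ge0//.
  by apply: mulr_ge0; [lra|rewrite exprn_ge0//; lra].
have -> : 22 * (1 + K) / al * expR (u ^+ 2) = (1 + K) * (22 * expR (u ^+ 2) / al) by ring.
apply: ler_wpM2l; first by lra.
rewrite ler_pdivlMr; last by lra.
have w0 : 0 <= (1 + u) ^+ 3 by rewrite exprn_ge0//; lra.
have : (1 + u) ^+ 3 * al <= (1 + u) ^+ 3 * (2 * u) by apply: ler_wpM2l => //; lra.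
by lra.
Qed.

(** The error is dominated by a Gaussian of smaller decay, uniformly in [r], so that
    it can be integrated over the whole line. *)
Lemma saddle_pointwise r :
  `|(if 1 <= r then Phi r else 0) - expR (- (2 * pi / 3)) * expR (- (3 * pi * (r - al) ^+ 2))|
  <= 3200 * (1 + K) / al * expR (- ((r - al) ^+ 2)).
Proof.
have ha := al4; have hK := K0.
have e0 := expR_ge0 (- ((r - al) ^+ 2)).
have k1 : 22 * (1 + K) / al * expR (- ((r - al) ^+ 2)) <= 3200 * (1 + K) / al * expR (- ((r - al) ^+ 2)).
  by apply: ler_wpM2r => //; apply: ler_wpM2r; [rewrite invr_ge0|]; lra.
have k2 : 22 / al * expR (- ((r - al) ^+ 2)) <= 22 * (1 + K) / al * expR (- ((r - al) ^+ 2)).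
  by apply: ler_wpM2r => //; apply: ler_wpM2r; [rewrite invr_ge0|]; lra.
have [nr|far] := leP `|r - al| (al / 2).
  have r1 : 1 <= r by move: nr; rewrite ler_norml; lra.
  by rewrite r1; exact: (Phi_near nr).
have /andP[f0 f1] := gauss_far far.
case: ifPn => [r1|_]; last by rewrite sub0r normrN ger0_norm//; lra.
have F1 := Phi_far r1 far; have F0 : 0 <= Phi r by apply: Phi_ge0; lra.
by rewrite ler_norml; apply/andP; split; lra.
Qed.

End Fixed.
End SaddlePoint.

(** * Integrals invariant under inversion *)

Section Substitution.
Variable R : realType.
Notation mu := (@lebesgue_measure R).
Implicit Types (G : R -> R).

Lemma eq_integral_exhaustion (A B : (set R)^nat) (f g : R -> R) :
  nondecreasing_seq A -> nondecreasing_seq B ->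
  (forall k, measurable (A k)) -> (forall k, measurable (B k)) ->
  (forall k, measurable_fun (A k) f) -> (forall k, measurable_fun (B k) g) ->
  (forall k x, A k x -> 0 <= f x) -> (forall k x, B k x -> 0 <= g x) ->
  (forall k, (\int[mu]_(x in A k) (f x)%:E = \int[mu]_(x in B k) (g x)%:E)%E) ->
  (\int[mu]_(x in \bigcup_k A k) (f x)%:E = \int[mu]_(x in \bigcup_k B k) (g x)%:E)%E.
Proof.
move=> ndA ndB mA mB mf mg f0 g0 e.
have ca := @ge0_nondecreasing_set_cvg_integral _ (measurableTypeR R) R A (EFin \o f) mu ndA mA
  (fun k => (measurable_EFinP _ _).2 (mf k)) (fun k x Ax => f0 k x Ax).
have cb := @ge0_nondecreasing_set_cvg_integral _ (measurableTypeR R) R B (EFin \o g) mu ndB mB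
  (fun k => (measurable_EFinP _ _).2 (mg k)) (fun k x Bx => g0 k x Bx).
have e' : (fun k => \int[mu]_(x in A k) (f x)%:E)%E = (fun k => \int[mu]_(x in B k) (g x)%:E)%E.
  by apply/funext.
rewrite e' in ca; exact: (cvg_unique (@ereal_hausdorff R) ca cb).
Qed.

(** The factor [a] serves the values 1, for the whole half-line, and 1/2, for the
    substitution [x = r^2] on its upper part. *)
Lemma integral_exp_segment G (a c d : R) : 0 < a -> c <= d ->
  (forall x, 0 < x -> {for x, continuous G}) ->
  (\int[mu]_(x in `[expR (a * c), expR (a * d)]) (G x)%:E =
   \int[mu]_(s in `[c, d]) (G (expR (a * s)) * (expR (a * s) * a))%:E)%E.
Proof.
move=> a0 cd cG; pose F s := expR (a * s).
have dF s : is_derive s (1 : R) F (expR (a * s) * a).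
  have h : is_derive s (1 : R) (fun y : R => a * y) a.
    by have := is_derive_mulcf a (is_derive_id s (1:R)); rewrite mulr1.
  exact: (is_derive_compf expR (fun y => a * y) (is_derive_expR _) h).
have F'E : (derive1 F) = fun s => expR (a * s) * a.
  by apply/funext => s; rewrite derive1E (@derive_val _ _ _ _ _ _ _ (dF s)).
have cF s : {for s, continuous F}.
  by apply/differentiable_continuous/derivable1_diffP; have [] := dF s.
have cF' s : {for s, continuous (derive1 F)}.
  rewrite F'E; apply: cvgM; [exact: cF|exact: cvg_cst].
have := @integration_by_substitution_increasing R F G c d cd.
rewrite F'E => ->//.
- by move=> x y _ _ xy; rewrite /F ltr_expR ltr_pM2l.
- by move=> s _; rewrite -F'E; exact: cF'.
- by rewrite -F'E; apply/cvg_ex; eexists; apply: cvg_at_right_filter; exact: cF'.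
- by rewrite -F'E; apply/cvg_ex; eexists; apply: cvg_at_left_filter; exact: cF'.
- split.
  + by move=> s _; have [] := dF s.
  + by apply: cvg_at_right_filter; exact: cF.
  + by apply: cvg_at_left_filter; exact: cF.
- apply: continuous_in_subspaceT => x; rewrite inE/= in_itv/= => /andP[xc _].
  by apply: cG; apply: lt_le_trans xc; exact: expR_gt0.
Qed.

Lemma measurable_positive_itv G (i : interval R) :
  (forall x, 0 < x -> {for x, continuous G}) -> (forall x, x \in i -> 0 < x) ->
  measurable_fun [set` i] G.
Proof.
move=> cG i0.
have h : measurable_fun (`]0, +oo[%classic : set R) G.
  apply: open_continuous_measurable_fun; first exact: interval_open.
  by move=> x; rewrite inE/= in_itv/= andbT; exact: cG.
apply: measurable_funS h; first exact: measurable_itv.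
by move=> x /= /i0; rewrite in_itv/= andbT.
Qed.

Let exp_cont G (a : R) : (forall x, 0 < x -> {for x, continuous G}) ->
  continuous (fun s => G (expR (a * s)) * (expR (a * s) * a)).
Proof.
move=> cG s; have c1 : (fun s => expR (a * s)) y @[y --> s] --> expR (a * s).
  apply: (@continuous_cvg _ _ _ _ _ (fun y => a * y) expR); first exact: continuous_expR.
  exact: mulrl_continuous.
apply: cvgM; last by apply: cvgM c1 _; exact: cvg_cst.
by apply: (@continuous_cvg _ _ _ _ _ (fun y => expR (a * y)) G) c1; apply: cG; exact: expR_gt0.
Qed.

Let nat_between (x : R) : exists k : nat, - k%:R <= x <= k%:R.
Proof.
exists `|Num.ceil `|x| |%N; rewrite natr_absz ger0_norm; last first.
  by rewrite ceil_ge0; apply: lt_le_trans (normr_ge0 x); rewrite oppr_lt0.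
have := ceil_ge `|x|; have := ler_norm x; have := ler_norm (- x); rewrite normrN.
by lra.
Qed.

(** The substitution [x = e^s], on the segments [[-k, k]] that exhaust the line. *)
Lemma integral_exp_line G :
  (forall x, 0 < x -> {for x, continuous G}) -> (forall x, 0 < x -> 0 <= G x) ->
  (\int[mu]_(x in `]0%R, +oo[) (G x)%:E = \int[mu]_s (G (expR s) * expR s)%:E)%E.
Proof.
move=> cG G0.
pose A (k : nat) : set R := `[expR (1 * - k%:R), expR (1 * k%:R)]%classic.
pose B (k : nat) : set R := `[- k%:R, k%:R]%classic.
have -> : [set` (`]0, +oo[ : interval R)] = \bigcup_k A k.
  apply/seteqP; split => x /=.
    rewrite in_itv/= andbT => x0; have [k hk] := nat_between (ln x).
    by exists k => //; rewrite /A/= in_itv/= !mul1r -[x]lnK ?posrE// !ler_expR.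
  move=> [k _]; rewrite /A/= !in_itv/= andbT => /andP[h _].
  by apply: lt_le_trans h; exact: expR_gt0.
have -> : [set: R] = \bigcup_k B k.
  apply/seteqP; split => x //= _; have [k hk] := nat_between x.
  by exists k => //; rewrite /B/= in_itv.
apply: eq_integral_exhaustion.
- move=> i j ij; apply/subsetPset => x; rewrite /A/= !in_itv/= => /andP[h1 h2].
  have ijR : i%:R <= j%:R :> R by rewrite ler_nat.
  by rewrite (le_trans _ h1) ?(le_trans h2)// ler_expR !mul1r// lerN2.
- move=> i j ij; apply/subsetPset => x; rewrite /B/= !in_itv/= => /andP[h1 h2].
  have ijR : i%:R <= j%:R :> R by rewrite ler_nat.
  by apply/andP; split; lra.
- by move=> k; exact: measurable_itv.
- by move=> k; exact: measurable_itv.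
- move=> k; apply: measurable_positive_itv => // x; rewrite in_itv/= => /andP[h _].
  by apply: lt_le_trans h; exact: expR_gt0.
- move=> k; apply: measurable_funTS; apply: continuous_measurable_fun.
  rewrite (_ : (fun s : R => _) = (fun s => G (expR (1 * s)) * (expR (1 * s) * 1))); first exact: exp_cont.
  by apply/funext => s; rewrite mul1r mulr1.
- move=> k x; rewrite /A/= in_itv/= => /andP[h _]; apply: G0.
  by apply: lt_le_trans h; exact: expR_gt0.
- by move=> k x _; rewrite mulr_ge0 ?expR_ge0// G0// expR_gt0.
- move=> k; rewrite integral_exp_segment//; last by have : 0 <= k%:R :> R by []; lra.
  by apply: eq_integral => s _; rewrite mul1r mulr1.
Qed.

Lemma integral_exp_half G :
  (forall x, 0 < x -> {for x, continuous G}) -> (forall x, 0 < x -> 0 <= G x) ->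
  (\int[mu]_(x in `[1%R, +oo[) (G x)%:E =
   \int[mu]_(s in [set s | (0 <= s)%R]) (G (expR (s / 2)) * (expR (s / 2) / 2))%:E)%E.
Proof.
move=> cG G0.
pose A (k : nat) : set R := `[expR (2^-1 * 0), expR (2^-1 * (2 * k%:R))]%classic.
pose B (k : nat) : set R := `[0, 2 * k%:R]%classic.
have -> : [set` (`[1, +oo[ : interval R)] = \bigcup_k A k.
  apply/seteqP; split => x /=.
    rewrite in_itv/= andbT => x1; have x0 : 0 < x by lra.
    have [k /andP[_ hk]] := nat_between (ln x).
    exists k => //; rewrite /A/= in_itv/= mulr0 expR0 x1/= mulKf//.
    by rewrite -[x]lnK ?posrE// ler_expR.
  by move=> [k _]; rewrite /A/= !in_itv/= andbT mulr0 expR0 => /andP[].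
have -> : [set s : R | 0 <= s] = \bigcup_k B k.
  apply/seteqP; split => x /= => [x0|[k _]]; last by rewrite /B/= in_itv/= => /andP[].
  have [k hk] := nat_between x.
  by exists k => //; rewrite /B/= in_itv/=; apply/andP; split; lra.
have A1 k x : A k x -> 0 < x.
  by rewrite /A/= in_itv/= => /andP[h _]; apply: lt_le_trans h; exact: expR_gt0.
apply: eq_integral_exhaustion.
- move=> i j ij; apply/subsetPset => x; rewrite /A/= !in_itv/= => /andP[-> h2].
  have ijR : i%:R <= j%:R :> R by rewrite ler_nat.
  by rewrite (le_trans h2)// ler_expR; lra.
- move=> i j ij; apply/subsetPset => x; rewrite /B/= !in_itv/= => /andP[-> h2].
  have ijR : i%:R <= j%:R :> R by rewrite ler_nat.
  by apply: le_trans h2 _; lra.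
- by move=> k; exact: measurable_itv.
- by move=> k; exact: measurable_itv.
- by move=> k; apply: measurable_positive_itv => // x hx; exact: (A1 k).
- move=> k; apply: measurable_funTS; apply: continuous_measurable_fun.
  rewrite (_ : (fun s : R => _) = (fun s => G (expR (2^-1 * s)) * (expR (2^-1 * s) * 2^-1))).
    exact: exp_cont.
  by apply/funext => s; rewrite [s / 2]mulrC.
- by move=> k x /A1; exact: G0.
- by move=> k x _; rewrite mulr_ge0 ?divr_ge0 ?expR_ge0// G0// expR_gt0.
- move=> k; have k0 : 0 <= 2 * k%:R :> R by rewrite mulr_ge0.
  have h2 : 0 < 2^-1 :> R by rewrite invr_gt0.
  rewrite (integral_exp_segment h2 k0 cG).
  by apply: eq_integral => s _; rewrite [s / 2]mulrC.
Qed.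

(** In the variable [s = ln x] the hypothesis says that [G(e^s) e^s] is even, and
    [s >= 0] corresponds to [r = e^(s/2) >= 1]. *)
Lemma integral_inversion_invariant G :
  (forall x, 0 < x -> {for x, continuous G}) -> (forall x, 0 < x -> 0 <= G x) ->
  (forall x, 0 < x -> G x^-1 = x ^+ 2 * G x) ->
  (\int[mu]_(x in `]0%R, +oo[) (G x)%:E =
   2%:E * \int[mu]_(r in `[1%R, +oo[) (2 * r * G (r ^+ 2))%:E)%E.
Proof.
move=> cG G0 inv; rewrite integral_exp_line// ge0_symfun_integralT.
- congr (_ * _)%E; rewrite integral_exp_half.
  + apply: eq_integral => s _; congr EFin.
    have -> : expR (s / 2) ^+ 2 = expR s by rewrite -expRM_natl; congr expR; field.
    have e : expR s = expR (s / 2) * expR (s / 2) by rewrite -expRD; congr expR; field.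
    by rewrite [in X in _ * X]e; field.
  + move=> x x0; apply: cvgM; first exact: mulrl_continuous.
    suff : {for x, continuous (G \o (fun y : R => y ^+ 2))} by [].
    by apply: continuous_comp; [exact: exprn_continuous|apply: cG; rewrite exprn_gt0].
  + by move=> x x0; rewrite mulr_ge0// ?G0 ?exprn_gt0// mulr_ge0// ltW.
- by move=> s; rewrite mulr_ge0 ?expR_ge0// G0// expR_gt0.
- rewrite (_ : (fun s : R => _) = (fun s => G (expR (1 * s)) * (expR (1 * s) * 1))); first exact: exp_cont.
  by apply/funext => s; rewrite mul1r mulr1.
- move=> s /=; rewrite expRN inv ?expR_gt0//.
  by have e0 := expR_gt0 s; field; lra.
Qed.

End Substitution.

(** * Continuity and symmetry of the integrand, Gaussian integrals *)

Section IntegrandRegularity.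
Variable R : realType.

Lemma d_integrand_continuous (n : nat) (x : R) : 0 < x -> {for x, continuous (d_integrand n.*2)}.
Proof.
move=> x0; set N := n.*2; pose b : R := N%:R + 3 / 2.
have b0 : 0 < b by have : 0 <= N%:R :> R by []; rewrite /b; lra.
have x1 : x + 1 != 0 by rewrite lt0r_neq0//; lra.
have cadd : {for x, continuous (fun y : R => y + 1)}.
  by apply: cvgD; [exact: cvg_id|exact: cvg_cst].
have cz : {for x, continuous (fun y : R => (y - 1) / (y + 1))}.
  apply: cvgM; last by apply: cvgV.
  by apply: cvgB; [exact: cvg_id|exact: cvg_cst].
have cp : {for x, continuous (fun y : R => (y + 1) `^ (3 / 2))}.
  apply: (@continuous_comp _ _ _ (fun y : R => y + 1) (fun y => y `^ (3 / 2))) => //.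
  apply/differentiable_continuous/derivable1_diffP; apply: derivable_powR.
  by rewrite in_itv/= andbT; lra.
have z1 : `|((x - 1) / (x + 1)) ^+ 2| < 1.
  rewrite ger0_norm ?sqr_ge0// expr_div_n ltr_pdivrMr ?mul1r; last by rewrite exprn_gt0//; lra.
  by rewrite !expr2; nra.
have cF : {for x, continuous (fun y : R => hyp2F1 (N%:R / 2 + 3 / 4) (N%:R / 2 + 5 / 4) (N%:R + 2)
    (((y - 1) / (y + 1)) ^+ 2))}.
  have -> : N%:R / 2 + 3 / 4 = b / 2 by rewrite /b; field.
  have -> : N%:R / 2 + 5 / 4 = b / 2 + 1 / 2 by rewrite /b; field.
  have -> : N%:R + 2 = b + 1 / 2 by rewrite /b; field.
  rewrite hyp2F1E -[hyp2F1_coef _ _ _]/(tcoef b).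
  apply: (@continuous_comp _ _ _ (fun y : R => ((y - 1) / (y + 1)) ^+ 2) (psum (tcoef b))).
    by apply: (@continuous_comp _ _ _ (fun y : R => (y - 1) / (y + 1)) (fun y => y ^+ 2)) => //; exact: exprn_continuous.
  by apply: psum_continuous z1; exact: tempered_tcoef.
have czN : {for x, continuous (fun y : R => ((y - 1) / (y + 1)) ^+ N)}.
  by apply: (@continuous_comp _ _ _ (fun y : R => (y - 1) / (y + 1)) (fun y => y ^+ N)) => //; exact: exprn_continuous.
apply: cvgM cF; apply: cvgM czN; apply: cvgM; first exact: omega_continuous.
by apply: cvgV cp; rewrite lt0r_neq0// powR_gt0//; lra.
Qed.

(** The inversion changes the sign of [(x-1)/(x+1)], of which only even powers
    occur, and the factors [sqrt x] from [omega] and [x^(3/2)] from the denominator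
    combine to [x^2]. *)
Lemma d_integrand_inversion (n : nat) (x : R) : 0 < x ->
  d_integrand n.*2 x^-1 = x ^+ 2 * d_integrand n.*2 x.
Proof.
move=> x0; rewrite /d_integrand omega_inversion//.
have zi : (x^-1 - 1) / (x^-1 + 1) = - ((x - 1) / (x + 1)) by field; lra.
rewrite zi sqrrN.
have -> : (- ((x - 1) / (x + 1))) ^+ n.*2 = ((x - 1) / (x + 1)) ^+ n.*2.
  by rewrite -mul2n !exprM sqrrN.
have -> : (x^-1 + 1) `^ (3 / 2) = (x + 1) `^ (3 / 2) / (x * Num.sqrt x).
  have -> : x^-1 + 1 = (x + 1) / x by field; lra.
  rewrite powRM ?invr_ge0 ?(ltW x0)//; last by lra.
  have -> : x^-1 `^ (3 / 2) = (x * Num.sqrt x)^-1.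
    have -> : x^-1 = x `^ (- 1) by rewrite powR_inv1// ltW.
    by rewrite -powRrM mulN1r powRN powR_3half// ltW.
  by [].
have s0 : 0 < Num.sqrt x by rewrite sqrtr_gt0.
have p0 : 0 < (x + 1) `^ (3 / 2) by rewrite powR_gt0//; lra.
have xs : x = Num.sqrt x ^+ 2 by rewrite sqr_sqrtr// ltW.
move: (hyp2F1 _ _ _ _) (omega x) (((x - 1) / (x + 1)) ^+ n.*2) => F W Z.
transitivity (Num.sqrt x ^+ 2 * x * W / (x + 1) `^ (3 / 2) * Z * F).
  by field; lra.
by rewrite -xs; field; lra.
Qed.

Notation mu := (@lebesgue_measure R).

(** The density of the normal law of mean [m] and variance [1 / (2 a)], rescaled. *)
Lemma gaussian_integral (a m : R) : 0 < a ->
  mu.-integrable setT (fun r => (expR (- (a * (r - m) ^+ 2)))%:E) /\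
  \int[mu]_r expR (- (a * (r - m) ^+ 2)) = Num.sqrt (pi / a).
Proof.
move=> a0; pose s := Num.sqrt (2 * a)^-1.
have p0 := pi_gt0 R.
have s20 : 0 < (2 * a)^-1 by rewrite invr_gt0 mulr_gt0.
have s0 : s != 0 by rewrite lt0r_neq0// sqrtr_gt0.
have s2 : s ^+ 2 = (2 * a)^-1 by rewrite sqr_sqrtr// ltW.
have q0 : 0 < Num.sqrt (pi / a) by rewrite sqrtr_gt0 divr_gt0.
have e r : expR (- (a * (r - m) ^+ 2)) = Num.sqrt (pi / a) * normal_pdf m s r.
  rewrite normal_pdfE// /normal_peak s2 /normal_fun.
  have -> : (2 * a)^-1 * pi *+ 2 = pi / a by rewrite -mulr_natr; field; lra.
  rewrite [RHS]mulrA divff ?mul1r ?lt0r_neq0//; congr expR.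
  by rewrite s2 -mulr_natr; field; lra.
have e' : (fun r => (expR (- (a * (r - m) ^+ 2)))%:E) =
    (fun r => (Num.sqrt (pi / a))%:E * (normal_pdf m s r)%:E)%E.
  by apply/funext => r; rewrite e EFinM.
split; first by rewrite e'; apply: integrableZl => //; exact: integrable_normal_pdf.
under eq_Rintegral do rewrite e.
rewrite RintegralZl//; last exact: integrable_normal_pdf.
by rewrite /Rintegral integral_normal_pdf/= mulr1.
Qed.

End IntegrandRegularity.

(** * The integral of the density *)

Section Asymptotics.
Variable R : realType.
Notation mu := (@lebesgue_measure R).

Lemma Rintegral_near_gaussian (phi : R -> R) (K P a c m : R) :
  0 < a -> 0 < c -> measurable_fun setT phi ->
  (forall r, `|phi r - P * expR (- (a * (r - m) ^+ 2))| <= K * expR (- (c * (r - m) ^+ 2))) ->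
  mu.-integrable setT (EFin \o phi) /\
  `|\int[mu]_r phi r - P * Num.sqrt (pi / a)| <= K * Num.sqrt (pi / c).
Proof.
move=> a0 c0 mphi h.
have [ia ea] := gaussian_integral m a0; have [ic ec] := gaussian_integral m c0.
pose psi r := P * expR (- (a * (r - m) ^+ 2)).
pose dom r := K * expR (- (c * (r - m) ^+ 2)).
have ipsi : mu.-integrable setT (EFin \o psi) by exact: (integrableZl measurableT P ia).
have idom : mu.-integrable setT (EFin \o dom) by exact: (integrableZl measurableT K ic).
have iphi : mu.-integrable setT (EFin \o phi).
  have isum : mu.-integrable setT (fun r => (`|psi r| + dom r)%:E).
    have : mu.-integrable setT (abse \o (EFin \o psi)) by exact: integrable_abse.
    by move=> i1; exact: (integrableD measurableT i1 idom).
  apply: le_integrable isum => //; first exact/measurable_EFinP.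
  move=> r _; rewrite /= lee_fin; have := h r; rewrite -/(psi r) -/(dom r) => hr.
  have -> : phi r = (phi r - psi r) + psi r by ring.
  apply: le_trans (ler_normD _ _) _; apply: le_trans (ler_norm _).
  by rewrite addrC lerD2l.
split=> //.
have <- : \int[mu]_r psi r = P * Num.sqrt (pi / a) by rewrite -ea RintegralZl.
have <- : \int[mu]_r dom r = K * Num.sqrt (pi / c) by rewrite -ec RintegralZl.
rewrite -RintegralB//.
have idiff : mu.-integrable setT (EFin \o (fun r => phi r - psi r)).
  exact: (integrableB measurableT iphi ipsi).
apply: le_trans (le_normr_Rintegral measurableT idiff) _.
by apply: le_Rintegral => //; exact: (integrable_abse idiff).
Qed.

(** The integrand of [d_(2n)] on [x >= 1], in the variable [r = sqrt x], divided by
    its size at the maximum. *)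
Definition saddle_density (n : nat) (al r : R) : R :=
  if 1 <= r then
    2 * r * d_integrand n.*2 (r ^+ 2) / (Num.sqrt 2 * 2 ^+ n.*2) / saddle_scale al
  else 0.

Lemma saddle_scale_gt0 (al : R) : 0 < al -> 0 < saddle_scale al.
Proof.
by move=> a0; rewrite /saddle_scale !mulr_gt0 ?exprn_gt0 ?sqrtr_gt0 ?expR_gt0 ?pi_gt0.
Qed.

Lemma integral_saddle_density (n : nat) (al : R) : 0 < al ->
  measurable_fun setT (saddle_density n al) /\
  (mu.-integrable setT (EFin \o saddle_density n al) ->
   \int[mu]_(x in `]0, +oo[) d_integrand n.*2 x =
   2 * (Num.sqrt 2 * 2 ^+ n.*2 * saddle_scale al) * \int[mu]_r saddle_density n al r).
Proof.
move=> al0; set N := n.*2; pose kappa := Num.sqrt 2 * 2 ^+ N * saddle_scale al.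
have s0 := saddle_scale_gt0 al0.
have c0 : 0 < Num.sqrt 2 * 2 ^+ N :> R by rewrite mulr_gt0 ?exprn_gt0// sqrtr_gt0.
have k0 : 0 < kappa by rewrite mulr_gt0.
pose f (r : R) : R := 2 * r * d_integrand N (r ^+ 2).
have fE : f \_ `[1, +oo[ = (fun r => kappa * saddle_density n al r).
  apply/funext => r; rewrite patchE mem_setE in_itv/= andbT /saddle_density.
  case: ifP => _; last by rewrite mulr0.
  rewrite /f -/N /kappa; move: (Num.sqrt 2 * 2 ^+ N) c0 (saddle_scale al) s0 => c c0' s s0'.
  by field; lra.
have cf (x : R) : 0 < x -> {for x, continuous f}.
  move=> x0; apply: cvgM; first exact: mulrl_continuous.
  suff : {for x, continuous (d_integrand N \o (fun y : R => y ^+ 2))} by [].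
  apply: continuous_comp; first exact: exprn_continuous.
  by apply: d_integrand_continuous; rewrite exprn_gt0.
have mf : measurable_fun (`[1, +oo[%classic : set R) f.
  by apply: measurable_positive_itv => // x; rewrite in_itv/= andbT; lra.
have mk : measurable_fun setT (fun r => kappa * saddle_density n al r).
  rewrite -fE; exact: (measurable_restrictT f (measurable_itv `[1, +oo[)).1 mf.
have mphi : measurable_fun setT (saddle_density n al).
  have -> : saddle_density n al = (fun r => kappa^-1 * (kappa * saddle_density n al r)).
    by apply/funext => r; rewrite mulKf// lt0r_neq0.
  by apply: measurable_funM => //; exact: measurable_cst.
split=> // iphi.
have cd (x : R) : 0 < x -> {for x, continuous (d_integrand N)} by exact: d_integrand_continuous.
have sqE (x : R) : 0 < x -> x = Num.sqrt x ^+ 2 by move=> x0; rewrite sqr_sqrtr// ltW.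
have d0 (x : R) : 0 < x -> 0 <= d_integrand N x.
  by move=> x0; rewrite (sqE x x0); apply: d_integrand_ge0; rewrite sqrtr_gt0.
have di (x : R) : 0 < x -> d_integrand N x^-1 = x ^+ 2 * d_integrand N x.
  exact: d_integrand_inversion.
have e1 : (\int[mu]_(r in `[1%R, +oo[) (f r)%:E = kappa%:E * \int[mu]_r (saddle_density n al r)%:E)%E.
  rewrite -integralZl// [LHS]integral_mkcond; apply: eq_integral => r _.
  have := congr1 (fun g => g r) fE; rewrite /= -EFinM => <-.
  by rewrite !patchE; case: ifP.
rewrite /Rintegral (integral_inversion_invariant cd d0 di) -[in LHS]/(f _) e1.
by rewrite !fineM ?fin_numM ?integrable_fin_num//= mulrA.
Qed.

End Asymptotics.

(** * The normalising factor and the main term *)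

Section Assembly.
Variable R : realType.
Notation mu := (@lebesgue_measure R).

(** [(3/2)_N = (2 N + 1) (1/2)_N], and [(1/2)_N / N!] is the central binomial
    coefficient over [4^N]. *)
Lemma pochhammer_central (N : nat) :
  pochhammer (3 / 2) N / N`!%:R = (2 * N%:R + 1) * central R N.
Proof.
elim: N => [|N IH].
  by rewrite /pochhammer big_ord0 fact0 /central double0 bin0 expr0 mulr0 add0r !divr1 mulr1.
have f0 : N`!%:R != 0 :> R by rewrite pnatr_eq0 -lt0n fact_gt0.
have n0 : 0 <= N%:R :> R by [].
have n1 : N.+1%:R = N%:R + 1 :> R by rewrite natr1.
rewrite centralS pochhammerS factS natrM n1.
have -> : pochhammer (3 / 2) N * (3 / 2 + N%:R) / ((N%:R + 1) * N`!%:R) =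
   (pochhammer (3 / 2) N / N`!%:R) * ((3 / 2 + N%:R) / (N%:R + 1)) :> R.
  by field; rewrite f0 lt0r_neq0//; lra.
by rewrite IH; move: (central _ _) => c; field; lra.
Qed.

Lemma prefactor_bounds (N : nat) : (0 < N)%N ->
  2 * Num.sqrt (N%:R / pi) <= (2 * N%:R + 1) * central R N
    <= 2 * Num.sqrt (N%:R / pi) * (1 + 1 / (2 * N%:R)).
Proof.
move=> N0; have n0 : 0 < N%:R :> R by rewrite ltr0n.
have p0 := pi_gt0 R; have c0 := central_gt0 R N.
have s0 : 0 < Num.sqrt (N%:R / pi) :> R by rewrite sqrtr_gt0 divr_gt0.
have s2 : Num.sqrt (N%:R / pi) ^+ 2 = N%:R / pi :> R by rewrite sqr_sqrtr// divr_ge0// ltW.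
have := wallis_ge R N0; have := wallis_le R N0; rewrite wallisE => lo hi.
have b0 : 0 <= (2 * N%:R + 1) * central R N by rewrite mulr_ge0 ?(ltW c0)//; lra.
have i0 : 0 < (2 * N%:R)^-1 :> R by rewrite invr_gt0 mulr_gt0.
have s20 : 0 <= 2 * Num.sqrt (N%:R / pi) :> R by rewrite mulr_ge0// ltW.
have s21 : 0 <= 2 * Num.sqrt (N%:R / pi) * (1 + 1 / (2 * N%:R)) :> R.
  by apply: mulr_ge0 => //; rewrite div1r; lra.
apply/andP; split.
  rewrite -(@ler_pXn2r _ 2) ?nnegrE//.
  rewrite 2!exprMn s2; apply: (@le_trans _ _ ((2 * N%:R + 1) ^+ 2 / ((N%:R + 1 / 2) * pi))).
    rewrite ler_pdivlMr; last by rewrite mulr_gt0//; lra.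
    have -> : 2 ^+ 2 * (N%:R / pi) * ((N%:R + 1 / 2) * pi) = 4 * N%:R * (N%:R + 1 / 2) :> R.
      by field; lra.
    by rewrite expr2; nra.
  apply: ler_wpM2l; first exact: sqr_ge0.
  by rewrite invfM [leLHS]mulrC ler_pdivrMr; [exact: lo|lra].
rewrite -(@ler_pXn2r _ 2) ?nnegrE//.
have -> : (2 * Num.sqrt (N%:R / pi) * (1 + 1 / (2 * N%:R))) ^+ 2 =
    (2 * N%:R + 1) ^+ 2 * (pi^-1 / N%:R) :> R.
  by rewrite !exprMn s2; field; lra.
rewrite exprMn; apply: ler_wpM2l; first exact: sqr_ge0.
by rewrite ler_pdivlMr.
Qed.

Lemma d_coefE (n : nat) (al : R) : 0 < al ->
  mu.-integrable setT (EFin \o saddle_density n al) ->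
  d_coef R (2 * n) = 8 * saddle_scale al * ((2 * n.*2%:R + 1) * central R n.*2)
    * \int[mu]_r saddle_density n al r.
Proof.
move=> al0 iphi; have [_ /(_ iphi) e] := integral_saddle_density n al0.
rewrite /d_coef mul2n; set N := n.*2 in e *; rewrite e -pochhammer_central.
have t0 : 0 < 2 `^ (N%:R - 3 / 2) :> R by rewrite powR_gt0.
(* [sqrt 2 2^N / 2^(N - 3/2) = 4]; the other factor 2 of the constant 8 comes from the symmetry. *)
have tE : 2 `^ (N%:R - 3 / 2) * 4 = Num.sqrt 2 * 2 ^+ N :> R.
  rewrite -powR12_sqrt// -[2 ^+ N]powR_mulrn//.
  have -> : 4 = 2 `^ 2 :> R by rewrite powR_mulrn// expr2; ring.
  by rewrite -!powRD; [congr (_ `^ _); field|rewrite pnatr_eq0/= implybT..].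
have f0 : N`!%:R != 0 :> R by rewrite pnatr_eq0 -lt0n fact_gt0.
rewrite -tE; move: (saddle_scale al) (\int[mu]_r _) => s J.
by field; rewrite f0 lt0r_neq0.
Qed.

(** The minimiser of the exponent [pi r^2 + 4 n / r]: its derivative vanishes when
    [pi r^3 = 2 n]. *)
Definition saddle_radius (n : nat) : R := (2 * n%:R / pi) `^ (1 / 3).

Lemma saddle_radius_cubed n : pi * saddle_radius n ^+ 3 = 2 * n%:R.
Proof.
have p0 := pi_gt0 R.
have x0 : 0 <= 2 * n%:R / pi :> R by rewrite divr_ge0 ?mulr_ge0// ltW.
rewrite /saddle_radius -powR_mulrn ?powR_ge0// -powRrM.
have -> : 1 / 3 * 3 = 1 :> R by field.
by rewrite powRr1//; field; lra.
Qed.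

(** [sqrt (1/3)] is the Gaussian integral [sqrt (pi / (3 pi))], and [exp (- 2 pi / 3)]
    the limit of the non-Gaussian factor. *)
Lemma main_termE (n : nat) (al : R) : 0 < al -> 2 * n%:R = pi * al ^+ 3 ->
  8 * saddle_scale al * (2 * Num.sqrt (n.*2%:R / pi)) * (expR (- (2 * pi / 3)) / Num.sqrt 3) =
  constD R * n%:R `^ (4 / 3) * expR (- (constE R * n%:R `^ (2 / 3))).
Proof.
move=> a0 na; have p0 := pi_gt0 R.
have nE : n%:R = pi / 2 * al ^+ 3 by lra.
have al3 (t : R) : (al ^+ 3) `^ (t / 3) = al `^ t.
  rewrite -(powR_mulrn 3 (ltW a0)) -powRrM.
  by have -> : 3%:R * (t / 3) = t by field.
have n43 : n%:R `^ (4 / 3) = (pi / 2) `^ (4 / 3) * al ^+ 4.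
  by rewrite nE powRM ?exprn_ge0 ?(ltW a0) ?divr_ge0 ?(ltW p0)// al3 powR_mulrn// ltW.
have n23 : n%:R `^ (2 / 3) = (pi / 2) `^ (2 / 3) * al ^+ 2.
  by rewrite nE powRM ?exprn_ge0 ?(ltW a0) ?divr_ge0 ?(ltW p0)// al3 powR_mulrn// ltW.
have p2 : 0 < pi / 2 :> R by lra.
have e1 : (4 * pi) `^ (1 / 3) * (pi / 2) `^ (2 / 3) = pi :> R.
  have -> : 4 * pi = (pi / 2) * 2 ^+ 3 :> R by rewrite !exprS expr0; field.
  rewrite powRM ?exprn_ge0 ?(ltW p2)// mulrAC -powRD; last by rewrite (lt0r_neq0 p2) implybT.
  have -> : 1 / 3 + 2 / 3 = 1 :> R by field.
  rewrite powRr1 ?(ltW p2)// -powR_mulrn// -powRrM.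
  have -> : 3 * (1 / 3) = 1 :> R by field.
  by rewrite powRr1//; field.
have e2 : 2 `^ (1 / 3) * pi `^ (2 / 3) * (pi / 2) `^ (4 / 3) = pi ^+ 2 / 2 :> R.
  have pE : pi `^ (2 / 3) = (pi / 2) `^ (2 / 3) * 2 `^ (2 / 3) :> R.
    by rewrite -powRM ?(ltW p2)//; congr (_ `^ _); field.
  have -> : 2 `^ (1 / 3) * pi `^ (2 / 3) * (pi / 2) `^ (4 / 3) =
     (2 `^ (1 / 3) * 2 `^ (2 / 3)) * ((pi / 2) `^ (2 / 3) * (pi / 2) `^ (4 / 3)) :> R.
    by rewrite pE; ring.
  rewrite -!powRD ?(lt0r_neq0 p2) ?pnatr_eq0 ?implybT//.
  have -> : 1 / 3 + 2 / 3 = 1 :> R by field.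
  have -> : 2 / 3 + 4 / 3 = 2 :> R by field.
  by rewrite powRr1// powR_mulrn ?(ltW p2)// !expr2; field.
have s3 : 0 < Num.sqrt 3 :> R by rewrite sqrtr_gt0.
have sN : Num.sqrt (n.*2%:R / pi) = al * Num.sqrt al.
  have -> : n.*2%:R / pi = al ^+ 2 * al.
    by rewrite -muln2 natrM nE; field; lra.
  by rewrite sqrtrM ?sqr_ge0// sqrtr_sqr ger0_norm// ltW.
have sa : Num.sqrt al * Num.sqrt al = al by rewrite -expr2 sqr_sqrtr// ltW.
rewrite /constD /constE /saddle_scale sN n43 n23.
have -> : 3 * (4 * pi) `^ (1 / 3) * ((pi / 2) `^ (2 / 3) * al ^+ 2) = 3 * pi * al ^+ 2 :> R.
  by rewrite -[in RHS]e1; ring.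
have -> : 128 * 2 `^ (1 / 3) * pi `^ (2 / 3) * expR (- (2 * pi / 3)) / Num.sqrt 3 *
    ((pi / 2) `^ (4 / 3) * al ^+ 4) =
  128 * (2 `^ (1 / 3) * pi `^ (2 / 3) * (pi / 2) `^ (4 / 3)) * (expR (- (2 * pi / 3)) / Num.sqrt 3)
   * al ^+ 4 by ring.
rewrite e2; move: (expR _) (expR _) => X Y.
have -> : al ^+ 4 = al ^+ 3 * (Num.sqrt al * Num.sqrt al) by rewrite sa; ring.
by field; lra.
Qed.

End Assembly.

(** * The relative error *)

Section RelativeError.
Variable R : realType.

Lemma relative_error_mul (X Y Ya C al : R) : 1 <= al -> 0 <= C -> 0 < Ya ->
  1 <= X <= 1 + 1 / al -> `|Y - Ya| <= C / al ->
  `|X * (Y / Ya) - 1| <= (1 + 2 * C / Ya) / al.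
Proof.
move=> a1 C0 y0 /andP[x1 x2] hy.
have a0 : 0 < al by lra.
have i0 : 0 < al^-1 by rewrite invr_gt0.
have i1 : al^-1 <= 1 by rewrite invf_le1.
have -> : X * (Y / Ya) - 1 = (X - 1) + X * ((Y - Ya) / Ya) by field; rewrite lt0r_neq0.
apply: le_trans (ler_normD _ _) _.
have -> : (1 + 2 * C / Ya) / al = 1 / al + 2 * ((C / al) / Ya) by field; rewrite !lt0r_neq0.
apply: lerD; first by rewrite ger0_norm; lra.
rewrite normrM ger0_norm; last by lra.
rewrite div1r in x2; apply: ler_pM => //; [by lra|by lra|].
rewrite normrM (ger0_norm (_ : 0 <= Ya^-1)) ?invr_ge0 ?(ltW y0)//.
by rewrite ler_wpM2r// invr_ge0 ltW.
Qed.

(** The threshold 128 makes [al^3 = 2 n / pi >= n / 2] at least [4^3]. The error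
    [1 / al] is of order [n^(-1/3)], better than the exponent required. *)
Lemma saddle_radius_ge (n : nat) : (128 <= n)%N ->
  4 <= saddle_radius R n /\ 1 / saddle_radius R n <= 2 * n%:R `^ (- (1 / 10)) :> R.
Proof.
move=> n128; have p0 := pi_gt0 R; have p4 := pi_le4 R.
have nR : 128 <= n%:R :> R by rewrite ler_nat.
have h : n%:R / 2 <= 2 * n%:R / pi :> R by rewrite ler_pdivlMr//; nra.
have b0 (x : R) : 0 <= x -> (x ^+ 3) `^ (1 / 3) = x.
  move=> x0; rewrite -(powR_mulrn 3 x0) -powRrM.
  have -> : 3%:R * (1 / 3) = 1 :> R by field.
  by rewrite powRr1.
split.
  rewrite -(b0 4)// ge0_ler_powR// ?nnegrE//; first by rewrite divr_ge0 ?mulr_ge0// ltW.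
  by rewrite !exprS expr0; lra.
have n0 : 0 < n%:R :> R by lra.
set m := n%:R `^ (1 / 3) : R.
have m0 : 0 < m by rewrite powR_gt0.
have m3 : m ^+ 3 = n%:R.
  rewrite -(powR_mulrn 3 (ltW m0)) -powRrM.
  have -> : 1 / 3 * 3%:R = 1 :> R by field.
  by rewrite powRr1// ltW.
have h2 : m / 2 <= saddle_radius R n.
  rewrite -[leLHS]b0; last by rewrite divr_ge0// ltW.
  apply: ge0_ler_powR => //; rewrite ?nnegrE ?exprn_ge0 ?divr_ge0 ?mulr_ge0 ?(ltW m0) ?(ltW p0)//.
  have -> : (m / 2) ^+ 3 = m ^+ 3 / 8 by field.
  by rewrite m3; lra.
rewrite div1r; apply: (@le_trans _ _ (m / 2)^-1).
  have m2 : 0 < m / 2 by rewrite divr_gt0.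
  by rewrite lef_pV2 ?posrE// (lt_le_trans m2 h2).
have -> : (m / 2)^-1 = 2 * m^-1 by field; rewrite lt0r_neq0.
rewrite /m -powRN; apply: ler_wpM2l => //.
by apply: ler_powR; lra.
Qed.

Lemma fourfold_ge_saddle_radius (n : nat) (al : R) :
  4 <= al -> 2 * n%:R = pi * al ^+ 3 -> al <= 2 * n.*2%:R.
Proof.
move=> a4 na; have p2 := pi_ge2 R; have a1 : 1 <= al by lra.
have a3 : 0 <= al ^+ 3 by rewrite exprn_ge0//; lra.
rewrite -muln2 natrM [n%:R * 2]mulrC na.
apply: le_trans (ler_eXnr (isT : (0 < 3)%N) a1) _; nra.
Qed.

End RelativeError.

Theorem theorem5p3 (R : realType) :
  exists eps : nat -> R,
    (eps =O_\oo (fun n : nat => n%:R `^ (- (1 / 10)) : R)) /\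
    (\forall n \near \oo,
       d_coef R (2 * n) =
       (1 + eps n) * constD R * n%:R `^ (4 / 3)
       * expR (- (constE R * n%:R `^ (2 / 3)))).
Proof.
pose M n := constD R * n%:R `^ (4 / 3) * expR (- (constE R * n%:R `^ (2 / 3))).
exists (fun n => d_coef R (2 * n) / M n - 1).
have p0 := pi_gt0 R; have [K K0 omegaK] := omega_ratio R.
pose C := 3200 * (1 + K) * Num.sqrt (pi / 1).
pose Ya : R := expR (- (2 * pi / 3)) / Num.sqrt 3.
have s3 : 0 < Num.sqrt 3 :> R by rewrite sqrtr_gt0.
have Ya0 : 0 < Ya by rewrite divr_gt0 ?expR_gt0.
have C0 : 0 <= C by apply: mulr_ge0; [lra|exact: sqrtr_ge0].
have L0 : 0 < 1 + 2 * C / Ya.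
  by apply: ltr_pwDl; [exact: ltr01|apply: divr_ge0; [exact: mulr_ge0|exact: ltW]].
have M_gt0 n : (128 <= n)%N -> 0 < M n.
  move=> n128; have [a4 _] := saddle_radius_ge R n128.
  have a0 : 0 < saddle_radius R n by lra.
  rewrite /M -(main_termE a0 (esym (saddle_radius_cubed R n))).
  apply: mulr_gt0 => //; apply: mulr_gt0.
    by apply: mulr_gt0 => //; exact: saddle_scale_gt0.
  by apply: mulr_gt0 => //; rewrite sqrtr_gt0 divr_gt0// ltr0n double_gt0 (leq_trans _ n128).
have bound n : (128 <= n)%N ->
    `|d_coef R (2 * n) / M n - 1| <= (1 + 2 * C / Ya) / saddle_radius R n.
  move=> n128; have [] := saddle_radius_ge R n128.
  have := esym (saddle_radius_cubed R n); move: (saddle_radius R n) => al na a4 ai.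
  have a0 : 0 < al by lra.
  have ha (r : R) : `|saddle_density n al r - expR (- (2 * pi / 3)) * expR (- (3 * pi * (r - al) ^+ 2))|
      <= 3200 * (1 + K) / al * expR (- (1 * (r - al) ^+ 2)).
    by rewrite mul1r; exact: saddle_pointwise.
  have q0 : 0 < 3 * pi :> R by lra.
  have [iphi eJ] := Rintegral_near_gaussian q0 ltr01 (integral_saddle_density n a0).1 ha.
  have n2 : (0 < n.*2)%N by rewrite double_gt0 (leq_trans _ n128).
  have := prefactor_bounds R n2; rewrite (d_coefE a0 iphi) /M -(main_termE a0 na).
  move: (\int[_]_r _) eJ => J eJ.
  have sE : Num.sqrt (pi / (3 * pi)) = (Num.sqrt 3)^-1 :> R.
    by rewrite -sqrtrV//; congr Num.sqrt; field; lra.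
  have S0 : 0 < 2 * Num.sqrt (n.*2%:R / pi) :> R.
    by rewrite mulr_gt0// sqrtr_gt0 divr_gt0// ltr0n.
  move: (2 * Num.sqrt _) S0 (_ * central _ _) => S S0 B /andP[B1 B2].
  rewrite -/Ya sE in eJ *.
  have k0 := saddle_scale_gt0 a0.
  have -> : 8 * saddle_scale al * B * J / (8 * saddle_scale al * S * Ya) = B / S * (J / Ya).
    by field; rewrite !lt0r_neq0.
  apply: relative_error_mul => //; first by lra.
    apply/andP; split; first by rewrite ler_pdivlMr// mul1r.
    rewrite ler_pdivrMr// mulrC (le_trans B2)//.
    apply: ler_wpM2l; first exact: ltW.
    rewrite lerD2l !div1r lef_pV2 ?posrE ?mulr_gt0 ?ltr0n//.
    exact: fourfold_ge_saddle_radius.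
  by rewrite /C mulrAC.
split; last first.
  near=> n; have n128 : (128 <= n)%N by near: n; exact: nbhs_infty_ge.
  transitivity ((1 + (d_coef R (2 * n) / M n - 1)) * M n).
    by rewrite addrC subrK divfK// lt0r_neq0// M_gt0.
  by rewrite /M !mulrA.
apply/eqO_exP; exists ((1 + 2 * C / Ya) * 2).
  exact: mulr_gt0.
near=> n; have n128 : (128 <= n)%N by near: n; exact: nbhs_infty_ge.
have [_ ai] := saddle_radius_ge R n128; rewrite div1r in ai.
apply: le_trans (bound n n128) _.
rewrite (ger0_norm (powR_ge0 _ _)) -[leRHS]mulrA.
by apply: ler_wpM2l; [exact: ltW|exact: ai].
Unshelve. all: by end_near.
Qed.
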